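(* For all $p \in [1,\infty) \setminus 2\mathbb{Z}$, all integers $k > \max\{2,p\}$, and all $1/2 < s \le c < 1$, there exists a polynomial-time (Karp) reduction from $(s,c)$-Gap-$k$-Parity instances on $n$ variables to $\gamma$-$\mathrm{CVP}_p$ instances of rank $n$, with $\gamma = \gamma(p,k,s,c)$ satisfying \[ \gamma \ge 1 + (c-s)\cdot \frac{|\sin(\pi p/2)|}{4p^3 k}\cdot \Big(\frac{2p}{e^2\pi^2 k}\Big)^{(p+1)/2}. \]
   Context: For $1 \le p<\infty$, $\|\vec x\|_p = (\sum_i |x_i|^p)^{1/p}$. A lattice of rank $n$ is $\mathcal{L}(B) = B\mathbb{Z}^n$ for $B \in \mathbb{R}^{d\times n}$ with linearly independent columns; $\mathrm{dist}_p(\mathcal{L},\vec t) = \min_{\vec x\in\mathcal{L}}\|\vec x - \vec t\|_p$. For $\gamma \ge 1$, $\gamma$-$\mathrm{CVP}_p$ is the promise problem: given $B$, $\vec t \in \mathbb{R}^d$ and $r>0$, distinguish YES instances with $\mathrm{dist}_p(\mathcal{L}(B),\vec t)\le r$ from NO instances with $\mathrm{dist}_p(\mathcal{L}(B),\vec t) > \gamma r$. A $k$-Parity instance on variables $x_1,\dots,x_n$ is a list of $m$ constraints, each of the form $x_{i_1}\oplus\cdots\oplus x_{i_k} = b$ with $b\in\{0,1\}$; its value $\mathrm{val}$ is the maximum over assignments in $\{0,1\}^n$ of the fraction of constraints satisfied. $(s,c)$-Gap-$k$-Parity is the promise problem of distinguishing instances with $\mathrm{val} \ge c$ (YES) from those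 with $\mathrm{val} < s$ (NO). A Karp reduction maps YES instances to YES instances and NO instances to NO instances. *)

(* Defs.v *)
From HB Require Import structures.
From mathcomp Require Import all_boot all_order all_algebra.
From mathcomp Require Import all_classical all_reals all_analysis.

Set Implicit Arguments.
Unset Strict Implicit.
Unset Printing Implicit Defensive.

Import Order.TTheory GRing.Theory Num.Theory.

Local Open Scope ring_scope.
Local Open Scope classical_set_scope.

(* Polynomial time is measured on Jones's WHILE language over binary trees, *)
(* a standard machine model equivalent to Turing machines up to polynomial  *)
(* overhead. An assignment is charged the full size of the tree that it     *)
(* stores, so repeated doubling [x := cons x x] takes exponential time and  *)
(* the output size is bounded by the running time.                          *)

Inductive data : Type := Leaf | Node of data & data.

Fixpoint dsize (d : data) : nat :=
  if d is Node a b then (dsize a + dsize b).+1 else 1%N.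

Inductive expr : Type :=
  | Var of nat | Nil | Cons of expr & expr | Hd of expr | Tl of expr.

Definition store := nat -> data.

Definition update (st : store) (x : nat) (d : data) : store :=
  fun y => if y == x then d else st y.

Fixpoint eval (e : expr) (st : store) : data :=
  match e with
  | Var x => st x
  | Nil => Leaf
  | Cons e1 e2 => Node (eval e1 st) (eval e2 st)
  | Hd e1 => if eval e1 st is Node a _ then a else Leaf
  | Tl e1 => if eval e1 st is Node _ b then b else Leaf
  end.

Inductive cmd : Type :=
  | Skip
  | Assign of nat & expr
  | Seq of cmd & cmd
  | If of nat & cmd & cmd
  | While of nat & cmd.

(* [exec c st st' t]: from store [st], [c] halts in store [st'] after time  *)
(* [t]. A test on variable [x] succeeds when [x] does not hold [Leaf].      *)
Inductive exec : cmd -> store -> store -> nat -> Prop :=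
  | ExecSkip st : exec Skip st st 1
  | ExecAssign x e st :
      exec (Assign x e) st (update st x (eval e st)) (dsize (eval e st)).+1
  | ExecSeq c1 c2 st1 st2 st3 t1 t2 :
      exec c1 st1 st2 t1 -> exec c2 st2 st3 t2 ->
      exec (Seq c1 c2) st1 st3 (t1 + t2).+1
  | ExecIfTrue x c1 c2 st st' t :
      st x <> Leaf -> exec c1 st st' t -> exec (If x c1 c2) st st' t.+1
  | ExecIfFalse x c1 c2 st st' t :
      st x = Leaf -> exec c2 st st' t -> exec (If x c1 c2) st st' t.+1
  | ExecWhileTrue x c st1 st2 st3 t1 t2 :
      st1 x <> Leaf -> exec c st1 st2 t1 -> exec (While x c) st2 st3 t2 ->
      exec (While x c) st1 st3 (t1 + t2).+1
  | ExecWhileFalse x c st : st x = Leaf -> exec (While x c) st st 1.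

(* Variable 0 holds the input at the start and the output at the end. *)
Definition poly_time (A B : Type) (encA : A -> data) (encB : B -> data)
    (f : A -> B) : Prop :=
  exists (P : cmd) (C e : nat), forall a : A, exists (st : store) (t : nat),
    [/\ exec P (update (fun=> Leaf) 0 (encA a)) st t,
        st 0%N = encB (f a)
      & (t <= C * dsize (encA a) ^ e)%N].

Definition enc_bool (b : bool) : data := if b then Node Leaf Leaf else Leaf.

Definition enc_unary (n : nat) : data := iter n (Node Leaf) Leaf.

Definition enc_seq (A : Type) (enc : A -> data) (s : seq A) : data :=
  foldr (fun x d => Node (enc x) d) Leaf s.

Record promise_problem (A : Type) := PromiseProblem {
  instance : A -> Prop;
  yes_instance : A -> Prop;
  no_instance : A -> Prop }.

(* [f] computes a description in [C] of an instance [den (f a)] of [Q]. *)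
Definition karp_reduction (A B C : Type) (P : promise_problem A)
    (Q : promise_problem B) (encA : A -> data) (encC : C -> data)
    (den : C -> B) (f : A -> C) : Prop :=
  [/\ poly_time encA encC f,
      forall a, instance P a -> instance Q (den (f a)),
      forall a, yes_instance P a -> yes_instance Q (den (f a))
    & forall a, no_instance P a -> no_instance Q (den (f a))].

Record parity_inst (k : nat) := ParityInst {
  nvars : nat;
  constraints : seq (k.-tuple 'I_nvars * bool) }.

Definition sat_parity (k n : nat) (x : {ffun 'I_n -> bool})
    (c : k.-tuple 'I_n * bool) : bool :=
  \big[addb/false]_(j < k) x (tnth c.1 j) == c.2.

Definition parity_val (R : realType) (k : nat) (I : parity_inst k) : R :=
  \big[Order.max/0]_(x : {ffun 'I_(nvars I) -> bool})
    ((count (sat_parity x) (constraints I))%:R / (size (constraints I))%:R).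

Definition gap_parity (R : realType) (k : nat) (s c : R) :
    promise_problem (parity_inst k) :=
  {| instance := fun I => (0 < size (constraints I))%N;
     yes_instance := fun I =>
       (0 < size (constraints I))%N /\ c <= parity_val R I;
     no_instance := fun I =>
       (0 < size (constraints I))%N /\ parity_val R I < s |}.

(* Variables are written in unary, so that "polynomial time" means          *)
(* polynomial in the number of variables and of constraints.                *)
Definition enc_parity (k : nat) (I : parity_inst k) : data :=
  Node (enc_unary (nvars I))
    (enc_seq (fun c : k.-tuple 'I_(nvars I) * bool =>
        Node (enc_seq (fun i : 'I_(nvars I) => enc_unary i) c.1)
             (enc_bool c.2))
      (constraints I)).

(* [A] is the type of the numbers in the instance: either a type of reals   *)
(* or the type of the finite descriptions of reals below.                   *)
Record cvp_inst (A : Type) := CVPInst {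
  cvp_dim : nat;
  cvp_rank : nat;
  cvp_basis : 'M[A]_(cvp_dim, cvp_rank);
  cvp_target : 'cV[A]_cvp_dim;
  cvp_radius : A }.

Definition map_cvp (A B : Type) (g : A -> B) (J : cvp_inst A) : cvp_inst B :=
  {| cvp_basis := map_mx g (cvp_basis J);
     cvp_target := map_mx g (cvp_target J);
     cvp_radius := g (cvp_radius J) |}.

Definition lpnorm (R : realType) (p : R) (d : nat) (x : 'cV[R]_d) : R :=
  (\sum_(i < d) `|x i 0| `^ p) `^ p^-1.

Definition lattice (R : realType) (d n : nat) (B : 'M[R]_(d, n)) :
    set 'cV[R]_d :=
  [set B *m map_mx intr z | z in [set: 'cV[int]_n]].

(* The infimum is attained when [L] is a lattice. *)
Definition dist_lp (R : realType) (p : R) (d : nat) (L : set 'cV[R]_d)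
    (t : 'cV[R]_d) : R :=
  inf [set lpnorm p (x - t) | x in L].

Definition cvp_wf (R : realType) (J : cvp_inst R) : Prop :=
  \rank (cvp_basis J) = cvp_rank J /\ 0 < cvp_radius J.

Definition gap_cvp (R : realType) (p gamma : R) :
    promise_problem (cvp_inst R) :=
  {| instance := @cvp_wf R;
     yes_instance := fun J => cvp_wf J /\
       dist_lp p (lattice (cvp_basis J)) (cvp_target J) <= cvp_radius J;
     no_instance := fun J => cvp_wf J /\
       gamma * cvp_radius J < dist_lp p (lattice (cvp_basis J)) (cvp_target J)
  |}.

(* Finite descriptions of the real entries of a CVP instance. The reals p,  *)
(* s and c are arbitrary, possibly uncomputable, and an exact reduction must *)
(* be able to write numbers that depend on them. A literal denotes          *)
(* (-1)^sign * mantissa * radicand^(1/p) * theta_i, where theta is a finite *)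
(* list of real constants fixed for the whole problem (not per instance)    *)
(* and mantissa and radicand are naturals in binary, least significant bit  *)
(* first. Constants cannot be multiplied together, and a literal of         *)
(* polynomial size scales a constant by at most 2^poly. This avoids the     *)
(* real-RAM artefact where 2^(2^m) * theta, obtained by repeated squaring,  *)
(* exposes exponentially many digits of a hard-wired real.                  *)
Record literal := Literal {
  lit_sign : bool;
  lit_mantissa : seq bool;
  lit_radicand : seq bool;
  lit_const : nat }.

Definition nat_of_bits (s : seq bool) : nat :=
  foldr (fun b n => (nat_of_bool b + n.*2)%N) 0%N s.

Definition lit_val (R : realType) (p : R) (theta : seq R) (l : literal) : R :=
  (-1) ^+ lit_sign l * (nat_of_bits (lit_mantissa l))%:R
    * (nat_of_bits (lit_radicand l))%:R `^ p^-1 * theta`_(lit_const l).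

Definition enc_literal (l : literal) : data :=
  Node (enc_bool (lit_sign l))
    (Node (enc_seq enc_bool (lit_mantissa l))
      (Node (enc_seq enc_bool (lit_radicand l))
        (enc_unary (lit_const l)))).

(* The basis is written row by row, each row together with its target entry. *)
Definition enc_cvp (J : cvp_inst literal) : data :=
  Node (enc_unary (cvp_rank J))
    (Node
      (enc_seq (fun i : 'I_(cvp_dim J) =>
          Node (enc_seq (fun j : 'I_(cvp_rank J) =>
                    enc_literal (cvp_basis J i j))
                  (enum 'I_(cvp_rank J)))
               (enc_literal (cvp_target J i 0)))
        (enum 'I_(cvp_dim J)))
      (enc_literal (cvp_radius J))).

(* Main.v *)
Require Import Defs.
From HB Require Import structures.
From mathcomp Require Import all_boot all_order all_algebra.
From mathcomp Require Import all_classical all_reals all_analysis.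
From mathcomp Require Import measurable_realfun.
From mathcomp Require Import ring lra zify.

Set Implicit Arguments.
Unset Strict Implicit.
Unset Printing Implicit Defensive.

(* Put y = 1 - 2x, padded with ones to an even length 2M. For a sign vector w,  *)
(* a row computes |<w, y>|^p; summed over the w of a fixed parity, the rows     *)
(* depend on y only through its parity, and the two values differ by            *)
(* E = sum_w (prod w) |sum w|^p, the alternating sum of the C(2M, j) |2j-2M|^p. *)
(* Choosing the parity of w by the right-hand side of the constraint makes      *)
(* satisfied constraints cheaper than violated ones by exactly |E|. Rows        *)
(* omega (1 - 2 x_i), one for each occurrence of a variable, make all binary    *)
(* vectors pay the same and the others pay more than any binary vector.         *)
(*                                                                              *)
(* To bound E from below write p = a + 2q with 0 < a < 2. As x^(a/2 - 1) is a   *)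
(* multiple of the integral of t^(a-1) / (t^2 + x), a partial fraction          *)
(* expansion turns E into the integral of t^(p-1) / prod_i (1 + t^2 / 4 i^2)    *)
(* times C(2M, M) / K, where K = int t^(a-1) / (t^2 + 1) satisfies              *)
(* |sin (pi p / 2)| K <= pi. The moment sum_w |sum w|^p is bounded from above   *)
(* through cosh x <= exp (x^2 / 2).                                             *)

(* The libraries shadow [Nil], [Cons] and [eval]. *)
Import Defs.

(** Put M = [uphalf k]. Let A be [abs_moment], the sum of |sum w|^p over all sign vectors w of
    length 2M, and E the absolute value of [altsum], the same sum weighted by the product of the
    signs. Multiplying w entrywise by y permutes the sign vectors and shifts their parity by that of
    y ([half_moment_symdiff]), so a gadget sees an assignment only through its parity: it costs
    [lo_cost] = (A - E)/2 if the constraint is satisfied and [hi_cost] = (A + E)/2 if not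
    ([binary_cost]). The weight omega is chosen so that one non-binary coordinate already costs a
    constraint as much extra as a violated gadget; hence rounding an integer vector to an assignment
    never increases the cost ([int_cost]). An assignment that satisfies a fraction t of the m
    constraints, and is 0 on the variables that occur nowhere, lies at distance (m [threshold]
    t)^(1/p). As [threshold] is affine and decreasing, the gap is the p-th root of [threshold] s /
    [threshold] c, and [gap_ge] bounds it once E / A is bounded from below.

    That bound is [parity_bias]. For an even p < 2M the alternating sum vanishes ([altsum_expr]).
    Otherwise x^(p/2) is a superposition of the functions x^(q+1) / (t^2 + x), whose alternating
    sums have an explicit product form with a sign independent of t ([altsum_kern]). Nothing cancels
    in the integral, so it may be restricted to a convenient range ([altsum_powR_lower]). The
    opposite bound on A is an exponential moment estimate ([abs_moment_le]).

    Everything depending on p, k, s, c sits in finitely many row templates and real constants. The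
    reduction therefore only copies and shifts table indices and counts the constraints;
    [run_reduction] verifies an explicit program for it together with a time bound. *)

(** * The reduction as a computation on table indices *)

(* Every number of the output instance is a constant from a fixed table, named  *)
(* by its index. The table is an arithmetic progression, so that sums of signs  *)
(* become shifts of the index: in the column of a variable, the index starts at *)
(* [tmpl_start] and the j-th operation moves it by two places (down for [true]) *)
(* if that variable is at position j of the constraint. This also accounts for  *)
(* variables repeated in a constraint.                                          *)
Record row_tmpl := RowTmpl {
  tmpl_start : nat; tmpl_ops : seq (option bool); tmpl_target : nat }.

Definition shift_index (o : option bool) (q : nat) : nat :=
  match o with None => q | Some false => q.+2 | Some true => q.-2 end.

Fixpoint entry_index (q : nat) (ops : seq (option bool)) (l : seq nat) (i : nat) : nat :=
  match ops, l with
  | o :: ops', a :: l' => entry_index (if a == i then shift_index o q else q) ops' l' i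
  | _, _ => q
  end.

Definition row_indices : Type := (nat -> nat) * nat.

Definition tmpl_row (t : row_tmpl) (l : seq nat) : row_indices :=
  (entry_index (tmpl_start t) (tmpl_ops t) l, tmpl_target t).

Definition constraint_rows (T : bool -> seq row_tmpl) (c : seq nat * bool) : seq row_indices :=
  [seq tmpl_row t c.1 | t <- T c.2].

Definition occurs (cs : seq (seq nat * bool)) (i : nat) : bool :=
  has (fun c : seq nat * bool => i \in c.1) cs.

(* Without these rows the column of a variable that occurs in no constraint    *)
(* would be zero, and the rank too small. They cost nothing at value 0, since  *)
(* [h] is the index of the constant 0 and [h.+1] that of the constant 1.       *)
Definition unused_row (h : nat) (cs : seq (seq nat * bool)) (i : nat) : row_indices :=
  (fun j => if (j == i) && ~~ occurs cs i then h.+1 else h, h).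

(** The order is the one in which the program conses: constraint rows pile up in reverse, then the
    loop over variables runs downwards. *)
Definition instance_rows (T : bool -> seq row_tmpl) h (n : nat) (cs : seq (seq nat * bool)) :
    seq row_indices :=
  [seq unused_row h cs i | i <- iota 0 n]
    ++ rev (flatten [seq constraint_rows T c | c <- cs]).

Definition const_literal (q : nat) : literal := Literal false [:: true] [:: true] q.

Fixpoint bits_incr (s : seq bool) : seq bool :=
  match s with
  | [::] => [:: true]
  | false :: s' => true :: s'
  | true :: s' => false :: bits_incr s'
  end.

Definition bits_of_nat (n : nat) : seq bool := iter n bits_incr [::].

Lemma bits_of_natK n : nat_of_bits (bits_of_nat n) = n.
Proof.
have H s : nat_of_bits (bits_incr s) = (nat_of_bits s).+1.
  elim: s => [|[] s IH] //=; rewrite ?IH /=; lia.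
by elim: n => //= n IH; rewrite H IH.
Qed.

(** Only the radius depends on the number m of constraints, by a factor m^(1/p); this is what the
    radicand of a literal provides. *)
Definition rows_cvp (n : nat) (rows : seq row_indices) (m rad : nat) : cvp_inst literal :=
  let row (r : 'I_(size rows)) := tnth (in_tuple rows) r in
  {| cvp_basis := (\matrix_(r < size rows, j < n) const_literal ((row r).1 j))%R;
     cvp_target := (\col_(r < size rows) const_literal (row r).2)%R;
     cvp_radius := Literal false [:: true] (bits_of_nat m) rad |}.

Definition plain_constraints (k : nat) (I : parity_inst k) : seq (seq nat * bool) :=
  [seq (map val (tval c.1), c.2) | c : k.-tuple 'I_(nvars I) * bool <- constraints I].

Definition reduction (T : bool -> seq row_tmpl) h rad k (I : parity_inst k) : cvp_inst literal :=
  rows_cvp (nvars I) (instance_rows T h (nvars I) (plain_constraints I))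
    (size (constraints I)) rad.

(** * Running WHILE programs in bounded time *)

(** A Hoare triple for total correctness with a time budget [T]. *)
Definition run (c : cmd) (st : store) (Q : store -> Prop) (T : nat) : Prop :=
  exists st' t, [/\ exec c st st' t, Q st' & t <= T].

Lemma run_weaken c st (Q Q' : store -> Prop) T T' :
  run c st Q T -> (forall st', Q st' -> Q' st') -> T <= T' -> run c st Q' T'.
Proof.
move=> [st' [t [ex q le]]] QQ TT; exists st', t; split => //; first exact: QQ.
exact: leq_trans TT.
Qed.

Lemma run_skip st (Q : store -> Prop) T : Q st -> 0 < T -> run Skip st Q T.
Proof. by move=> q T0; exists st, 1; split => //; exact: ExecSkip. Qed.

Lemma run_assign x e st (Q : store -> Prop) T :
  Q (update st x (eval e st)) -> dsize (eval e st) < T -> run (Assign x e) st Q T.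
Proof.
by move=> q le; exists (update st x (eval e st)), (dsize (eval e st)).+1; split => //; exact: ExecAssign.
Qed.

Lemma run_seq c1 c2 st (Q1 Q : store -> Prop) T1 T2 T :
  run c1 st Q1 T1 -> (forall st', Q1 st' -> run c2 st' Q T2) -> T1 + T2 < T ->
  run (Seq c1 c2) st Q T.
Proof.
move=> [st1 [t1 [ex1 q1 le1]]] H le.
have [st2 [t2 [ex2 q2 le2]]] := H _ q1.
exists st2, (t1 + t2).+1; split => //; first exact: ExecSeq ex1 ex2.
by apply: leq_trans le; rewrite ltnS leq_add.
Qed.

Lemma run_assign_seq x e c st (Q : store -> Prop) T1 T :
  run c (update st x (eval e st)) Q T1 -> dsize (eval e st) + T1 + 2 <= T ->
  run (Seq (Assign x e) c) st Q T.
Proof.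
move=> [st' [t [ex q le]]] h.
exists st', ((dsize (eval e st)).+1 + t).+1; split => //.
  exact: ExecSeq (ExecAssign _ _ _) ex.
by apply: leq_trans h; lia.
Qed.

Lemma run_if x c1 c2 st (Q : store -> Prop) T T1 :
  (st x <> Leaf -> run c1 st Q T1) -> (st x = Leaf -> run c2 st Q T1) -> T1 < T ->
  run (If x c1 c2) st Q T.
Proof.
move=> H1 H2 le; case e : (st x) => [|a b].
  have [st' [t [ex q le']]] := H2 e.
  by exists st', t.+1; split => //; [exact: ExecIfFalse | exact: leq_trans le].
have ne : st x <> Leaf by rewrite e.
have [st' [t [ex q le']]] := H1 ne.
by exists st', t.+1; split => //; [exact: ExecIfTrue | exact: leq_trans le].
Qed.

(** The index of [Inv] bounds the iterations still to come: the loop may stop early, but at index 0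
    the test must fail. *)
Lemma run_while (Inv : nat -> store -> Prop) x c T n st (Q : store -> Prop) T' :
  Inv n st -> (forall i st, Inv i st -> st x = Leaf -> Q st) ->
  (forall i st, Inv i st -> st x <> Leaf -> exists2 i', i = i'.+1 & run c st (Inv i') T) ->
  n * T.+1 < T' -> run (While x c) st Q T'.
Proof.
move=> + H0 HS; elim: n st T' => [|n IH] st T' I0 le.
  case e : (st x) => [|a b].
    by exists st, 1; split; [exact: ExecWhileFalse | exact: (H0 _ _ I0 e) | lia].
  have ne : st x <> Leaf by rewrite e.
  by have [] := HS _ _ I0 ne.
case e : (st x) => [|a b].
  by exists st, 1; split; [exact: ExecWhileFalse | exact: (H0 _ _ I0 e) | lia].
have ne : st x <> Leaf by rewrite e.
have [n' [<-] [st1 [t1 [ex1 q1 le1]]]] := HS _ _ I0 ne.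
have [st2 [t2 [ex2 q2 le2]]] := IH _ (n * T.+1).+1 q1 (leqnn _).
exists st2, (t1 + t2).+1; split => //; first exact: ExecWhileTrue ex1 ex2.
lia.
Qed.

(** A frame condition: only the variables in [vs] may have changed. *)
Definition same (vs : seq nat) (st st' : store) : Prop :=
  forall y, y \notin vs -> st' y = st y.

Lemma same_refl vs st : same vs st st. Proof. by []. Qed.

Lemma same_update vs st st' x d : same vs st st' -> x \in vs -> same vs st (update st' x d).
Proof.
by move=> sm xv y yv; rewrite /update ifF ?sm //; apply: contraNF yv => /eqP ->.
Qed.

Lemma same_trans vs us st st' st'' : same us st st' -> same vs st' st'' ->
  all (mem vs) us -> same vs st st''.
Proof.
move=> s1 s2 uv y yv; rewrite s2 // s1 //; apply: contra yv => yu.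
exact: (allP uv).
Qed.

Lemma same_sub vs us st st' : same us st st' -> all (mem vs) us -> same vs st st'.
Proof. by move=> s1 uv; apply: same_trans s1 (@same_refl vs _) uv. Qed.

Lemma dsize_unary n : dsize (enc_unary n) = n.*2.+1.
Proof. by elim: n => //= n IH; rewrite IH; lia. Qed.

Lemma dsize_gt0 d : 0 < dsize d. Proof. by case: d. Qed.

Lemma dsize_seq_le (A : Type) (enc : A -> data) (s : seq A) B :
  all (fun x => dsize (enc x) <= B) s -> dsize (enc_seq enc s) <= size s * B.+1 + 1.
Proof. by elim: s => //= a s IH /andP[a1 /IH]; lia. Qed.

Lemma dsize_seq_size (A : Type) (enc : A -> data) (s : seq A) :
  size s < dsize (enc_seq enc s).
Proof. by elim: s => //= a s IH; have := dsize_gt0 (enc a); lia. Qed.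

Fixpoint unary_expr (n : nat) : expr := if n is n'.+1 then Cons Nil (unary_expr n') else Nil.

Lemma eval_unary n st : eval (unary_expr n) st = enc_unary n.
Proof. by elim: n => //= n ->. Qed.

Definition true_expr : expr := Cons Nil Nil.
Definition literal_expr (e : expr) : expr :=
  Cons Nil (Cons (Cons true_expr Nil) (Cons (Cons true_expr Nil) e)).

(* Variables of the program: 0 input and output; 1 number of columns; 2 list of *)
(* constraints still to be read; 3 rows written so far; 4 their number of       *)
(* constraints in binary; 5-7 current constraint; 8 current unused variable;    *)
(* 9 current column; 10 current row; 11 current table index; 12 list of the     *)
(* positions to compare with the column; 13-15 operands and result of a         *)
(* comparison; 16 and 18 scan for occurrences of a variable; 19-20 counter.     *)

Definition eq_cmd : cmd :=
  Seq (Assign 15 true_expr)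
    (Seq (While 13 (If 14 (Seq (Assign 13 (Tl (Var 13))) (Assign 14 (Tl (Var 14))))
                          (Seq (Assign 13 Nil) (Assign 15 Nil))))
         (If 14 (Assign 15 Nil) Skip)).

Definition eq_time (S : nat) : nat := 20 + S * (2 * S + 10).

Lemma run_eq st x y S : st 13 = enc_unary x -> st 14 = enc_unary y ->
  x.*2 < S -> y.*2 < S ->
  run eq_cmd st (fun st' => same [:: 13; 14; 15] st st' /\ st' 15 = enc_bool (x == y))
    (eq_time S).
Proof.
move=> ex ey xS yS; rewrite /eq_cmd.
apply: (@run_assign_seq _ _ _ _ _ (8 + S * (2 * S + 9))); last by rewrite /eq_time /=; lia.
set st0 := update _ _ _.
(* [g] is the verdict so far. A mismatch clears variable 13, which ends the loop with [g] false; a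
   longer second number is caught by the final test. *)
pose Inv i st' := same [:: 13; 14; 15] st st' /\ exists x' y' g,
  [/\ st' 13 = enc_unary x', st' 14 = enc_unary y', st' 15 = enc_bool g,
      (x' <= i /\ x'.*2 < S /\ y'.*2 < S) & (x == y) = g && (x' == y')].
apply: (@run_seq _ _ _ (fun st' => Inv 0 st') _ (x * (2 * S + 8).+1).+1 5); last by nia.
  apply: (@run_while Inv _ _ (2 * S + 8) x) => //.
  - split; first by apply: same_update.
    by exists x, y, true; split.
  - move=> i st' [sm [x' [y' [g [e13 e14 e15 [_ b] e]]]]] l; split => //.
    exists x', y', g; split => //; split => //.
    by move: l; rewrite e13; case: (x').
  move=> i st' [sm [x' [y' [g [e13 e14 e15 [xi [xS' yS']] e]]]]] ne.
  case: x' e13 xi xS' e => [|x'] e13 xi xS' e; first by case: ne.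
  case: i xi => [//|i] xi; exists i => //.
  apply: (@run_if _ _ _ _ _ _ (2 * S + 7)) => //.
    rewrite e14; case: y' e14 yS' e => [//|y'] e14 yS' e _.
    apply: (@run_assign_seq _ _ _ _ _ (S + 2)); last by rewrite /= e13 /= dsize_unary; lia.
    apply: run_assign; last by rewrite /= /update /= e14 /= dsize_unary; lia.
    split; first by do 2!apply: same_update => //.
    exists x', y', g; rewrite /update /= e13 e14 /=; split => //; lia.
  rewrite e14; case: y' e14 yS' e => [|//] e14 yS' e _.
  apply: (@run_assign_seq _ _ _ _ _ 3); last by rewrite /=; lia.
  apply: run_assign => //.
  split; first by do 2!apply: same_update => //.
  exists 0, 0, false; rewrite /update e14; split => //; first by lia.
  lia.
move=> st' [sm [x' [y' [g [e13 e14 e15 [x0 _] e]]]]].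
move: x0; rewrite leqn0 => /eqP x0; subst x'.
apply: (@run_if _ _ _ _ _ _ 3) => //.
  move=> ne; apply: run_assign => //; split; first exact: same_update.
  rewrite e /update /=; move: ne; rewrite e14.
  by case: (y') => //= y'' _; rewrite andbF.
move=> l; apply: run_skip => //; split => //.
rewrite e15 e; move: l; rewrite e14; case: (y') => //=.
by rewrite eqxx andbT.
Qed.

(** * Computing one matrix entry *)

Definition shift_cmd (o : option bool) : cmd :=
  match o with
  | None => Skip
  | Some false => Assign 11 (Cons Nil (Cons Nil (Var 11)))
  | Some true => Assign 11 (Tl (Tl (Var 11)))
  end.

Definition step_cmd (o : option bool) : cmd :=
  Seq (Assign 13 (Hd (Var 12))) (Seq (Assign 14 (Var 9))
    (Seq eq_cmd (Seq (If 15 (shift_cmd o) Skip) (Assign 12 (Tl (Var 12)))))).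

(** The operations of a template are fixed for the whole problem, so they are unrolled in the
    program text instead of being data. *)
Definition entry_cmd (ops : seq (option bool)) : cmd :=
  foldr (fun o c => Seq (step_cmd o) c) Skip ops.

Lemma run_shift o st q : st 11 = enc_unary q ->
  run (shift_cmd o) st
    (fun st' => same [:: 11] st st' /\ st' 11 = enc_unary (shift_index o q)) (q.*2 + 7).
Proof.
case: o => [[]|] e /=.
- apply: run_assign.
    split; first exact: same_update.
    by rewrite /update /= e; case: q {e} => [|[|q]].
  rewrite /= e; case: q {e} => [|[|q]] //=; rewrite dsize_unary; lia.
- apply: run_assign; last by rewrite /= e dsize_unary; lia.
  by split; [exact: same_update | rewrite /update /= e].
- by apply: run_skip => //; lia.
Qed.

Definition step_time (S q : nat) : nat := 3 * S + eq_time S + q.*2 + 30.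

Lemma run_step o st a l i q S :
  st 12 = enc_seq enc_unary (a :: l) -> st 9 = enc_unary i -> st 11 = enc_unary q ->
  dsize (st 12) <= S -> i.*2 < S ->
  run (step_cmd o) st (fun st' => [/\ same [:: 11; 12; 13; 14; 15] st st',
     st' 12 = enc_seq enc_unary l & st' 11 = enc_unary (if a == i then shift_index o q else q)])
   (step_time S q).
Proof.
move=> e12 e9 e11; rewrite e12 /= dsize_unary => S12 iS.
apply: (@run_assign_seq _ _ _ _ _ (2 * S + eq_time S + q.*2 + 20)); last first.
  by rewrite /step_time /= e12 /= dsize_unary; lia.
apply: (@run_assign_seq _ _ _ _ _ (S + eq_time S + q.*2 + 15)); last first.
  by rewrite /= /update /= e9 dsize_unary; lia.
set st0 := update _ 14 _.
have sm0 : same [:: 13; 14; 15] st st0 by do 2!apply: same_update => //.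
apply: (@run_seq _ _ _ _ _ (eq_time S) (S + q.*2 + 12)); last by lia.
  by apply: (@run_eq st0 a i) => //; [rewrite /st0 /update /= e12 | lia].
move=> st1 [sm1 b1].
have {}sm1 : same [:: 13; 14; 15] st st1 by exact: same_trans sm0 sm1 _.
apply: (@run_seq _ _ _ (fun st2 => same [:: 11] st1 st2 /\
   st2 11 = enc_unary (if a == i then shift_index o q else q)) _ (q.*2 + 8) (S + 1)); last by lia.
  apply: (@run_if _ _ _ _ _ _ (q.*2 + 7)); last by lia.
    rewrite b1; case: eqP => // _ _.
    by apply: run_shift; rewrite sm1.
  rewrite b1; case: eqP => // _ _.
  by apply: run_skip => //; [split => //; rewrite sm1 | lia].
move=> st2 [sm2 e2].
have st2_12 : st2 12 = st 12 by rewrite sm2 // sm1.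
apply: run_assign; last by rewrite /= st2_12 e12 /=; lia.
split.
- apply: same_update => //.
  by apply: same_trans (same_sub sm1 _) (same_sub sm2 _) _.
- by rewrite /update /= st2_12 e12.
- by rewrite /update.
Qed.

Definition entry_time (S q k : nat) : nat := k * (step_time S (q + 2 * k)).+1 + 1.

Lemma run_entry ops st l i q S k :
  st 12 = enc_seq enc_unary l -> st 9 = enc_unary i -> st 11 = enc_unary q ->
  size ops <= size l -> dsize (st 12) <= S -> i.*2 < S -> size ops <= k ->
  run (entry_cmd ops) st (fun st' => same [:: 11; 12; 13; 14; 15] st st' /\
     st' 11 = enc_unary (entry_index q ops l i)) (entry_time S q k).
Proof.
rewrite /entry_time; set T := step_time S (q + 2 * k).
move=> e12 e9 e11 sl S12 iS sk.
(* Each operation raises the index by at most 2, so the index plus twice the number of remaining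
   operations never exceeds [q + 2 * k]. *)
suff H j : forall ops st l q', st 12 = enc_seq enc_unary l -> st 9 = enc_unary i ->
    st 11 = enc_unary q' -> size ops <= size l -> dsize (st 12) <= S ->
    size ops <= j -> q' + 2 * j <= q + 2 * k ->
    run (entry_cmd ops) st (fun st' => same [:: 11; 12; 13; 14; 15] st st' /\
     st' 11 = enc_unary (entry_index q' ops l i)) (j * T.+1 + 1).
  by apply: (H k).
elim: j => [|j IH] {e12 e9 e11 sl S12 sk}{}ops {}st {}l q' e12 e9 e11 sl S12 sk qk.
  move: sk; rewrite leqn0 size_eq0 => /eqP ->.
  by apply: run_skip => //; split => //; rewrite e11; case: (l).
case: ops sl sk => [|o ops] sl sk.
  by apply: run_skip; [split => //; rewrite e11; case: (l) | lia].
case: l e12 sl => [//|a l] e12 sl.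
apply: (@run_seq _ _ _ _ _ T (j * T.+1 + 1)); last by lia.
  apply: run_weaken (run_step o e12 e9 e11 S12 iS) (fun _ h => h) _.
  by rewrite /T /step_time; lia.
move=> st1 [sm1 e12' e11'].
apply: run_weaken (IH ops st1 l _ e12' _ e11' _ _ _ _) _ _ => //.
- by rewrite sm1.
- by move: S12; rewrite e12 e12' /=; lia.
- by case: eqP => _; case: (o) => [[]|] /=; lia.
- move=> st2 [sm2 e2]; split; first by apply: same_trans sm1 sm2 _.
  by rewrite e2.
Qed.

(** * Writing the rows of a constraint *)

Definition enc_index (q : nat) : data := enc_literal (const_literal q).

Definition enc_row (n : nat) (x : row_indices) : data :=
  Node (enc_seq enc_index [seq x.1 j | j <- iota 0 n]) (enc_index x.2).

Lemma entry_index_le q ops l i : entry_index q ops l i <= q + 2 * size ops.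
Proof.
elim: ops l q => [|o ops IH] [|a l] q /=; try by lia.
have := IH l (if a == i then shift_index o q else q).
by case: (a == i); case: o => [[]|] /=; lia.
Qed.

Lemma entry_time_mono S q q' k : q <= q' -> entry_time S q k <= entry_time S q' k.
Proof. by move=> qq; rewrite /entry_time /step_time leq_add2r leq_mul2l; lia. Qed.

(** The column counter runs downwards, so that consing yields the entries in increasing column
    order. *)
Definition row_cmd (t : row_tmpl) : cmd :=
  Seq (Assign 10 Nil) (Seq (Assign 9 (Var 1))
    (Seq (While 9 (Seq (Assign 9 (Tl (Var 9)))
           (Seq (Assign 11 (unary_expr (tmpl_start t))) (Seq (Assign 12 (Var 6))
             (Seq (entry_cmd (tmpl_ops t))
                  (Assign 10 (Cons (literal_expr (Var 11)) (Var 10))))))))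
         (Assign 3 (Cons (Cons (Var 10) (literal_expr (unary_expr (tmpl_target t)))) (Var 3))))).

Definition row_size (S q : nat) : nat := S * (2 * q + 16) + 2 * q + 20.

Lemma dsize_enc_row n (x : row_indices) S q :
  n <= S -> (forall j, x.1 j <= q) -> x.2 <= q -> dsize (enc_row n x) <= row_size S q.
Proof.
move=> nS x1 x2; rewrite /= dsize_unary.
have := @dsize_seq_le _ enc_index [seq x.1 j | j <- iota 0 n] (q.*2 + 15).
rewrite size_map size_iota all_map => /(_ _).
have -> : all (preim x.1 (fun j => dsize (enc_index j) <= q.*2 + 15)) (iota 0 n).
  by apply/allP => j _ /=; rewrite dsize_unary; have := x1 j; lia.
move=> /(_ isT) h; rewrite /row_size; nia.
Qed.

Definition row_time (S q k Z : nat) : nat :=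
  S * (4 * S + entry_time S q k + row_size S (q + 2 * k) + 4 * q + 4 * k + 60) + 2 * S
   + row_size S (q + 2 * k) + Z + 30.

Lemma run_row t st n l rows S q k Z :
  st 1 = enc_unary n -> st 6 = enc_seq enc_unary l -> st 3 = enc_seq (enc_row n) rows ->
  size (tmpl_ops t) <= size l -> size (tmpl_ops t) <= k ->
  tmpl_start t <= q -> tmpl_target t <= q ->
  dsize (st 6) <= S -> n.*2 < S -> dsize (st 3) <= Z ->
  run (row_cmd t) st (fun st' => same [:: 3; 9; 10; 11; 12; 13; 14; 15] st st' /\
     st' 3 = enc_seq (enc_row n) (tmpl_row t l :: rows)) (row_time S q k Z).
Proof.
move=> e1 e6 e3 sl sk qs qt S6 nS Z3.
set W := row_size S (q + 2 * k); set TE := entry_time S q k.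
set f := entry_index (tmpl_start t) (tmpl_ops t) l.
have fle j : f j <= q + 2 * k.
  by apply: leq_trans (entry_index_le _ _ _ _) _; lia.
have accle i : i <= n -> dsize (enc_seq enc_index [seq f j | j <- iota i (n - i)]) <= W.
  move=> iN; have := @dsize_seq_le _ enc_index [seq f j | j <- iota i (n - i)] ((q + 2 * k).*2 + 15).
  rewrite size_map size_iota all_map => /(_ _).
  have -> : all (preim f (fun j => dsize (enc_index j) <= (q + 2 * k).*2 + 15)) (iota i (n - i)).
    by apply/allP => j _ /=; rewrite dsize_unary; have := fle j; lia.
  by move=> /(_ isT) h; rewrite /W /row_size; nia.
apply: (@run_assign_seq _ _ _ _ _ (S * (4 * S + TE + W + 4 * q + 4 * k + 60) + 2 * S + W + Z + 27)); last first.
  by rewrite /row_time -/W -/TE /=; lia.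
apply: (@run_assign_seq _ _ _ _ _ (S * (4 * S + TE + W + 4 * q + 4 * k + 60) + S + W + Z + 25)); last first.
  by rewrite /= /update /= e1 dsize_unary; lia.
set st0 := update _ 9 _.
pose vs := [:: 9; 10; 11; 12; 13; 14; 15].
pose Inv i st' := [/\ same vs st st', i <= n, st' 9 = enc_unary i &
   st' 10 = enc_seq enc_index [seq f j | j <- iota i (n - i)]].
apply: (@run_seq _ _ _ (Inv 0) _ (n * (4 * S + TE + W + 4 * q + 4 * k + 50).+1).+1 (W + Z + 20)); last 2 first.
- move=> st1 [sm _ e9 e10].
  have h : dsize (enc_row n (tmpl_row t l)) <= W by apply: dsize_enc_row => //=; lia.
  have ev : eval (Cons (Cons (Var 10) (literal_expr (unary_expr (tmpl_target t)))) (Var 3)) st1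
     = Node (enc_row n (tmpl_row t l)) (st 3).
    by rewrite /= e10 sm // eval_unary subn0.
  apply: run_assign; rewrite ev; last by rewrite /= -/(enc_row _ _) in h *; lia.
  split; first by apply: same_update => //; apply: same_sub sm _.
  by rewrite /update /= e3.
- by nia.
apply: (@run_while Inv _ _ (4 * S + TE + W + 4 * q + 4 * k + 50) n) => //.
- split => //; first by do 2!apply: same_update => //.
  by rewrite /st0 /update /= subnn.
- by move=> i st1 [sm iN e9 e10] l9; move: e9 e10 iN; rewrite l9; case: i.
move=> i st1 [sm iN e9 e10] ne.
case: i iN e9 e10 => [|i] iN e9 e10; first by case: ne.
exists i => //.
apply: (@run_assign_seq _ _ _ _ _ (3 * S + TE + W + 4 * q + 4 * k + 45)); last first.
  by rewrite /= e9 /= dsize_unary; lia.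
apply: (@run_assign_seq _ _ _ _ _ (3 * S + TE + W + 2 * q + 4 * k + 42)); last first.
  by rewrite eval_unary dsize_unary; lia.
apply: (@run_assign_seq _ _ _ _ _ (2 * S + TE + W + 2 * q + 4 * k + 40)); last first.
  by rewrite /= /update /= sm //; lia.
set st2 := update _ 12 _.
have s2 : same vs st st2 by do 3!apply: same_update => //.
apply: (@run_seq _ _ _ _ _ TE (S + W + 2 * q + 4 * k + 35)); last by lia.
  apply: run_weaken (@run_entry (tmpl_ops t) st2 l i (tmpl_start t) S k _ _ _ _ _ _ _) (fun _ h => h) _ => //.
  - by rewrite /st2 /update /= sm.
  - by rewrite /st2 /update /= e9.
  - by rewrite /st2 /update eval_unary.
  - by rewrite /st2 /update /= sm.
  - lia.
  - by rewrite /TE; apply: entry_time_mono.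
move=> st3 [sm3 e11].
have e10' : st3 10 = st1 10 by rewrite sm3.
have ev : eval (Cons (literal_expr (Var 11)) (Var 10)) st3
    = enc_seq enc_index [seq f j | j <- iota i (n - i)].
  rewrite /= e11 e10' e10 -/(f i).
  by rewrite (_ : n - i = (n - i.+1).+1) //; lia.
apply: run_assign; rewrite ev.
  split.
  - by apply: same_update => //; apply: same_trans s2 (same_sub sm3 _) _.
  - by lia.
  - by rewrite /update /= sm3 // /st2 /update /= e9.
  - by [].
by have := accle i (ltnW iN); lia.
Qed.

Definition rows_cmd (ts : seq row_tmpl) : cmd :=
  foldr (fun t c => Seq (row_cmd t) c) Skip ts.

Definition tmpl_ok (q k : nat) (t : row_tmpl) : bool :=
  [&& size (tmpl_ops t) <= k, tmpl_start t <= q & tmpl_target t <= q].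

Definition row_vars := [:: 3; 9; 10; 11; 12; 13; 14; 15].

Lemma dsize_tmpl_row t n l S q k : tmpl_ok q k t -> n <= S ->
  dsize (enc_row n (tmpl_row t l)) <= row_size S (q + 2 * k).
Proof.
move=> /and3P[sz s t'] nS; apply: dsize_enc_row => //=; last by lia.
by move=> j; apply: leq_trans (entry_index_le _ _ _ _) _; lia.
Qed.

Lemma run_rows ts st n l rows S q k Z :
  st 1 = enc_unary n -> st 6 = enc_seq enc_unary l -> st 3 = enc_seq (enc_row n) rows ->
  size l = k -> all (tmpl_ok q k) ts -> dsize (st 6) <= S -> n.*2 < S ->
  all (fun x => dsize (enc_row n x) <= row_size S (q + 2 * k)) rows ->
  (size rows + size ts) * (row_size S (q + 2 * k)).+1 + 1 <= Z ->
  run (rows_cmd ts) st (fun st' => same row_vars st st' /\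
     st' 3 = enc_seq (enc_row n) (rev [seq tmpl_row t l | t <- ts] ++ rows))
   (size ts * (row_time S q k Z).+1 + 1).
Proof.
move=> + + + sl.
elim: ts st rows => [|t ts IH] st rows e1 e6 e3 /=.
  by move=> *; apply: run_skip.
move=> /andP[ok oks] S6 nS arows Zb.
have /and3P[szt o2 o3] := ok.
apply: (@run_seq _ _ _ _ _ (row_time S q k Z) (size ts * (row_time S q k Z).+1 + 1)); last by lia.
  apply: (run_row e1 e6 e3) => //; first by rewrite sl.
  rewrite e3; apply: leq_trans (@dsize_seq_le _ (enc_row n) rows _ arows) _.
  by apply: leq_trans Zb => /=; nia.
move=> st1 [sm1 e3'].
apply: run_weaken (IH st1 (tmpl_row t l :: rows) _ _ e3' _ _ _ _ _) _ _ => //.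
- by rewrite sm1.
- by rewrite sm1.
- by rewrite sm1.
- by rewrite /= arows andbT; apply: dsize_tmpl_row => //; lia.
- by rewrite /=; lia.
- move=> st2 [sm2 e]; split; first exact: same_trans sm1 sm2 _.
  by rewrite e rev_cons cat_rcons.
Qed.

(** * Incrementing a binary counter *)

Definition incr_cmd : cmd :=
  Seq (Assign 19 Nil) (Seq (Assign 20 (Hd (Var 4)))
   (Seq (While 20 (Seq (Assign 19 (Cons Nil (Var 19)))
           (Seq (Assign 4 (Tl (Var 4))) (Assign 20 (Hd (Var 4))))))
   (Seq (Assign 4 (Cons true_expr (Tl (Var 4))))
        (While 19 (Seq (Assign 4 (Cons Nil (Var 4))) (Assign 19 (Tl (Var 19)))))))).

Fixpoint leading_ones (s : seq bool) : nat := if s is true :: s' then (leading_ones s').+1 else 0.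
Fixpoint skip_ones (s : seq bool) : seq bool := if s is true :: s' then skip_ones s' else s.

(** The carry clears the leading ones and sets the next bit; [behead] also covers the case in which
    there is no next bit. *)
Lemma bits_incrE s : bits_incr s = nseq (leading_ones s) false ++ true :: behead (skip_ones s).
Proof. by elim: s => //= [[]] s //= ->. Qed.

Lemma leading_ones_le s : leading_ones s <= size s.
Proof. by elim: s => //= [[]] s. Qed.

Lemma dsize_bits s : dsize (enc_seq enc_bool s) <= 4 * size s + 1.
Proof. by elim: s => //= [[]] s /=; lia. Qed.

Lemma bits_of_nat_size m : size (bits_of_nat m) <= m.
Proof.
have H s : size (bits_incr s) <= (size s).+1 by elim: s => //= [[]] s //=; lia.
by elim: m => //= m IH; apply: leq_trans (H _) _.
Qed.

Definition incr_time (S : nat) : nat := S * (12 * S + 40) + S * (10 * S + 40) + 12 * S + 160.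

Lemma run_incr st s S : st 4 = enc_seq enc_bool s -> size s <= S ->
  run incr_cmd st (fun st' => same [:: 4; 19; 20] st st' /\
    st' 4 = enc_seq enc_bool (bits_incr s)) (incr_time S).
Proof.
move=> e4 sS.
have hd r : dsize (if enc_seq enc_bool r is Node a _ then a else Leaf) <= 3 by case: r => [|[]].
apply: (@run_assign_seq _ _ _ _ _ (S * (12 * S + 40) + S * (10 * S + 40) + 12 * S + 157)); last first.
  by rewrite /incr_time /=; lia.
apply: (@run_assign_seq _ _ _ _ _ (S * (12 * S + 40) + S * (10 * S + 40) + 12 * S + 150)); last first.
  by rewrite /= /update /= e4; have := hd s; lia.
set st0 := update _ 20 _.
pose vs := [:: 4; 19; 20].
pose Inv i st' := same vs st st' /\ exists r j, [/\ size r <= S,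
  [/\ i = leading_ones r, leading_ones r + j = leading_ones s & skip_ones r = skip_ones s],
  st' 19 = enc_unary j,
  st' 4 = enc_seq enc_bool r & st' 20 = eval (Hd (Var 4)) st'].
apply: (@run_seq _ _ _ (Inv 0) _ (S * (12 * S + 30).+1).+1 (S * (10 * S + 40) + 6 * S + 60)); last by nia.
  apply: (@run_while Inv _ _ (12 * S + 30) (leading_ones s)).
  - split; first by do 2!apply: same_update => //.
    by exists s, 0; split => //; rewrite addn0.
  - move=> i st1 [sm [r [j [rS [ir jr sk] e19 e4' e20]]]] l; split => //.
    exists r, j; split => //; split => //.
    by move: l; rewrite e20 /= e4'; case: (r) => [|[]].
  - move=> i st1 [sm [r [j [rS [ir jr sk] e19 e4' e20]]]] ne.
    case: r rS ir jr sk e4' => [|[] r] rS ir jr sk e4';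
      try by case: ne; rewrite e20 /= e4'.
    exists (leading_ones r) => //.
    have r1 := leading_ones_le s; have d := dsize_bits r.
    move: rS jr => /= rS jr.
    apply: (@run_assign_seq _ _ _ _ _ (8 * S + 20)); last first.
      by rewrite /= e19 dsize_unary; lia.
    apply: (@run_assign_seq _ _ _ _ _ 5); last first.
      by rewrite /= /update /= e4' /=; lia.
    apply: run_assign; last by rewrite /= /update /= e4' /=; have := hd r; lia.
    split; first by do 3!apply: same_update => //.
    exists r, j.+1; rewrite /update /= e19 e4'; split => //; [lia | split => //; lia].
  - by have := leading_ones_le s; nia.
move=> st1 [sm [r [j [rS [ir jr sk] e19 e4' e20]]]].
have rE : skip_ones r = r by case: (r) ir => [|[]].
have d := dsize_bits r; have d' := dsize_bits (behead r).
have sb : size (behead r) <= S by rewrite size_behead; lia.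
have jS : j <= S by have := leading_ones_le s; lia.
(* [Hd] and [Tl] of [Leaf] are [Leaf], so the end of the list behaves like a zero bit. *)
have ev : eval (Cons true_expr (Tl (Var 4))) st1 = enc_seq enc_bool (true :: behead r).
  by rewrite /= e4'; case: (r).
apply: (@run_assign_seq _ _ _ _ _ (S * (10 * S + 40) + 30)); rewrite ev; last by rewrite /=; lia.
set st2 := update _ 4 _.
pose Inv2 i st' := same vs st st' /\ [/\ i <= j, st' 19 = enc_unary i &
  st' 4 = enc_seq enc_bool (nseq (j - i) false ++ true :: behead r)].
apply: (@run_while Inv2 _ _ (10 * S + 20) j).
- split; first exact: same_update.
  by rewrite subnn.
- move=> i st3 [sm3 [ij e19' e4'']] l; split => //.
  rewrite e4'' bits_incrE -sk rE; congr (enc_seq _ (nseq _ _ ++ _)).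
  by move: l; rewrite e19'; case: (i) => // _; lia.
- move=> i st3 [sm3 [ij e19' e4'']] ne.
  case: i ij e19' e4'' => [|i] ij e19' e4''; first by case: ne.
  exists i => //.
  have d3 := dsize_bits (nseq (j - i.+1) false ++ true :: behead r).
  rewrite size_cat size_nseq /= in d3.
  apply: (@run_assign_seq _ _ _ _ _ (2 * S + 8)); last by rewrite /= e4''; lia.
  apply: run_assign; last by rewrite /= /update /= e19' /= dsize_unary; lia.
  split; first by do 2!apply: same_update => //.
  rewrite /update /= e19' e4'' /=; split => //; first by lia.
  by rewrite (_ : j - i = (j - i.+1).+1) //; lia.
- by nia.
Qed.

(** * The loop over the constraints *)

Definition enc_constraint (c : seq nat * bool) : data :=
  Node (enc_seq enc_unary c.1) (enc_bool c.2).

Lemma dsize_seq_catr (A : Type) (enc : A -> data) s1 s2 :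
  dsize (enc_seq enc s2) <= dsize (enc_seq enc (s1 ++ s2)).
Proof. by elim: s1 => //= a s IH; lia. Qed.

Definition constraints_cmd (T : bool -> seq row_tmpl) : cmd :=
  While 2 (Seq (Assign 5 (Hd (Var 2))) (Seq (Assign 2 (Tl (Var 2)))
    (Seq incr_cmd (Seq (Assign 6 (Hd (Var 5))) (Seq (Assign 7 (Tl (Var 5)))
      (If 7 (rows_cmd (T true)) (rows_cmd (T false)))))))).

Definition templates_ok (T : bool -> seq row_tmpl) (q k mT : nat) : Prop :=
  forall b, all (tmpl_ok q k) (T b) /\ size (T b) <= mT.

(** Bounds the size of the whole list of rows, at most [S * mT] for the constraints and [S] for the
    variables; each row written costs a copy of that list. *)
Definition rows_size (S q k mT : nat) : nat :=
  (S * mT + S) * (row_size S (q + 2 * k)).+1 + 1.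

Definition constraints_time (S q k mT : nat) : nat :=
  S * (4 * S + incr_time S + mT * (row_time S q k (rows_size S q k mT)).+1 + 30) + 1.

Lemma all_constraint_rows T q k mT S n cs : templates_ok T q k mT -> n <= S ->
  all (fun x => dsize (enc_row n x) <= row_size S (q + 2 * k))
    (rev (flatten [seq constraint_rows T c | c <- cs])).
Proof.
move=> ok nS; rewrite all_rev; elim: cs => //= c cs IH; rewrite all_cat IH andbT.
rewrite /constraint_rows all_map; have [okb _] := ok c.2.
by apply: sub_all okb => t okt /=; apply: dsize_tmpl_row.
Qed.

Lemma size_constraint_rows T q k mT cs : templates_ok T q k mT ->
  size (flatten [seq constraint_rows T c | c <- cs]) <= size cs * mT.
Proof.
move=> ok; elim: cs => //= c cs IH; rewrite size_cat size_map.
by have [_ h] := ok c.2; lia.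
Qed.

Lemma run_constraints T st n cs S q k mT :
  templates_ok T q k mT ->
  st 1 = enc_unary n -> st 2 = enc_seq enc_constraint cs -> st 3 = Leaf -> st 4 = Leaf ->
  all (fun c : seq nat * bool => size c.1 == k) cs ->
  dsize (st 2) <= S -> n.*2 < S ->
  run (constraints_cmd T) st (fun st' => same ([:: 2; 4; 5; 6; 7; 19; 20] ++ row_vars) st st' /\
    [/\ st' 3 = enc_seq (enc_row n) (rev (flatten [seq constraint_rows T c | c <- cs])) &
     st' 4 = enc_seq enc_bool (bits_of_nat (size cs))]) (constraints_time S q k mT).
Proof.
move=> ok e1 e2 e3 e4 sk S2 nS.
set vs := _ ++ row_vars.
set W := row_size S (q + 2 * k); set Z := rows_size S q k mT; set TR := row_time S q k Z.
have csS : size cs <= S by have := dsize_seq_size enc_constraint cs; rewrite e2 in S2; lia.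
pose Inv i st' := same vs st st' /\ exists pre rest, [/\ cs = pre ++ rest /\ size rest = i,
  st' 2 = enc_seq enc_constraint rest,
  st' 3 = enc_seq (enc_row n) (rev (flatten [seq constraint_rows T c | c <- pre])) &
  st' 4 = enc_seq enc_bool (bits_of_nat (size pre))].
apply: (@run_while Inv _ _ (4 * S + incr_time S + mT * TR.+1 + 25) (size cs)).
- by split => //; exists [::], cs; split.
- move=> i st1 [sm [pre [rest [[csE ri] e2' e3' e4']]]] l; split => //.
  have rE : rest = [::] by move: l; rewrite e2'; case: (rest).
  by rewrite rE cats0 in csE; rewrite csE.
- move=> i st1 [sm [pre [[|c rest] [[csE ri] e2' e3' e4']]]] ne; first by case: ne.
  exists (size rest) => //.
  have S2' : dsize (enc_seq enc_constraint (c :: rest)) <= S.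
    by apply: leq_trans S2; rewrite e2 csE; exact: dsize_seq_catr.
  have preS : size pre < S.
    by move: csS; rewrite csE size_cat /=; lia.
  have ck : size c.1 = k by move: sk; rewrite csE all_cat /= => /and3P[_ /eqP].
  move: (S2') => /=; set dc := dsize (enc_seq enc_unary c.1) => S2''.
  apply: (@run_assign_seq _ _ _ _ _ (3 * S + incr_time S + mT * TR.+1 + 22)); last first.
    by rewrite /= e2' /= -/dc; lia.
  apply: (@run_assign_seq _ _ _ _ _ (2 * S + incr_time S + mT * TR.+1 + 20)); last first.
    by rewrite /= /update /= e2' /=; lia.
  set st2 := update _ 2 _.
  apply: (@run_seq _ _ _ _ _ (incr_time S) (2 * S + mT * TR.+1 + 18)); last by lia.
    apply: (@run_incr st2 (bits_of_nat (size pre)) S) => //.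
    by apply: leq_trans (bits_of_nat_size _) _; lia.
  move=> st3 [sm3 e4''].
  have e5 : st3 5 = enc_constraint c by rewrite sm3 // /st2 /update /= e2'.
  apply: (@run_assign_seq _ _ _ _ _ (S + mT * TR.+1 + 15)); last first.
    by rewrite /= e5 /= -/dc; lia.
  apply: (@run_assign_seq _ _ _ _ _ (mT * TR.+1 + 5)); last first.
    by rewrite /= /update /= e5 /=; lia.
  set st4 := update _ 7 _.
  have sm4 : same vs st st4.
    do 2!apply: same_update => //.
    apply: same_trans (_ : same vs st st2) (same_sub sm3 _) _ => //.
    by do 2!apply: same_update => //.
  have e7 : st4 7 = enc_bool c.2 by rewrite /st4 /update /= e5.
  have H b : b = c.2 -> run (rows_cmd (T b)) st4 (Inv (size rest)) (mT * TR.+1 + 1).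
    move=> bE; have [okb mb] := ok b.
    apply: run_weaken (run_rows (n := n) (l := c.1) (S := S) (q := q) (k := k) (Z := Z)
      (rows := rev (flatten [seq constraint_rows T c | c <- pre])) _ _ _ ck okb _ nS _ _) _ _.
    - by rewrite sm4.
    - by rewrite /st4 /update /= e5.
    - by rewrite /st4 /update /= sm3.
    - by rewrite /st4 /update /= e5 /= -/dc; lia.
    - by apply: all_constraint_rows; [exact: ok | lia].
    - have h := size_constraint_rows pre ok; rewrite size_rev /Z /rows_size -/W.
      rewrite leq_add2r leq_mul2r; apply/orP; right; nia.
    - move=> st5 [sm5 e3'']; split.
        by apply: same_trans sm4 (same_sub sm5 _) _.
      exists (rcons pre c), rest; split.
      + by rewrite cat_rcons.
      + by rewrite sm5 // /st4 /update /= sm3 // /st2 /update /= e2'.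
      + by rewrite e3'' map_rcons flatten_rcons rev_cat bE.
      + by rewrite sm5 // size_rcons.
    - by rewrite leq_add2r leq_mul2r mb orbT.
  apply: (@run_if _ _ _ _ _ _ (mT * TR.+1 + 1)); last by lia.
    by move=> ne'; apply: H; move: ne'; rewrite e7; case: c.2.
  by move=> l; apply: H; move: l; rewrite e7; case: c.2.
- rewrite /constraints_time -/Z -/TR; nia.
Qed.

(** * Rows of the variables that occur in no constraint *)

Definition mem_cmd : cmd :=
  While 12 (Seq (Assign 13 (Hd (Var 12))) (Seq (Assign 14 (Var 8)) (Seq eq_cmd
    (Seq (If 15 (Assign 18 true_expr) Skip) (Assign 12 (Tl (Var 12))))))).

Definition mem_time (S : nat) : nat := S * (4 * S + eq_time S + 30) + 1.

Lemma run_mem st l i g S :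
  st 12 = enc_seq enc_unary l -> st 8 = enc_unary i -> st 18 = enc_bool g ->
  dsize (st 12) <= S -> i.*2 < S ->
  run mem_cmd st (fun st' => same [:: 12; 13; 14; 15; 18] st st' /\
    st' 18 = enc_bool (g || (i \in l))) (mem_time S).
Proof.
move=> e12 e8 e18 S12 iS; set vs := [:: _; _; _; _; _].
pose Inv j st' := same vs st st' /\ exists r g', [/\ size r = j, st' 12 = enc_seq enc_unary r,
  st' 18 = enc_bool g', g || (i \in l) = g' || (i \in r) & dsize (st' 12) <= S].
have lS : size l <= S by have := dsize_seq_size enc_unary l; rewrite e12 in S12; lia.
apply: (@run_while Inv _ _ (3 * S + eq_time S + 28) (size l)).
- by split => //; exists l, g; split.
- move=> j st1 [sm [r [g' [rj e12' e18' e _]]]] l0; split => //.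
  by rewrite e e18'; move: l0; rewrite e12'; case: (r) => //; rewrite in_nil orbF.
- move=> j st1 [sm [[|a r] [g' [rj e12' e18' e S12']]]] ne; first by case: ne; rewrite e12'.
  exists (size r) => //.
  move: S12'; rewrite e12' /= dsize_unary => S12'.
  apply: (@run_assign_seq _ _ _ _ _ (2 * S + eq_time S + 25)); last first.
    by rewrite /= e12' /= dsize_unary; lia.
  apply: (@run_assign_seq _ _ _ _ _ (S + eq_time S + 20)); last first.
    by rewrite /= /update /= sm // e8 dsize_unary; lia.
  set st2 := update _ 14 _.
  have sm2 : same vs st st2 by do 2!apply: same_update => //.
  apply: (@run_seq _ _ _ _ _ (eq_time S) (S + 15)); last by lia.
    apply: (@run_eq st2 a i) => //.
    - by rewrite /st2 /update /= e12'.
    - by rewrite /st2 /update /= sm.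
    - by lia.
  move=> st3 [sm3 b3].
  have e18_3 : st3 18 = enc_bool g' by rewrite sm3.
  have sm3' : same vs st st3 by apply: same_trans sm2 (same_sub sm3 _) _.
  apply: (@run_seq _ _ _ (fun st4 => same [:: 18] st3 st4 /\ st4 18 = enc_bool (g' || (a == i))) _ 6 (S + 5)); last by lia.
    apply: (@run_if _ _ _ _ _ _ 4) => //.
      rewrite b3; case: eqP => // _ _; apply: run_assign => //.
      by split; [exact: same_update | rewrite orbT].
    rewrite b3; case: eqP => // _ _; apply: run_skip => //.
    by rewrite orbF.
  move=> st4 [sm4 e18_4].
  have e12_4 : st4 12 = st1 12 by rewrite sm4 // sm3.
  apply: run_assign; last by rewrite /= e12_4 e12' /=; lia.
  split; first by apply: same_update => //; apply: same_trans sm3' (same_sub sm4 _) _.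
  exists r, (g' || (a == i)); split => //.
  - by rewrite /update /= e12_4 e12'.
  - by rewrite e in_cons orbA [a == i]eq_sym.
  - by rewrite /update /= e12_4 e12' /=; lia.
- by rewrite /mem_time; nia.
Qed.

Definition scan_cmd : cmd :=
  Seq (Assign 18 Nil) (Seq (Assign 16 (Tl (Var 0)))
    (While 16 (Seq (Assign 12 (Hd (Hd (Var 16)))) (Seq mem_cmd (Assign 16 (Tl (Var 16))))))).

Definition scan_time (S : nat) : nat := S * (2 * S + mem_time S + 20) + S + 20.

Lemma run_scan st d cs i S :
  st 0 = Node d (enc_seq enc_constraint cs) -> st 8 = enc_unary i ->
  dsize (st 0) <= S -> i.*2 < S ->
  run scan_cmd st (fun st' => same [:: 12; 13; 14; 15; 16; 18] st st' /\
    st' 18 = enc_bool (occurs cs i)) (scan_time S).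
Proof.
move=> e0 e8 + iS; rewrite e0 /= => S0; set vs := [:: _; _; _; _; _; _].
have csS : size cs <= S by have := dsize_seq_size enc_constraint cs; lia.
apply: (@run_assign_seq _ _ _ _ _ (S * (2 * S + mem_time S + 20) + S + 10)); last first.
  by rewrite /scan_time /=; lia.
apply: (@run_assign_seq _ _ _ _ _ (S * (2 * S + mem_time S + 20) + 2)); last first.
  by rewrite /= /update /= e0; lia.
set st0 := update _ 16 _.
pose Inv j st' := same vs st st' /\ exists r g, [/\ size r = j, st' 16 = enc_seq enc_constraint r,
  st' 18 = enc_bool g, occurs cs i = g || occurs r i & dsize (st' 16) <= S].
apply: (@run_while Inv _ _ (2 * S + mem_time S + 15) (size cs)).
- split; first by do 2!apply: same_update => //.
  by exists cs, false; rewrite /st0 /update /= e0; split => //; lia.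
- move=> j st1 [sm [r [g [rj e16 e18 e _]]]] l; split => //.
  by rewrite e e18; move: l; rewrite e16; case: (r) => //; rewrite /occurs /= orbF.
- move=> j st1 [sm [[|c r] [g [rj e16 e18 e S16]]]] ne; first by case: ne; rewrite e16.
  exists (size r) => //.
  move: S16; rewrite e16 /= => S16.
  apply: (@run_assign_seq _ _ _ _ _ (S + mem_time S + 12)); last first.
    by rewrite /= e16 /=; lia.
  set st2 := update _ 12 _.
  have sm2 : same vs st st2 by apply: same_update.
  apply: (@run_seq _ _ _ _ _ (mem_time S) (S + 5)); last by lia.
    apply: (@run_mem st2 c.1 i g S) => //.
    - by rewrite /st2 /update /= e16.
    - by rewrite /st2 /update /= sm.
    - by rewrite /st2 /update /= e16 /=; lia.
  move=> st3 [sm3 e18_3].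
  have e16_3 : st3 16 = st1 16 by rewrite sm3.
  apply: run_assign; last by rewrite /= e16_3 e16 /=; lia.
  split; first by apply: same_update => //; apply: same_trans sm2 (same_sub sm3 _) _.
  exists r, (g || (i \in c.1)); rewrite /update /= e16_3 e16; split => //=.
  - by rewrite e /occurs /= orbA.
  - by lia.
- by nia.
Qed.

Definition unused_row_cmd (h : nat) : cmd :=
  Seq (Assign 10 Nil) (Seq (Assign 9 (Var 1))
    (Seq (While 9 (Seq (Assign 9 (Tl (Var 9))) (Seq (Assign 13 (Var 9)) (Seq (Assign 14 (Var 8))
           (Seq eq_cmd (Seq (Assign 11 (unary_expr h))
             (Seq (If 15 (If 18 Skip (Assign 11 (unary_expr h.+1))) Skip)
                  (Assign 10 (Cons (literal_expr (Var 11)) (Var 10))))))))))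
         (Assign 3 (Cons (Cons (Var 10) (literal_expr (unary_expr h))) (Var 3))))).

Definition unused_row_time (S h Z : nat) : nat :=
  S * (4 * S + eq_time S + row_size S h.+1 + 6 * h + 60) + 2 * S + row_size S h.+1 + Z + 30.

Lemma run_unused_row st n cs i rows S h Z :
  st 1 = enc_unary n -> st 8 = enc_unary i -> st 18 = enc_bool (occurs cs i) ->
  st 3 = enc_seq (enc_row n) rows -> n.*2 < S -> i.*2 < S -> dsize (st 3) <= Z ->
  run (unused_row_cmd h) st (fun st' => same row_vars st st' /\
     st' 3 = enc_seq (enc_row n) (unused_row h cs i :: rows)) (unused_row_time S h Z).
Proof.
move=> e1 e8 e18 e3 nS iS Z3.
set W := row_size S h.+1; set TE := eq_time S.
set f := (unused_row h cs i).1.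
have fle j : f j <= h.+1 by rewrite /f /=; case: ifP.
have accle j : j <= n -> dsize (enc_seq enc_index [seq f j' | j' <- iota j (n - j)]) <= W.
  move=> jn; have := @dsize_seq_le _ enc_index [seq f j' | j' <- iota j (n - j)] (h.+1.*2 + 15).
  rewrite size_map size_iota all_map => /(_ _).
  have -> : all (preim f (fun j => dsize (enc_index j) <= h.+1.*2 + 15)) (iota j (n - j)).
    by apply/allP => j' _ /=; rewrite dsize_unary; have := fle j'; lia.
  by move=> /(_ isT) hh; rewrite /W /row_size; nia.
apply: (@run_assign_seq _ _ _ _ _ (S * (4 * S + TE + W + 6 * h + 60) + 2 * S + W + Z + 27)); last first.
  by rewrite /unused_row_time -/W -/TE /=; lia.
apply: (@run_assign_seq _ _ _ _ _ (S * (4 * S + TE + W + 6 * h + 60) + S + W + Z + 25)); last first.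
  by rewrite /= /update /= e1 dsize_unary; lia.
set st0 := update _ 9 _.
pose vs := [:: 9; 10; 11; 13; 14; 15].
pose Inv j st' := [/\ same vs st st', j <= n, st' 9 = enc_unary j &
   st' 10 = enc_seq enc_index [seq f j' | j' <- iota j (n - j)]].
apply: (@run_seq _ _ _ (Inv 0) _ (n * (4 * S + TE + W + 6 * h + 50).+1).+1 (W + Z + 20)); last 2 first.
- move=> st1 [sm _ e9 e10].
  have hh : dsize (enc_row n (unused_row h cs i)) <= W by apply: dsize_enc_row => //=; lia.
  have ev : eval (Cons (Cons (Var 10) (literal_expr (unary_expr h))) (Var 3)) st1
     = Node (enc_row n (unused_row h cs i)) (st 3).
    by rewrite /= e10 sm // eval_unary subn0.
  apply: run_assign; rewrite ev; last by rewrite /= -/(enc_row _ _) in hh *; lia.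
  split; first by apply: same_update => //; apply: same_sub sm _.
  by rewrite /update /= e3.
- by nia.
apply: (@run_while Inv _ _ (4 * S + TE + W + 6 * h + 50) n) => //.
- split => //; first by do 2!apply: same_update => //.
  by rewrite /st0 /update /= subnn.
- by move=> j st1 [sm jn e9 e10] l9; move: e9 e10 jn; rewrite l9; case: j.
move=> j st1 [sm jn e9 e10] ne.
case: j jn e9 e10 => [|j] jn e9 e10; first by case: ne.
exists j => //.
apply: (@run_assign_seq _ _ _ _ _ (3 * S + TE + W + 6 * h + 45)); last first.
  by rewrite /= e9 /= dsize_unary; lia.
apply: (@run_assign_seq _ _ _ _ _ (2 * S + TE + W + 6 * h + 42)); last first.
  by rewrite /= /update /= e9 /= dsize_unary; lia.
apply: (@run_assign_seq _ _ _ _ _ (S + TE + W + 6 * h + 40)); last first.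
  by rewrite /= /update /= sm // e8 dsize_unary; lia.
set st2 := update _ 14 _.
have s2 : same vs st st2 by do 3!apply: same_update => //.
apply: (@run_seq _ _ _ _ _ TE (S + W + 6 * h + 38)); last by lia.
  apply: (@run_eq st2 j i) => //.
  - by rewrite /st2 /update /= e9.
  - by rewrite /st2 /update /= sm.
  - by lia.
move=> st3 [sm3 b3].
apply: (@run_assign_seq _ _ _ _ _ (S + W + 4 * h + 33)); last first.
  by rewrite eval_unary dsize_unary; lia.
set st4 := update _ 11 _.
have sm4 : same vs st st4.
  by apply: same_update => //; apply: same_trans s2 (same_sub sm3 _) _.
have b4 : st4 15 = enc_bool (j == i) by rewrite /st4 /update /= b3.
have e18_4 : st4 18 = enc_bool (occurs cs i) by rewrite sm4.
have e11_4 : st4 11 = enc_unary h by rewrite /st4 /update eval_unary.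
apply: (@run_seq _ _ _ (fun st5 => same [:: 11] st4 st5 /\ st5 11 = enc_unary (f j))
   _ (2 * h + 10) (W + 15)); last by lia.
  have fE : f j = if (j == i) && ~~ occurs cs i then h.+1 else h by [].
  apply: (@run_if _ _ _ _ _ _ (2 * h + 8)); last by lia.
    rewrite b4 fE; case: eqP => // _ _.
    apply: (@run_if _ _ _ _ _ _ (2 * h + 6)); last by lia.
      by rewrite e18_4; case: occurs => // _; apply: run_skip; [split | lia].
    rewrite e18_4; case: occurs => // _; apply: run_assign.
      by split; [exact: same_update | rewrite /update eval_unary].
    by rewrite eval_unary dsize_unary; lia.
  by rewrite b4 fE; case: eqP => // _ _; apply: run_skip; [split | lia].
move=> st5 [sm5 e11].
have e10' : st5 10 = st1 10 by rewrite sm5 // /st4 /update /= sm3.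
have ev : eval (Cons (literal_expr (Var 11)) (Var 10)) st5
    = enc_seq enc_index [seq f j' | j' <- iota j (n - j)].
  rewrite /= e11 e10' e10.
  by rewrite (_ : n - j = (n - j.+1).+1) //; lia.
apply: run_assign; rewrite ev.
  split.
  - by apply: same_update => //; apply: same_trans sm4 (same_sub sm5 _) _.
  - by lia.
  - by rewrite /update /= sm5 // /st4 /update /= sm3 // /st2 /update /= e9.
  - by [].
by have := accle j (ltnW jn); lia.
Qed.

Definition unused_cmd (h : nat) : cmd :=
  Seq (Assign 8 (Var 1))
    (While 8 (Seq (Assign 8 (Tl (Var 8))) (Seq scan_cmd (unused_row_cmd h)))).

Definition unused_time (S h Z : nat) : nat :=
  S * (S + scan_time S + unused_row_time S h Z + 20) + S + 20.

Lemma run_unused st d n cs rows S h B Z :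
  st 0 = Node d (enc_seq enc_constraint cs) -> st 1 = enc_unary n ->
  st 3 = enc_seq (enc_row n) rows ->
  dsize (st 0) <= S -> n.*2 < S ->
  row_size S h.+1 <= B -> all (fun x => dsize (enc_row n x) <= B) rows ->
  (size rows + n) * B.+1 + 1 <= Z ->
  run (unused_cmd h) st (fun st' => same ([:: 8; 16; 18] ++ row_vars) st st' /\
     st' 3 = enc_seq (enc_row n) ([seq unused_row h cs i | i <- iota 0 n] ++ rows))
   (unused_time S h Z).
Proof.
move=> e0 e1 e3 S0 nS hB arows Zb; set vs := _ ++ row_vars.
apply: (@run_assign_seq _ _ _ _ _ (S * (S + scan_time S + unused_row_time S h Z + 20) + 1)); last first.
  by rewrite /unused_time /= e1 dsize_unary; lia.
set st0 := update _ 8 _.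
pose Inv i st' := [/\ same vs st st', i <= n, st' 8 = enc_unary i &
  st' 3 = enc_seq (enc_row n) ([seq unused_row h cs j | j <- iota i (n - i)] ++ rows)].
apply: (@run_while Inv _ _ (S + scan_time S + unused_row_time S h Z + 10) n).
- split => //; first by apply: same_update.
  by rewrite subnn.
- move=> i st1 [sm iN e8 e3'] l; split => //.
  by rewrite e3'; move: l iN; rewrite e8; case: (i) => //; rewrite subn0.
- move=> i st1 [sm iN e8 e3'] ne.
  case: i iN e8 e3' => [|i] iN e8 e3'; first by case: ne.
  exists i => //.
  apply: (@run_assign_seq _ _ _ _ _ (scan_time S + unused_row_time S h Z + 5)); last first.
    by rewrite /= e8 /= dsize_unary; lia.
  set st2 := update _ 8 _.
  have e8_2 : st2 8 = enc_unary i by rewrite /st2 /update /= e8.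
  have sm2 : same vs st st2 by apply: same_update.
  apply: (@run_seq _ _ _ _ _ (scan_time S) (unused_row_time S h Z)); last by lia.
    apply: (@run_scan st2 d cs i S) => //.
    - by rewrite sm2.
    - by rewrite sm2.
    - by lia.
  move=> st3 [sm3 e18].
  have sm3' : same vs st st3 by apply: same_trans sm2 (same_sub sm3 _) _.
  have e3_3 : st3 3 = enc_seq (enc_row n) ([seq unused_row h cs j | j <- iota i.+1 (n - i.+1)] ++ rows).
    by rewrite sm3 // /st2 /update /= e3'.
  apply: run_weaken (run_unused_row (n := n) (i := i) (S := S) (Z := Z) h _ _ e18 e3_3 nS _ _) _ _ => //.
  + by rewrite sm3'.
  + by rewrite sm3.
  + by lia.
  + have all_ok : all (fun x => dsize (enc_row n x) <= B)
       ([seq unused_row h cs j | j <- iota i.+1 (n - i.+1)] ++ rows).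
      rewrite all_cat arows andbT all_map; apply/allP => j _.
      change (dsize (enc_row n (unused_row h cs j)) <= B); apply: leq_trans hB.
      by apply: dsize_enc_row => //=; [lia | move=> j'; case: ifP].
    rewrite e3_3; apply: leq_trans (@dsize_seq_le _ (enc_row n) _ _ all_ok) _.
    rewrite size_cat size_map size_iota; apply: leq_trans Zb; nia.
  + move=> st4 [sm4 e3_4]; split.
    * by apply: same_trans sm3' (same_sub sm4 _) _.
    * by lia.
    * by rewrite sm4 // sm3.
    * rewrite e3_4; congr (enc_seq _ _).
      by rewrite (_ : n - i = (n - i.+1).+1) //; lia.
- by nia.
Qed.

(** * The complete program *)

Definition reduction_cmd (T : bool -> seq row_tmpl) (h rad : nat) : cmd :=
  Seq (Assign 1 (Hd (Var 0))) (Seq (Assign 2 (Tl (Var 0)))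
    (Seq (constraints_cmd T) (Seq (unused_cmd h)
      (Assign 0 (Cons (Var 1) (Cons (Var 3)
        (Cons Nil (Cons (Cons true_expr Nil) (Cons (Var 4) (unary_expr rad)))))))))).

Lemma enc_seq_map (A B : Type) (enc : B -> data) (f : A -> B) s :
  enc_seq enc (map f s) = enc_seq (enc \o f) s.
Proof. by elim: s => //= a s ->. Qed.

Lemma eq_enc_seq (A : Type) (enc enc' : A -> data) s : enc =1 enc' ->
  enc_seq enc s = enc_seq enc' s.
Proof. by move=> e; elim: s => //= a s ->; rewrite e. Qed.

Lemma enc_parityE k (I : parity_inst k) : enc_parity I =
  Node (enc_unary (nvars I)) (enc_seq enc_constraint (plain_constraints I)).
Proof.
rewrite /enc_parity /plain_constraints enc_seq_map; congr Node; apply: eq_enc_seq => c.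
by rewrite /= /enc_constraint /= enc_seq_map.
Qed.

Lemma enc_rows_cvp n rows m rad : enc_cvp (rows_cvp n rows m rad) =
  Node (enc_unary n) (Node (enc_seq (enc_row n) rows)
    (enc_literal (Literal false [:: true] (bits_of_nat m) rad))).
Proof.
rewrite /enc_cvp /=; congr (Node _ (Node _ _)).
have -> : enc_seq (enc_row n) rows
    = enc_seq (fun r => enc_row n (tnth (in_tuple rows) r)) (enum 'I_(size rows)).
  have e := enc_seq_map (enc_row n) (tnth (in_tuple rows)) (enum 'I_(size rows)).
  by rewrite map_tnth_enum in e; exact: e.
apply: eq_enc_seq => r; rewrite /enc_row !mxE; congr Node.
rewrite -val_enum_ord -map_comp enc_seq_map; apply: eq_enc_seq => j.
by rewrite /= !mxE.
Qed.

Definition reduction_time (S q k mT h rad : nat) : nat :=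
  constraints_time S q k mT + unused_time S h (rows_size S q k mT)
    + 10 * S + rows_size S q k mT + 2 * rad + 100.

Lemma run_reduction T k h rad q mT (I : parity_inst k) :
  templates_ok T q k mT -> h < q + 2 * k ->
  run (reduction_cmd T h rad) (update (fun=> Leaf) 0 (enc_parity I))
    (fun st' => st' 0 = enc_cvp (reduction T h rad I))
    (reduction_time (dsize (enc_parity I)) q k mT h rad).
Proof.
move=> ok hq; rewrite /reduction enc_rows_cvp enc_parityE.
set n := nvars I; set cs := plain_constraints I; set S := dsize _.
have csE : size (constraints I) = size cs by rewrite size_map.
have SE : S = n.*2.+1 + dsize (enc_seq enc_constraint cs) + 1 by rewrite /S /= dsize_unary addn1.
have csS : size cs <= S by have := dsize_seq_size enc_constraint cs; lia.
set Z := rows_size S q k mT.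
set st0 := update _ 0 _.
apply: (@run_assign_seq _ _ _ _ _ (constraints_time S q k mT + unused_time S h Z + 9 * S + Z + 2 * rad + 80)); last first.
  by rewrite /reduction_time -/Z /= dsize_unary; lia.
apply: (@run_assign_seq _ _ _ _ _ (constraints_time S q k mT + unused_time S h Z + 8 * S + Z + 2 * rad + 70)); last first.
  by rewrite /=; lia.
set st1 := update _ 2 _.
apply: (@run_seq _ _ _ _ _ (constraints_time S q k mT) (unused_time S h Z + 8 * S + Z + 2 * rad + 60)); last by lia.
  apply: (@run_constraints T st1 n cs S q k mT) => //.
  - by apply/allP => c /mapP[c0 _ ->] /=; rewrite size_map size_tuple.
  - by rewrite /st1 /st0 /update /=; lia.
  - by lia.
move=> st2 [sm2 [e3 e4]].
set rows := rev _ in e3.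
have rowsZ m : m <= n -> (size rows + m) * (row_size S (q + 2 * k)).+1 + 1 <= Z.
  move=> mn; have h1 := size_constraint_rows cs ok; rewrite size_rev /Z /rows_size leq_add2r leq_mul2r.
  by apply/orP; right; nia.
have arows : all (fun x => dsize (enc_row n x) <= row_size S (q + 2 * k)) rows.
  by apply: all_constraint_rows; [exact: ok | lia].
have hB : row_size S h.+1 <= row_size S (q + 2 * k) by rewrite /row_size; nia.
have e0_2 : st2 0 = Node (enc_unary n) (enc_seq enc_constraint cs) by rewrite sm2.
apply: (@run_seq _ _ _ _ _ (unused_time S h Z) (8 * S + Z + 2 * rad + 50)); last by lia.
  apply: (run_unused (n := n) (cs := cs) (rows := rows) (S := S) (B := row_size S (q + 2 * k)) e0_2) => //.
  - by rewrite sm2.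
  - by rewrite e0_2.
  - by lia.
  - exact: rowsZ.
move=> st3 [sm3 e3'].
have all_ok : all (fun x => dsize (enc_row n x) <= row_size S (q + 2 * k))
    ([seq unused_row h cs i | i <- iota 0 n] ++ rows).
  rewrite all_cat arows andbT all_map; apply/allP => j _.
  change (dsize (enc_row n (unused_row h cs j)) <= row_size S (q + 2 * k)); apply: leq_trans hB.
  by apply: dsize_enc_row => //=; [lia | move=> j'; case: ifP].
have sizeZ : dsize (st3 3) <= Z.
  rewrite e3'; apply: leq_trans (@dsize_seq_le _ (enc_row n) _ _ all_ok) _.
  by rewrite size_cat size_map size_iota (addnC n) rowsZ.
have e1_3 : st3 1 = enc_unary n by rewrite sm3 // sm2.
have e4_3 : st3 4 = enc_seq enc_bool (bits_of_nat (size cs)) by rewrite sm3.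
apply: run_assign.
  by rewrite /update /= e1_3 e3' e4_3 eval_unary csE.
have b1 := dsize_bits (bits_of_nat (size cs)); have b2 := bits_of_nat_size (size cs).
rewrite /= e1_3 e4_3 eval_unary !dsize_unary; lia.
Qed.

(** * Polynomial bounds *)

Definition poly_bounded (f : nat -> nat) : Prop :=
  exists C e, forall N, 0 < N -> f N <= C * N ^ e.

Lemma poly_const c : poly_bounded (fun=> c).
Proof. by exists c, 0 => N _; rewrite expn0 muln1. Qed.

Lemma poly_id : poly_bounded (fun N => N).
Proof. by exists 1, 1 => N _; rewrite expn1 mul1n. Qed.

(** Both exponents are raised to their sum, which is where [0 < N] enters. *)
Lemma poly_add f g : poly_bounded f -> poly_bounded g -> poly_bounded (fun N => f N + g N).
Proof.
move=> [C [e H]] [C' [e' H']]; exists (C + C'), (e + e') => N N0.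
rewrite mulnDl; apply: leq_add.
  by apply: leq_trans (H _ N0) _; rewrite leq_mul2l leq_pexp2l ?leq_addr ?orbT.
by apply: leq_trans (H' _ N0) _; rewrite leq_mul2l leq_pexp2l ?leq_addl ?orbT.
Qed.

Lemma poly_mul f g : poly_bounded f -> poly_bounded g -> poly_bounded (fun N => f N * g N).
Proof.
move=> [C [e H]] [C' [e' H']]; exists (C * C'), (e + e') => N N0.
by rewrite expnD mulnACA leq_mul ?H ?H'.
Qed.

Lemma poly_succ f : poly_bounded f -> poly_bounded (fun N => (f N).+1).
Proof.
move=> pf; have [C [e H]] := poly_add pf (poly_const 1); exists C, e => N N0.
by rewrite -addn1 H.
Qed.

Ltac poly_bound := repeat first
  [ exact: poly_const | exact: poly_id | apply: poly_add | apply: poly_mul | apply: poly_succ ].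

Lemma poly_reduction_time q k mT h rad :
  poly_bounded (fun S => reduction_time S q k mT h rad).
Proof.
rewrite /reduction_time /constraints_time /unused_time /scan_time /mem_time /unused_row_time
  /rows_size /row_time /incr_time /entry_time /step_time /eq_time /row_size.
poly_bound.
Qed.

Lemma reduction_poly_time T k h rad q mT : templates_ok T q k mT -> h < q + 2 * k ->
  poly_time (@enc_parity k) enc_cvp (reduction T h rad (k := k)).
Proof.
move=> ok hq; have [C [e H]] := poly_reduction_time q k mT h rad.
exists (reduction_cmd T h rad), C, e => I.
have [st [t [ex e0 le]]] := run_reduction rad I ok hq.
exists st, t; split => //; apply: leq_trans le (H _ _).
exact: dsize_gt0.
Qed.

Import Order.TTheory GRing.Theory Num.Theory.
Import numFieldNormedType.Exports.

Local Open Scope classical_set_scope.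
Local Open Scope ring_scope.


(** * Alternating binomial sums *)

Section AlternatingSums.
Variable R : realFieldType.
Implicit Types (h : R -> R) (M q : nat).

(** The square of the sum of 2M signs, j of which are negative. *)
Definition node M (j : nat) : R := 4 * (j%:R - M%:R) ^+ 2.

(** A finite difference of order 2M in j; equivalently, the sum of (prod w) h((sum w)^2) over sign
    vectors w. *)
Definition altsum M h : R :=
  \sum_(j < M.*2.+1) (-1) ^+ j * 'C(M.*2, j)%:R * h (node M j).

Lemma eq_altsum M h1 h2 :
  (forall j, (j <= M.*2)%N -> h1 (node M j) = h2 (node M j)) -> altsum M h1 = altsum M h2.
Proof. by move=> e; apply: eq_bigr => j _; rewrite e // -ltnS. Qed.

Lemma altsum_lin M h1 h2 (c1 c2 : R) :
  altsum M (fun x => c1 * h1 x + c2 * h2 x) = c1 * altsum M h1 + c2 * altsum M h2.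
Proof.
rewrite /altsum !mulr_sumr -big_split /=; apply: eq_bigr => j _; ring.
Qed.

(** The factor vanishes at the two extreme nodes; the others are the nodes for M with j shifted by
    one, and there it turns C(2M+2, j+1) into a multiple of C(2M, j). *)
Lemma altsum_rec M h :
  altsum M.+1 (fun x => (4 * M.+1%:R ^+ 2 - x) * h x)
  = - (8 * M.+1%:R * M.*2.+1%:R) * altsum M h.
Proof.
rewrite /altsum doubleS big_ord_recl big_ord_recr /= /node.
rewrite (_ : 4 * M.+1%:R ^+ 2 - 4 * (0%:R - M.+1%:R) ^+ 2 = 0 :> R); last by ring.
rewrite /bump /= add1n.
rewrite (_ : 4 * M.+1%:R ^+ 2 - 4 * (M.*2.+2%:R - M.+1%:R) ^+ 2 = 0 :> R); last first.
  by rewrite -doubleS -muln2 natrM; ring.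
rewrite !mul0r !mulr0 add0r addr0 mulr_sumr; apply: eq_bigr => j _.
rewrite add1n.
have jM : (j <= M.*2)%N by rewrite -ltnS.
have E1 : (M.*2.+2 * M.*2.+1 * 'C(M.*2, j) = j.+1 * (M.*2.+1 - j) * 'C(M.*2.+2, j.+1))%N.
  have /= := mul_bin_diag M.*2.+2 j; have /= := mul_bin_down M.*2.+1 j.
  by move=> d2 d1; rewrite -mulnA d2 mulnCA d1 mulnA (mulnC _ j.+1).
have E2 : M.*2.+2%:R * M.*2.+1%:R * 'C(M.*2, j)%:R
    = j.+1%:R * (M.*2.+1%:R - j%:R) * 'C(M.*2.+2, j.+1)%:R :> R.
  by rewrite -natrB ?(leq_trans jM)// -!natrM E1.
rewrite (_ : j.+1%:R - M.+1%:R = j%:R - M%:R :> R); last by rewrite -!natr1; ring.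
have jE : j.+1%:R = j%:R + 1 :> R by rewrite -natr1.
have ME : M.+1%:R = M%:R + 1 :> R by rewrite -natr1.
have M2E : M.*2.+1%:R = 2 * M%:R + 1 :> R by rewrite -natr1 -mul2n natrM.
have M3E : M.*2.+2%:R = 2 * M%:R + 2 :> R by rewrite -doubleS -mul2n natrM ME; ring.
move: E2; rewrite (exprS (-1) j) M3E M2E ME jE.
move: ('C(_, _)%:R) ('C(_, _)%:R) (h _) ((-1) ^+ j) => c1 c2 hj sg E2.
transitivity (sg * (-4) * ((j%:R + 1) * (2 * M%:R + 1 - j%:R) * c1) * hj); first by ring.
by rewrite -E2; ring.
Qed.

(** A difference of order 2M annihilates polynomials of degree 2q < 2M in j. The induction uses
    [altsum_rec], starting from (1 - 1)^(2M) = 0. *)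
Lemma altsum_expr M q : (q < M)%N -> altsum M (fun x => x ^+ q) = 0.
Proof.
elim: q M => [|q IH] [//|M] qM.
  have e := exprDn (1 : R) (-1) M.+1.*2.
  rewrite (_ : 0 = (1 - 1) ^+ M.+1.*2 :> R) ; last by rewrite subrr expr0n.
  rewrite e; apply: eq_bigr => j _.
  by rewrite expr1n mul1r expr0 mulr1 mulr_natr.
have qM' : (q < M.+1)%N by exact: ltnW.
have := altsum_rec M (fun x => x ^+ q).
rewrite (IH M) // mulr0.
rewrite (@eq_altsum _ _ (fun x => 4 * M.+1%:R ^+ 2 * (x ^+ q) + (-1) * (x ^+ q.+1))); last first.
  by move=> j _; rewrite (exprS _ q); ring.
by rewrite altsum_lin (IH M.+1) // mulr0 add0r mulN1r => /eqP; rewrite oppr_eq0 => /eqP.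
Qed.

(* The partial fraction decomposition of [1 / (s * prod_i (s + 4 i^2))]. *)
Lemma altsum_inv M (s : R) : 0 < s ->
  altsum M (fun x => (s + x)^-1)
  = (-1) ^+ M * \prod_(i < M) (8 * i.+1%:R * i.*2.+1%:R / (s + 4 * i.+1%:R ^+ 2)) / s.
Proof.
move=> s0; elim: M => [|M IH].
  by rewrite /altsum big_ord1 big_ord0 /node subrr expr0n /= mulr0 addr0 bin0 expr0 !mul1r.
have := altsum_rec M (fun x => (s + x)^-1); rewrite IH.
have nz x : 0 <= x -> s + x != 0 by move=> x0; rewrite gt_eqF // ltr_wpDr.
have node0 N j : 0 <= node N j by rewrite /node mulr_ge0 // sqr_ge0.
(* (4(M+1)^2 - x) / (s + x) is (s + 4(M+1)^2) / (s + x) - 1, and the constant is annihilated. *)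
rewrite (@eq_altsum _ _ (fun x => (s + 4 * M.+1%:R ^+ 2) * (s + x)^-1 + (-1) * x ^+ 0)); last first.
  by move=> j _; field; exact: nz.
rewrite altsum_lin altsum_expr // mulr0 addr0 big_ord_recr /= => e.
have nzM : s + 4 * M.+1%:R ^+ 2 != 0 by apply: nz; rewrite mulr_ge0 // sqr_ge0.
apply: (mulfI nzM); rewrite e (exprS (-1) M); field.
by rewrite gt_eqF //= nat1r.
Qed.

(** x^(q+1) / (s + x) = x^q - s x^q / (s + x), and x^q is annihilated as long as q < M. *)
Lemma altsum_expr_inv M q (s : R) : 0 < s -> (q <= M)%N ->
  altsum M (fun x => x ^+ q / (s + x)) = (- s) ^+ q * altsum M (fun x => (s + x)^-1).
Proof.
move=> s0; elim: q => [|q IH] qM.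
  by rewrite expr0 mul1r; apply: eq_altsum => j _; rewrite expr0 mul1r.
rewrite exprS -mulrA -IH; last exact: ltnW.
have nz x : 0 <= x -> s + x != 0 by move=> x0; rewrite gt_eqF // ltr_wpDr.
have node0 N j : 0 <= node N j by rewrite /node mulr_ge0 // sqr_ge0.
rewrite (@eq_altsum _ _ (fun x => 1 * x ^+ q + (- s) * (x ^+ q / (s + x)))); last first.
  by move=> j _; rewrite (exprS _ q); field; exact: nz.
by rewrite altsum_lin altsum_expr // mulr0 add0r.
Qed.

End AlternatingSums.

(** * An integral representation of the alternating sum *)

Section ExponentialKernel.
Variable R : realType.
Notation mu := (@lebesgue_measure R).

Lemma continuous_expRM (a : R) : continuous (fun u : R => expR (a * u)).
Proof.
move=> u; apply: (@continuous_comp _ _ _ (fun u => a * u) expR).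
  exact: mulrl_continuous.
exact: continuous_expR.
Qed.

Lemma integral_expRy (a L : R) : 0 < a ->
  (\int[mu]_(x in `[L, +oo[) (expR (- a * x))%:E = (expR (- a * L) / a)%:E)%E.
Proof.
move=> a0.
have dF (x : R) : is_derive x 1 (fun x => - (expR (- a * x) / a)) (expR (- a * x)).
  apply: is_derive_eq; rewrite /GRing.scale /=; field; lra.
have cF : continuous (fun x : R => - (expR (- a * x) / a)).
  move=> x; apply: differentiable_continuous; apply/derivable1_diffP.
  exact: (@ex_derive _ _ _ _ _ _ _ (dF x)).
rewrite (@ge0_continuous_FTC2y _ _ (fun x => - (expR (- a * x) / a)) L 0).
- by rewrite sub0e -EFinN opprK.
- by move=> x _; exact: expR_ge0.
- by apply: continuous_subspaceT; exact: continuous_expRM.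
- rewrite -oppr0; apply: cvgN; rewrite -(mul0r a^-1); apply: cvgM; last exact: cvg_cst.
  have : (fun x : R => expR (- (a * x))) x @[x --> +oo] --> (0 : R).
    apply: (@cvg_comp _ _ _ (fun x => a * x) (fun y => expR (- y))); last exact: cvgr_expR.
    exact: gt0_cvgMry.
  by under eq_fun do rewrite -mulNr.
- by move=> x _; exact: (@ex_derive _ _ _ _ _ _ _ (dF x)).
- by apply: cvg_at_right_filter; exact: cF.
- by move=> x _; rewrite derive1E derive_val.
Qed.

Lemma integral_expRNy (a L : R) : 0 < a ->
  (\int[mu]_(x in `]-oo, L]) (expR (a * x))%:E = (expR (a * L) / a)%:E)%E.
Proof.
move=> a0; rewrite -(opprK L) ge0_integration_by_substitutionNy.
- under eq_integral do rewrite /= mulrN -mulNr.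
  by rewrite integral_expRy // opprK mulrNN.
- by apply: continuous_subspaceT; exact: continuous_expRM.
- by move=> x _; exact: expR_ge0.
Qed.

(* This is [t^(a-1) / (t^2 + x) dt] for [t = e^u], in which scaling [t] becomes *)
(* a translation of [u]. *)
Definition kern (a x u : R) : R := expR (a * u) / (expR (2 * u) + x).

Lemma kern_ge0 a x u : 0 <= x -> 0 <= kern a x u.
Proof. by move=> x0; rewrite divr_ge0 ?expR_ge0 // addr_ge0 ?expR_ge0. Qed.

Lemma continuous_kern a x : 0 <= x -> continuous (kern a x).
Proof.
move=> x0 u; apply: cvgM; first exact: continuous_expRM.
apply: cvgV; first by rewrite gt_eqF // ltr_wpDr ?expR_gt0.
by apply: cvgD; [exact: continuous_expRM | exact: cvg_cst].
Qed.

Lemma measurable_kern a x (D : set R) : 0 <= x ->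
  measurable_fun D (kern a x).
Proof.
move=> x0; apply: measurable_funTS.
by apply: continuous_measurable_fun; exact: continuous_kern.
Qed.

(** In the denominator e^(2u) + 1, drop e^(2u) for u <= 0 and drop 1 for u > 0. *)
Lemma kern1_bound a : 0 < a < 2 ->
  (\int[mu]_u (kern a 1 u)%:E <= (a^-1 + (2 - a)^-1)%:E)%E.
Proof.
move=> /andP[a0 a2].
have -> : [set: R] = `]-oo, 0] `|` `]0, +oo[ by rewrite -setCitvl setUv.
rewrite ge0_integral_setU //=; last 3 first.
- by apply/measurable_EFinP; exact: measurable_kern.
- by move=> x _; rewrite lee_fin; exact: kern_ge0.
- apply/disj_setPS => x [] /=; rewrite !in_itv /= andbT => h1 h2.
  by move: (lt_le_trans h2 h1); rewrite ltxx.
rewrite EFinD; apply: leeD.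
- have := integral_expRNy 0 a0; rewrite mulr0 expR0 mul1r => <-.
  apply: ge0_le_integral => //.
  + by move=> x _; rewrite lee_fin kern_ge0.
  + by apply/measurable_EFinP; exact: measurable_kern.
  + apply/measurable_EFinP; apply: measurable_funTS.
    by apply: continuous_measurable_fun; exact: continuous_expRM.
  + move=> x _; rewrite lee_fin ler_pdivrMr; last by rewrite addr_gt0 ?expR_gt0.
    by rewrite ler_peMr ?expR_ge0 // lerDr expR_ge0.
- rewrite integral_itv_obnd_cbnd; last by apply/measurable_EFinP; exact: measurable_kern.
  have := @integral_expRy (2 - a) 0; rewrite mulr0 expR0 mul1r subr_gt0 => <- //.
  apply: ge0_le_integral => //.
  + by move=> x _; rewrite lee_fin kern_ge0.
  + by apply/measurable_EFinP; exact: measurable_kern.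
  + apply/measurable_EFinP; apply: measurable_funTS.
    by apply: continuous_measurable_fun; exact: continuous_expRM.
  + move=> x _; rewrite lee_fin ler_pdivrMr; last by rewrite addr_gt0 ?expR_gt0.
    rewrite mulrDr mulr1 -expRD (_ : - (2 - a) * x + 2 * x = a * x); last by ring.
    by rewrite lerDl expR_ge0.
Qed.

(** Translate u by (ln x) / 2, that is, scale t by the square root of x. *)
Lemma kern_scale a x : 0 < x -> (\int[mu]_u (kern a x u)%:E =
  (x `^ (a / 2 - 1))%:E * \int[mu]_u (kern a 1 u)%:E)%E.
Proof.
move=> x0.
set b := ln x / 2.
have db (u : R) : is_derive u 1 (fun u => u + b) 1.
  by apply: is_derive_eq; rewrite addr0.
have d1 : derive1 (fun u : R => u + b) = cst 1.
  by apply/funext => u; rewrite derive1E derive_val.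
rewrite (@increasing_ge0_integration_by_substitutionT _ (fun u => u + b) (kern a x)).
- rewrite d1 -ge0_integralZl_EFin //; last 3 first.
  + by move=> u _; rewrite lee_fin kern_ge0.
  + by apply/measurable_EFinP; apply: measurable_kern; exact: ltW.
  + exact: powR_ge0.
  apply: eq_integral => u _; rewrite -EFinM; congr EFin.
  have e2 : expR (2 * (u + b)) = x * expR (2 * u).
    by rewrite mulrDr expRD /b [2 * (_ / _)]mulrC divfK // lnK ?posrE // mulrC.
  rewrite mulrfctE /= /kern. rewrite e2 mulr1 mulrDr expRD powRB; last by rewrite (gt_eqF x0) implybT.
  rewrite powRr1 ?ltW // /powR gt_eqF // (_ : a * b = a / 2 * ln x); last by rewrite /b; field.
  have := expR_gt0 (2 * u) => h; field.
  by rewrite !gt_eqF //= ?addr_gt0 ?mulr_gt0 // addr_gt0 // mulr_gt0.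
- by move=> u v uv; rewrite ltrD2r.
- by rewrite d1 => u; exact: cvg_cst.
- by rewrite d1; exact: is_cvg_cst.
- by rewrite d1; exact: is_cvg_cst.
- by move=> u; exact: (@ex_derive _ _ _ _ _ _ _ (db u)).
- exact: cvg_addrr_Ny.
- exact: cvg_addrr.
- by apply: continuous_kern; exact: ltW.
- by move=> u; apply: kern_ge0; exact: ltW.
Qed.

End ExponentialKernel.

(** * From kernel integrals to a lower bound on the alternating sum *)

Section IntegralBound.
Variable R : realType.
Notation mu := (@lebesgue_measure R).

(** The constant K. Classically it equals pi / (2 sin(pi a / 2)) for 0 < a < 2, but an upper bound
    is enough here. *)
Definition kern_mass (a : R) : R := fine (\int[mu]_u (kern a 1 u)%:E)%E.

Lemma kern_massE a : 0 < a < 2 -> (\int[mu]_u (kern a 1 u)%:E = (kern_mass a)%:E)%E.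
Proof.
move=> /kern1_bound h; rewrite fineK // ge0_fin_numE; first exact: le_lt_trans h (ltry _).
by apply: integral_ge0 => u _; rewrite lee_fin kern_ge0.
Qed.

Lemma kern_mass_ge0 a : 0 <= kern_mass a.
Proof.
by apply: fine_ge0; apply: integral_ge0 => u _; rewrite lee_fin kern_ge0.
Qed.

Lemma kern_mass_le a : 0 < a < 2 -> kern_mass a <= a^-1 + (2 - a)^-1.
Proof. by move=> h; have := kern1_bound h; rewrite kern_massE // lee_fin. Qed.

(** The exponents add up: (q + 1) + (a/2 - 1) = p/2. The extra factor x also covers the middle node
    x = 0, where the kernel alone is not integrable. *)
Lemma integral_expr_kern a x q : 0 < a < 2 -> 0 <= x ->
  (\int[mu]_u (x ^+ q.+1 * kern a x u)%:E = (kern_mass a * x `^ ((a + 2 * q%:R) / 2))%:E)%E.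
Proof.
move=> ha; rewrite le_eqVlt => /predU1P[<-|x0].
  rewrite powR0; last first.
    by case/andP: ha => a0 _; rewrite gt_eqF // divr_gt0 // ltr_wpDr // mulr_ge0.
  by under eq_integral do rewrite expr0n /= mul0r; rewrite integral0 mulr0.
under eq_integral do rewrite EFinM.
rewrite ge0_integralZl_EFin //; last 3 first.
- by move=> u _; rewrite lee_fin kern_ge0 ?ltW.
- by apply/measurable_EFinP; apply: measurable_kern; exact: ltW.
- by rewrite exprn_ge0 ?ltW.
rewrite kern_scale // kern_massE // -!EFinM; congr EFin.
rewrite -powR_mulrn ?ltW // mulrA -powRD; last by rewrite (gt_eqF x0) implybT.
by rewrite mulrC; congr (_ * _ `^ _); rewrite -natr1; field.
Qed.

Lemma integrable_expr_kern a x q : 0 < a < 2 -> 0 <= x ->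
  mu.-integrable setT (fun u => (x ^+ q.+1 * kern a x u)%:E).
Proof.
move=> ha x0; apply/integrableP; split.
  apply/measurable_EFinP; apply: measurable_funM; first exact: measurable_cst.
  exact: measurable_kern.
have absE u : (`|(x ^+ q.+1 * kern a x u)%:E| = (x ^+ q.+1 * kern a x u)%:E)%E.
  by rewrite gee0_abs // lee_fin mulr_ge0 ?exprn_ge0 ?kern_ge0.
under eq_integral do rewrite absE.
by rewrite integral_expr_kern // ltry.
Qed.

(** The sign on the right does not depend on u; this excludes cancellation in the integral. *)
Lemma altsum_kern (a u : R) q M : (q < M)%N ->
  altsum M (fun x => x ^+ q.+1 * kern a x u)
  = (-1) ^+ (q.+1 + M) * (expR ((a + 2 * q%:R) * u)
      * \prod_(i < M) (8 * i.+1%:R * i.*2.+1%:R / (expR (2 * u) + 4 * i.+1%:R ^+ 2))).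
Proof.
move=> qM.
have s0 : 0 < expR (2 * u) by exact: expR_gt0.
transitivity (expR (a * u) * altsum M (fun x => x ^+ q.+1 / (expR (2 * u) + x))).
  by rewrite /altsum mulr_sumr; apply: eq_bigr => j _; rewrite /kern; ring.
rewrite altsum_expr_inv // altsum_inv //.
rewrite (_ : (a + 2 * q%:R) * u = a * u + q%:R * (2 * u)); last by ring.
rewrite expRD (expRM_natl q (2 * u)) exprD [(- expR _) ^+ _]exprNn.
set P := \prod_(i < M) _; rewrite (exprS (expR (2 * u)) q).
by field; rewrite gt_eqF.
Qed.

(** Integrating [altsum_kern] over u gives K times the alternating sum on one side and, up to sign,
    the integral of a nonnegative function on the other. Keep only u <= L, bound the product by Q,
    and integrate e^(pu). *)
Lemma altsum_powR_lower (a : R) q M (L Q : R) : 0 < a < 2 -> (q < M)%N ->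
  let p := a + 2 * q%:R in
  (forall u, u <= L -> Q <=
     \prod_(i < M) (8 * i.+1%:R * i.*2.+1%:R / (expR (2 * u) + 4 * i.+1%:R ^+ 2))) ->
  0 <= Q ->
  Q * (expR (p * L) / p) <= kern_mass a * `|altsum M (fun x => x `^ (p / 2))|.
Proof.
move=> ha qM p HQ Q0.
have p0 : 0 < p by case/andP: ha => a0 _; rewrite ltr_wpDr // mulr_ge0.
pose sg : R := (-1) ^+ (q.+1 + M).
pose H u := expR (p * u) * \prod_(i < M) (8 * i.+1%:R * i.*2.+1%:R / (expR (2 * u) + 4 * i.+1%:R ^+ 2)).
have node0 N j : 0 <= node R N j by rewrite /node mulr_ge0 // sqr_ge0.
pose F (j : 'I_M.*2.+1) (u : R) : \bar R := ((sg * ((-1) ^+ j * 'C(M.*2, j)%:R))%:E *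
   (node R M j ^+ q.+1 * kern a (node R M j) u)%:E)%E.
have iF j : mu.-integrable setT (F j).
  by apply: integrableZl => //; exact: integrable_expr_kern.
have HE u : (H u)%:E = (\sum_(j < M.*2.+1) F j u)%E.
  rewrite /F; under eq_bigr do rewrite -EFinM.
  rewrite sumEFin; congr EFin.
  have := altsum_kern a u qM; rewrite -/p -/sg -/(H u) => e.
  transitivity (sg * sg * H u); first by rewrite -expr2 sqrr_sign mul1r.
  by rewrite -mulrA -e mulr_sumr; apply: eq_bigr => j _; rewrite !mulrA.
have IH : (\int[mu]_u (H u)%:E = (sg * (kern_mass a * altsum M (fun x => x `^ (p / 2))))%:E)%E.
  under eq_integral do rewrite HE.
  rewrite integral_sum //.
  have IF j : (\int[mu]_u (F j u) = (sg * ((-1) ^+ j * 'C(M.*2, j)%:R) *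
      (kern_mass a * node R M j `^ (p / 2)))%:E)%E.
    by rewrite integralZl ?integral_expr_kern -?EFinM //; exact: integrable_expr_kern.
  under eq_bigr do rewrite IF.
  rewrite sumEFin; congr EFin; rewrite !mulr_sumr; apply: eq_bigr => j _.
  by rewrite -/p; ring.
have Hge0 u : 0 <= H u.
  apply: mulr_ge0; first exact: expR_ge0.
  apply: prodr_ge0 => i _.
  apply: divr_ge0; first by rewrite !mulr_ge0.
  by rewrite addr_ge0 ?expR_ge0 // mulr_ge0 // sqr_ge0.
have mH : measurable_fun setT (fun u => (H u)%:E).
  under eq_fun do rewrite HE.
  have : mu.-integrable setT (fun u => (\sum_(j < M.*2.+1) F j u)%E).
    by apply: integrable_sum => // j _; exact: iF.
  by case/integrableP.
have low : ((Q * (expR (p * L) / p))%:E <= \int[mu]_u (H u)%:E)%E.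
  apply: (@le_trans _ _ (\int[mu]_(u in `]-oo, L]) (H u)%:E)%E); last first.
    by apply: ge0_subset_integral => // u _; rewrite lee_fin.
  rewrite EFinM -integral_expRNy // -ge0_integralZl_EFin //; last first.
  - apply/measurable_EFinP; apply: measurable_funTS.
    by apply: continuous_measurable_fun; exact: continuous_expRM.
  apply: ge0_le_integral => //.
  - by move=> u _; rewrite -EFinM lee_fin mulr_ge0 ?expR_ge0.
  - apply: measurable_funeM; apply/measurable_EFinP; apply: measurable_funTS.
    by apply: continuous_measurable_fun; exact: continuous_expRM.
  - exact: measurable_funTS.
  - move=> u; rewrite /= in_itv /= => uL; rewrite -EFinM lee_fin mulrC.
    by rewrite ler_wpM2l ?expR_ge0 //; exact: HQ.
move: low; rewrite IH lee_fin => low; apply: le_trans low _.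
apply: le_trans (ler_norm _) _.
by rewrite !normrM normr_sign mul1r ger0_norm ?kern_mass_ge0.
Qed.

End IntegralBound.

(** * Elementary bounds *)

Lemma central_binS N : (N.+1 * 'C(N.+1.*2, N.+1) = 2 * N.*2.+1 * 'C(N.*2, N))%N.
Proof.
have e1 := mul_bin_diag N.*2.+2 N; have e2 := mul_bin_down N.*2.+1 N.
rewrite /= in e1 e2.
have e3 : (N.*2.+1 - N = N.+1)%N by lia.
rewrite e3 in e2; rewrite doubleS -e1.
apply/eqP; rewrite -(eqn_pmul2l (ltn0Sn N)); apply/eqP.
rewrite mulnCA -e2 mulnA -doubleS -muln2; lia.
Qed.

Lemma central_bin_le N : (0 < N)%N -> (2 * 'C(N.*2, N) <= 4 ^ N)%N.
Proof.
case: N => // N _; elim: N => // N IH.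
rewrite -(leq_pmul2l (ltn0Sn N.+1)) mulnCA central_binS expnS; nia.
Qed.

Lemma central_bin_ge N : (0 < N)%N -> (16 ^ N <= 4 * N * 'C(N.*2, N) ^ 2)%N.
Proof.
case: N => // N _; elim: N => // N IH.
have e := central_binS N.+1.
set C := 'C(_, N.+2) in e *; set B := 'C(_, N.+1) in e IH.
rewrite -(leq_pmul2l (ltn0Sn N.+1)) (_ : (_ * (4 * _ * _) = 4 * (N.+2 * C) ^ 2)%N); last by nia.
rewrite e expnS; nia.
Qed.

Section ElementaryBounds.
Variable R : realType.

Lemma expR1_le3 : expR 1 <= 3 :> R.
Proof.
have h : 7 / 8 <= expR (- (1 / 8)) :> R.
  by apply: le_trans (expR_ge1Dx _); lra.
have e : expR 1 = expR (- (1 / 8)) ^- 8 :> R.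
  by rewrite -exprVn -expRN opprK -expRM_natl; congr expR; field.
rewrite e -[leRHS]invrK lef_pV2 ?posrE ?exprn_gt0 ?expR_gt0 // ?invr_gt0 //.
have h8 : (7 / 8) ^+ 8 <= expR (- (1 / 8)) ^+ 8 :> R by rewrite lerXn2r ?nnegrE // ?expR_ge0 //; lra.
by apply: le_trans h8; lra.
Qed.

Lemma expR3_ge16 : 16 <= expR 3 :> R.
Proof.
have h : 9 / 8 <= expR (1 / 8) :> R.
  by apply: le_trans (expR_ge1Dx _); lra.
have -> : expR 3 = expR (1 / 8) ^+ 24 :> R.
  by rewrite -expRM_natl; congr expR; field.
have h8 : (9 / 8) ^+ 24 <= expR (1 / 8) ^+ 24 :> R by rewrite lerXn2r ?nnegrE // ?expR_ge0 //; lra.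
by apply: le_trans h8; lra.
Qed.

Lemma expR1_ge : 5 / 2 <= expR 1 :> R.
Proof.
have h : 9 / 8 <= expR (1 / 8) :> R.
  by apply: le_trans (expR_ge1Dx _); lra.
have -> : expR 1 = expR (1 / 8) ^+ 8 :> R.
  by rewrite -expRM_natl; congr expR; field.
have h8 : (9 / 8) ^+ 8 <= expR (1 / 8) ^+ 8 :> R by rewrite lerXn2r ?nnegrE // ?expR_ge0 //; lra.
by apply: le_trans h8; lra.
Qed.

(** 1 + x^2 <= (1 + x)^2 for x >= 0, and the product of (N + i) / i over 1 <= i <= N is C(2N, N). *)
Lemma prod_1Dsqr_le_bin N :
  \prod_(i < N) (1 + N%:R ^+ 2 / i.+1%:R ^+ 2) <= 'C(N.*2, N)%:R ^+ 2 :> R.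
Proof.
have -> : 'C(N.*2, N)%:R = \prod_(i < N) ((N%:R + i.+1%:R) / i.+1%:R) :> R.
  suff H n : (n <= N)%N -> \prod_(i < n) ((N%:R + i.+1%:R) / i.+1%:R) = 'C(N + n, n)%:R :> R.
    by rewrite H // addnn.
  elim: n => [|n IH] nN; first by rewrite big_ord0 bin0.
  rewrite big_ord_recr /= IH ?(ltnW nN) //.
  have := mul_bin_diag (N + n.+1) n; rewrite addnS /= => e.
  have -> : 'C((N + n).+1, n.+1)%:R = (N + n).+1%:R * 'C(N + n, n)%:R / n.+1%:R :> R.
    by rewrite -natrM e natrM mulrAC divff ?mul1r.
  by rewrite -natrD addnS; field.
rewrite -prodrXl; apply: ler_prod => i _; apply/andP; split.
  by rewrite addr_ge0 // divr_ge0 // sqr_ge0.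
have -> : ((N%:R + i.+1%:R) / i.+1%:R) ^+ 2 = 1 + N%:R ^+ 2 / i.+1%:R ^+ 2 + 2 * N%:R / i.+1%:R :> R.
  by field.
by rewrite lerDl divr_ge0 // mulr_ge0.
Qed.

(** The first N factors contribute at most C(2N, N)^2 <= 16^N / 4, and the rest at most e^N because
    the sum of N^2 / i^2 over i > N is at most N; finally 16 <= e^3. The infinite product is sinh(pi
    N) / (pi N), so the bound is not far off. *)
Lemma prod_1Dsqr_le N M : (0 < N)%N ->
  \prod_(i < M) (1 + N%:R ^+ 2 / i.+1%:R ^+ 2) <= expR (4 * N%:R) / 4 :> R.
Proof.
move=> N0.
have fac1 i : 1 <= 1 + N%:R ^+ 2 / i.+1%:R ^+ 2 :> R by rewrite lerDl divr_ge0 // sqr_ge0.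
have mono d : \prod_(i < M) (1 + N%:R ^+ 2 / i.+1%:R ^+ 2)
    <= \prod_(i < M + d) (1 + N%:R ^+ 2 / i.+1%:R ^+ 2) :> R.
  elim: d => [|d IH]; first by rewrite addn0.
  rewrite addnS big_ord_recr /=; apply: le_trans IH _.
  rewrite ler_peMr //; apply: prodr_ge0 => i _; exact: le_trans ler01 (fac1 _).
apply: le_trans (mono N) _; rewrite addnC.
(* The exponent telescopes: it bounds the sum of N^2 / i^2 over N < i <= N + d through 1 / (n (n +
   1)). *)
have H d : \prod_(i < N + d) (1 + N%:R ^+ 2 / i.+1%:R ^+ 2)
   <= 'C(N.*2, N)%:R ^+ 2 * expR (N%:R - N%:R ^+ 2 / (N + d)%:R) :> R.
  elim: d => [|d IH].
    rewrite addn0 (_ : _ - _ = 0) ?expR0 ?mulr1; first exact: prod_1Dsqr_le_bin.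
    by field; rewrite pnatr_eq0 -lt0n.
  rewrite addnS big_ord_recr /=.
  set n := (N + d)%N in IH *.
  have n0 : (0 < n)%N by rewrite addn_gt0 N0.
  have n0R : n%:R != 0 :> R by rewrite pnatr_eq0 -lt0n.
  have -> : N%:R - N%:R ^+ 2 / n.+1%:R = (N%:R - N%:R ^+ 2 / n%:R) + N%:R ^+ 2 / (n%:R * n.+1%:R) :> R.
    by rewrite -natr1; field; rewrite n0R natr1 pnatr_eq0.
  rewrite expRD mulrA; apply: ler_pM => //.
  - by apply: prodr_ge0 => i _; exact: le_trans ler01 (fac1 _).
  - apply: le_trans (expR_ge1Dx _); rewrite lerD2l ler_wpM2l ?sqr_ge0 //.
    rewrite lef_pV2 ?posrE ?exprn_gt0 ?mulr_gt0 ?ltr0n //.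
    by rewrite expr2 ler_wpM2r // ler_nat.
apply: le_trans (H M) _.
have e16 : 16 ^+ N * expR N%:R <= expR (4 * N%:R) :> R.
  rewrite (_ : 4 * N%:R = N%:R * 3 + N%:R); last by ring.
  rewrite expRD ler_wpM2r ?expR_ge0 // expRM_natl lerXn2r ?nnegrE ?expR_ge0 //.
  exact: expR3_ge16.
have b : ('C(N.*2, N)%:R ^+ 2 <= 16 ^+ N / 4 :> R).
  have := central_bin_le N0; rewrite -(ler_nat R) natrM natrX => h.
  rewrite (_ : 16 ^+ N = (4 ^+ N) ^+ 2); last by rewrite -exprM mulnC exprM; congr (_ ^+ _); ring.
  move: h; set C := 'C(_, _)%:R; set F := 4 ^+ N => h.
  rewrite ler_pdivlMr // (_ : C ^+ 2 * 4 = (2 * C) ^+ 2); last by ring.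
  by rewrite lerXn2r // ?nnegrE ?mulr_ge0 ?exprn_ge0 ?ler0n.
apply: (@le_trans _ _ (16 ^+ N / 4 * expR N%:R)).
  apply: ler_pM => //; rewrite ?sqr_ge0 ?expR_ge0 // ler_expR.
  by rewrite gerBl divr_ge0 // sqr_ge0.
by rewrite mulrAC ler_wpM2r.
Qed.

End ElementaryBounds.

(** * Bounds on the sine constant and on the absolute moment *)

Section Growth.
Variable R : realType.

Lemma ge0_derive_ndecr (f df : R -> R) (x : R) :
  (forall u : R, is_derive u 1 f (df u)) -> (forall u, 0 < u -> 0 <= df u) ->
  0 <= x -> f 0 <= f x.
Proof.
move=> d dp x0; apply: (@ger0_derive1_ndecr R f 0 x) => //.
- by move=> u; rewrite in_itv /= => /andP[u0 _]; rewrite derive1E derive_val; exact: dp.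
- apply: continuous_subspaceT => u; apply: differentiable_continuous.
  by apply/derivable1_diffP; exact: (@ex_derive _ _ _ _ _ _ _ (d u)).
Qed.

Lemma sin_le_id (x : R) : 0 <= x -> sin x <= x.
Proof.
move=> x0; rewrite -subr_ge0.
have := @ge0_derive_ndecr (fun u => u - sin u) (fun u => 1 - cos u) x.
rewrite sin0 subr0; apply => //.
Qed.

Lemma tanh_le_id (x : R) : 0 <= x ->
  expR x - expR (- x) <= x * (expR x + expR (- x)).
Proof.
move=> x0; rewrite -subr_ge0.
have := @ge0_derive_ndecr
  (fun u => u * (expR u + expR (- u)) - (expR u - expR (- u)))
  (fun u => u * (expR u - expR (- u))) x.
rewrite mul0r oppr0 !subrr; apply => //.
- by move=> u; apply: is_derive_eq; rewrite /GRing.scale /=; ring.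
- by move=> u u0; apply: mulr_ge0; [exact: ltW | rewrite subr_ge0 ler_expR; lra].
Qed.

(** The derivative of e^(-u^2/2) cosh u is nonpositive by [tanh_le_id]. *)
Lemma cosh_le (x : R) : 0 <= x -> expR x + expR (- x) <= 2 * expR (x ^+ 2 / 2).
Proof.
move=> x0.
have := @ge0_derive_ndecr
  (fun u => - (expR (- (u ^+ 2 / 2)) * (expR u + expR (- u))))
  (fun u => expR (- (u ^+ 2 / 2)) * (u * (expR u + expR (- u)) - (expR u - expR (- u)))) x.
rewrite expr0n /= mul0r oppr0 expR0 mul1r lerN2 => H.
have : expR (- (x ^+ 2 / 2)) * (expR x + expR (- x)) <= 1 + 1.
  apply: H => //.
  - by move=> u; apply: is_derive_eq; rewrite /GRing.scale /=; field.
  - by move=> u u0; rewrite mulr_ge0 ?expR_ge0 // subr_ge0 tanh_le_id // ltW.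
by rewrite expRN mulrC ler_pdivrMr ?expR_gt0.
Qed.

(** The sine is at most (pi/2) min(a, 2 - a), while K <= 2 / (a (2 - a)); the product is at most pi
    / max(a, 2 - a), and that maximum is at least 1. *)
Lemma norm_sin_kern_mass (a : R) q : 0 < a < 2 ->
  `|sin (pi * (a + 2 * q%:R) / 2)| * kern_mass a <= pi.
Proof.
move=> ha; case/andP: (ha) => a0 a2.
have pi0 : 0 < pi :> R by exact: pi_gt0.
have -> : `|sin (pi * (a + 2 * q%:R) / 2)| = `|sin (pi * a / 2)|.
  rewrite (_ : pi * (a + 2 * q%:R) / 2 = pi * a / 2 + pi *+ q); last by rewrite -mulr_natr; field.
  elim: q => [|q IH]; first by rewrite mulr0n addr0.
  by rewrite (mulrSr pi q) addrA sinDpi normrN.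
have s1 : `|sin (pi * a / 2)| <= pi * a / 2.
  rewrite ger0_norm; first by apply: sin_le_id; rewrite divr_ge0 // mulr_ge0 // ltW.
  by apply: sin_ge0_pi; apply/andP; split; [rewrite divr_ge0 // mulr_ge0 // ltW | nra].
have s2 : `|sin (pi * a / 2)| <= pi * (2 - a) / 2.
  rewrite (_ : pi * a / 2 = - (pi * (2 - a) / 2) + pi); last by field.
  rewrite sinDpi sinN opprK ger0_norm.
    by apply: sin_le_id; rewrite divr_ge0 // mulr_ge0 // ?subr_ge0 // ltW.
  apply: sin_ge0_pi; apply/andP; split; last by nra.
  by rewrite divr_ge0 // mulr_ge0 // ?subr_ge0 // ltW.
have K := kern_mass_le ha.
apply: (le_trans (ler_wpM2l (normr_ge0 _) K)).
have -> : a^-1 + (2 - a)^-1 = 2 / (a * (2 - a)) by field; rewrite !gt_eqF ?subr_gt0.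
rewrite mulrA ler_pdivrMr ?mulr_gt0 ?subr_gt0 //.
have [a1|a1] := leP a 1; nra.
Qed.

(** y^p e^(-ly) is largest at y = p / l; this is 1 + v <= e^v at v = ly/p - 1. *)
Lemma powR_le_expR (p l y : R) : 0 < p -> 0 < l -> 0 <= y ->
  y `^ p <= (p / (expR 1 * l)) `^ p * expR (l * y).
Proof.
move=> p0 l0 y0.
have e0 : 0 < expR 1 :> R by exact: expR_gt0.
have h : y <= p / (expR 1 * l) * expR (l * y / p).
  have := expR_ge1Dx (l * y / p - 1).
  rewrite addrC subrK expRB => h.
  apply: (@le_trans _ _ (p / l * (l * y / p))).
    by rewrite le_eqVlt; apply/orP; left; apply/eqP; field; rewrite !gt_eqF.
  rewrite (_ : p / (expR 1 * l) * _ = p / l * (expR (l * y / p) / expR 1)).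
    by rewrite ler_wpM2l // divr_ge0 // ltW.
  by field; rewrite !gt_eqF.
have c0 : 0 <= p / (expR 1 * l) by rewrite divr_ge0 ?mulr_ge0 // ltW.
apply: (@le_trans _ _ ((p / (expR 1 * l) * expR (l * y / p)) `^ p)).
  by apply: ge0_ler_powR; rewrite ?nnegrE ?(ltW p0) // mulr_ge0 ?expR_ge0.
rewrite powRM ?expR_ge0 //.
by rewrite -expRM divfK // gt_eqF.
Qed.

(** The sum of |sum w|^p over sign vectors w, grouped by the number of negative signs. *)
Definition abs_moment M (p : R) : R :=
  \sum_(j < M.*2.+1) 'C(M.*2, j)%:R * node R M j `^ (p / 2).

Lemma node_powR M j (p : R) : node R M j `^ (p / 2) = (2 * `|j%:R - M%:R|) `^ p.
Proof.
rewrite /node (_ : 4 * _ = (2 * `|j%:R - M%:R|) ^+ 2).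
  rewrite -powR_mulrn ?mulr_ge0 // -powRrM; congr (_ `^ _); by field.
by rewrite exprMn real_normK ?num_real //; ring.
Qed.

(** A Chernoff-type bound: replace |sum w|^p by exponentials of l sum w and -l sum w, sum the
    binomial series to (2 cosh l)^(2M), and apply [cosh_le]. *)
Lemma abs_moment_le M (p : R) : (0 < M)%N -> 0 < p ->
  abs_moment M p <= 2 * 4 ^+ M * (2 * M%:R * p / expR 1) `^ (p / 2).
Proof.
move=> M0 p0.
have M0R : 0 < M%:R :> R by rewrite ltr0n.
have e0 : 0 < expR 1 :> R by exact: expR_gt0.
(* This l minimises the resulting bound, proportional to l^(-p) e^(M l^2). *)
pose l := Num.sqrt (p / (2 * M%:R)).
have l2 : l ^+ 2 = p / (2 * M%:R) by rewrite sqr_sqrtr // divr_ge0 ?mulr_ge0 // ltW.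
have l0 : 0 < l by rewrite sqrtr_gt0 divr_gt0 // mulr_gt0.
have M2E : M.*2%:R = 2 * M%:R :> R by rewrite -mul2n natrM.
have gen (x : R) : \sum_(j < M.*2.+1) 'C(M.*2, j)%:R * expR (x * (2 * (j%:R - M%:R)))
    = (expR x + expR (- x)) ^+ M.*2.
  rewrite addrC exprDn; apply: eq_bigr => j _.
  have jM : (j <= M.*2)%N by rewrite -ltnS.
  rewrite -[RHS]mulr_natl -!expRM_natl -expRD; congr (_ * expR _).
  by rewrite natrB // M2E; ring.
apply: (@le_trans _ _ (\sum_(j < M.*2.+1) 'C(M.*2, j)%:R *
   ((p / (expR 1 * l)) `^ p * (expR (l * (2 * (j%:R - M%:R))) + expR ((- l) * (2 * (j%:R - M%:R))))))).
  apply: ler_sum => j _; rewrite ler_wpM2l // node_powR.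
  apply: le_trans (powR_le_expR p0 l0 _) _; first by rewrite mulr_ge0.
  rewrite ler_wpM2l ?powR_ge0 //.
  have [h|h] := ger0P (j%:R - M%:R : R).
    by rewrite lerDl expR_ge0.
  by rewrite (_ : l * (2 * - _) = - l * (2 * (j%:R - M%:R))) ?lerDr ?expR_ge0 //; ring.
have -> : \sum_(j < M.*2.+1) 'C(M.*2, j)%:R *
   ((p / (expR 1 * l)) `^ p * (expR (l * (2 * (j%:R - M%:R))) + expR ((- l) * (2 * (j%:R - M%:R)))))
   = 2 * (p / (expR 1 * l)) `^ p * (expR l + expR (- l)) ^+ M.*2.
  have g1 := gen l; have g2 := gen (- l); rewrite opprK addrC in g2.
  set c := _ `^ p; set S := (_ + _) ^+ _ in g1 g2 *.
  rewrite (_ : 2 * c * S = c * S + c * S); last by ring.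
  rewrite -{1}g1 -g2 !mulr_sumr -big_split /=.
  by apply: eq_bigr => j _; ring.
rewrite -!mulrA ler_wpM2l // mulrC.
have c := cosh_le (ltW l0).
apply: (@le_trans _ _ ((2 * expR (l ^+ 2 / 2)) ^+ M.*2 * (p / (expR 1 * l)) `^ p)).
  rewrite ler_wpM2r ?powR_ge0 // lerXn2r // nnegrE ?addr_ge0 ?mulr_ge0 ?expR_ge0 //.
rewrite exprMn -mul2n exprM (_ : 2 ^+ 2 = 4); last (by ring). rewrite -mulrA ler_wpM2l ?exprn_ge0 //.
rewrite l2 -expRM_natl natrM (_ : 2 * M%:R * (p / (2 * M%:R) / 2) = p / 2); last by field; rewrite gt_eqF.
have -> : (p / (expR 1 * l)) `^ p = ((2 * M%:R * p) / (expR 1) ^+ 2) `^ (p / 2).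
  have -> : 2 * M%:R * p / expR 1 ^+ 2 = (p / (expR 1 * l)) ^+ 2.
    rewrite expr_div_n exprMn l2; field; by rewrite !gt_eqF.
  rewrite -powR_mulrn; last by rewrite divr_ge0 ?mulr_ge0 // ltW.
  by rewrite -powRrM; congr (_ `^ _); field.
rewrite -[X in expR X]mul1r expRM -powRM ?expR_ge0 //; last first.
  by rewrite divr_ge0 ?sqr_ge0 // !mulr_ge0 // ltW.
by rewrite le_eqVlt; apply/orP; left; apply/eqP; congr (_ `^ _); field; rewrite gt_eqF.
Qed.

End Growth.

(** * Choice of the integration range *)

Section Ratio.
Variable R : realType.

(** From sin(pi/4)^2 = 1/2 and sin x <= x. *)
Lemma pi2_ge8 : 8 <= pi ^+ 2 :> R.
Proof.
have s0 : 0 <= sin (pi / 4) :> R.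
  by apply: sin_ge0_pi; have := pi_gt0 R; move=> ?; apply/andP; split; lra.
have s2 : sin (pi / 4) ^+ 2 = 1 / 2 :> R.
  have := cos_pihalf R; rewrite (_ : pi / 2 = (pi / 4) *+ 2); last by rewrite mulr2n; field.
  rewrite cos_mulr2n cos2sin2 => h; lra.
have := @sin_le_id R (pi / 4); have := pi_gt0 R => p0.
move=> /(_ _)/wrap[]; first by rewrite divr_ge0 // ltW.
move=> h; have : sin (pi / 4) ^+ 2 <= (pi / 4) ^+ 2 :> R.
  by rewrite lerXn2r // nnegrE divr_ge0 // ltW.
rewrite s2; lra.
Qed.

(* The integral of [t^(p-1) / prod_i (1 + t^2 / 4 i^2)] is estimated on         *)
(* [0 < t < 2 N]; any [N] between [p / 4] and [p / 2] is good enough.           *)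
Lemma scale_choice (p : R) : 1 <= p ->
  exists2 N : nat, (0 < N)%N &
    Num.sqrt (4 * p / (3 * expR 1 ^+ 2)) * (p / expR 1 ^+ 2) `^ p
      <= 3 * p * expR (- (4 * N%:R)) * (2 * N%:R) `^ p.
Proof.
move=> p1.
have p0 : 0 < p by exact: lt_le_trans p1.
have e3 := expR1_le3 R; have e2 := expR1_ge R.
have e0 : 0 < expR 1 :> R by exact: expR_gt0.
have E0 : 0 < expR 1 ^+ 2 :> R by rewrite exprn_gt0.
have EE : expR 2 = expR 1 ^+ 2 :> R by rewrite -expRM_natl mulr1.
have [p2|p2] := ltP p 2.
  (* After cancelling 2^p, the bounds 2/3 on the square root and p / (2 e^2) on the power leave
     e^(-2) >= 1/9, that is, e <= 3. *)
  exists 1%N => //; rewrite !mulr1.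
  have h1 : Num.sqrt (4 * p / (3 * expR 1 ^+ 2)) <= 2 / 3 :> R.
    rewrite -[leRHS]ger0_norm ?divr_ge0 // -sqrtr_sqr ler_wsqrtr //.
    rewrite ler_pdivrMr ?mulr_gt0 //; nra.
  have h2 : (p / expR 1 ^+ 2) `^ p = 2 `^ p * (p / expR 1 ^+ 2 / 2) `^ p.
    rewrite -powRM // ?divr_ge0 ?(ltW p0) ?(ltW E0) //; congr (_ `^ _); field.
    by rewrite gt_eqF.
  have x0 : 0 < p / expR 1 ^+ 2 / 2 by rewrite !divr_gt0.
  have h3 : (p / expR 1 ^+ 2 / 2) `^ p <= p / expR 1 ^+ 2 / 2.
    by apply: ge1r_powR => //; rewrite x0 /= !ler_pdivrMr //; nra.
  have P0 : 0 < 2 `^ p :> R by exact: powR_gt0.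
  rewrite h2 mulrCA [leRHS]mulrC ler_pM2l //.
  apply: (@le_trans _ _ (2 / 3 * (p / expR 1 ^+ 2 / 2))).
    by apply: ler_pM; rewrite ?sqrtr_ge0 ?powR_ge0.
  have -> : expR (- 4) = (expR 1 ^+ 2)^-1 * (expR 1 ^+ 2)^-1 :> R.
    by rewrite -EE -expRN -expRD; congr expR; ring.
  have i9 : 1 / 9 <= (expR 1 ^+ 2)^-1 :> R.
    by rewrite div1r lef_pV2 ?posrE //; nra.
  set y := (expR 1 ^+ 2)^-1 in i9 *.
  by have : 0 <= p * y * (y - 1 / 9); [rewrite !mulr_ge0 //; lra | nra].
pose N := (Num.truncn (p / 4)).+1.
have p40 : 0 <= p / 4 by rewrite divr_ge0 // ltW.
have /andP[N1 N2] := truncn_itv p40.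
have NE : N%:R = (Num.truncn (p / 4))%:R + 1 :> R by rewrite natr1.
have Nlo : p / 4 < N%:R by [].
have Nhi : N%:R <= p / 2.
  have [p4|p4] := leP 4 p; first by rewrite NE; lra.
  rewrite /N (_ : Num.truncn (p / 4) = 0%N); first by lra.
  apply/eqP; rewrite -leqn0 -ltnS -(ltr_nat R); lra.
have N0 : 0 < N%:R :> R by rewrite ltr0n.
exists N => //.
have h1 : Num.sqrt (4 * p / (3 * expR 1 ^+ 2)) <= p.
  rewrite -[leRHS]ger0_norm ?(ltW p0) // -sqrtr_sqr ler_wsqrtr //.
  rewrite ler_pdivrMr ?mulr_gt0 //.
  have E6 : 2 <= expR 1 ^+ 2 :> R by nra.
  have pp : 2 * p <= p ^+ 2 by rewrite expr2 ler_pM2r.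
  have := ler_pM _ _ pp E6; rewrite mulr_ge0 ?(ltW p0) //= => /(_ isT (ler0n _ _)); lra.
have h2 : (p / expR 1 ^+ 2) `^ p <= expR (- (4 * N%:R)) * (2 * N%:R) `^ p.
  have x0 : 0 < 2 * N%:R / p by rewrite divr_gt0 // mulr_gt0.
  have -> : (2 * N%:R) `^ p = p `^ p * (2 * N%:R / p) `^ p.
    rewrite -powRM // ?(ltW p0) ?(ltW x0) //; congr (_ `^ _); field; by rewrite gt_eqF.
  rewrite powRM ?(ltW p0) ?invr_ge0 ?(ltW E0) // mulrCA ler_pM2l ?powR_gt0 //.
  rewrite -EE -expRN -expRM /powR (gt_eqF x0) -expRD ler_expR.
  (* With x = 2N / p in [1/2, 1] the claim becomes 2(x - 1) <= ln x, which follows from ln x >= 1 -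
     1/x = (x - 1) / x. *)
  have l : 1 - (2 * N%:R / p)^-1 <= ln (2 * N%:R / p).
    set x := 2 * N%:R / p in x0 *.
    have xV : 0 < x^-1 by rewrite invr_gt0.
    have := @le_ln1Dx R (x^-1 - 1); rewrite (_ : 1 + (x^-1 - 1) = x^-1); last by ring.
    rewrite lnV ?posrE // => h.
    have := h _; suff: -1 < x^-1 - 1 by move=> h' /(_ h'); lra.
    lra.
  have -> : - 2 * p = 2 * (p * (2 * N%:R / p) - p) - 4 * N%:R.
    by field; rewrite gt_eqF.
  suff : 2 * (p * (2 * N%:R / p) - p) <= p * ln (2 * N%:R / p) by move=> ?; lra.
  set x := 2 * N%:R / p in x0 l *.
  have x1 : x <= 1 by rewrite ler_pdivrMr //; lra.
  have x2 : 1 <= 2 * x by rewrite /x mulrA ler_pdivlMr //; lra.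
  rewrite (_ : 2 * (p * x - p) = p * (2 * (x - 1))); last by ring.
  rewrite ler_pM2l //; apply: le_trans l.
  have -> : 1 - x^-1 = (x - 1) * x^-1 by field; rewrite gt_eqF.
  have : x^-1 <= 2 by rewrite -[leRHS]invrK lef_pV2 ?posrE //; lra.
  move: (x^-1) => y; nra.
have h3 := powR_ge0 (p / expR 1 ^+ 2) p.
apply: (@le_trans _ _ (p * (p / expR 1 ^+ 2) `^ p)); first by rewrite ler_wpM2r.
rewrite -!mulrA (mulrC 3) -mulrA ler_pM2l // mulrC; lra.
Qed.
End Ratio.

(** * The ratio of the alternating sum to the absolute moment *)

Section Bias.
Variable R : realType.

Lemma central_binE M :
  'C(M.*2, M)%:R = \prod_(i < M) (2 * i.*2.+1%:R / i.+1%:R) :> R.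
Proof.
elim: M => [|M IH]; first by rewrite big_ord0.
have e : M.+1%:R * 'C(M.+1.*2, M.+1)%:R = 2 * M.*2.+1%:R * 'C(M.*2, M)%:R :> R.
  by rewrite -!natrM central_binS.
rewrite big_ord_recr /= -IH; apply: (mulfI (_ : M.+1%:R != 0)); first by rewrite pnatr_eq0.
by rewrite e; field; rewrite nat1r pnatr_eq0.
Qed.

Lemma pow4_le_central_bin M : (0 < M)%N ->
  4 ^+ M <= 2 * Num.sqrt M%:R * 'C(M.*2, M)%:R :> R.
Proof.
move=> M0; have := central_bin_ge M0.
rewrite -(ler_nat R) !natrM !natrX => h.
rewrite -[leLHS]ger0_norm ?exprn_ge0 // -sqrtr_sqr.
have -> : 2 * Num.sqrt M%:R * 'C(M.*2, M)%:R = Num.sqrt (4 * M%:R * 'C(M.*2, M)%:R ^+ 2) :> R.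
  rewrite sqrtrM ?mulr_ge0 // sqrtr_sqr ger0_norm // sqrtrM //.
  rewrite (_ : 4 = 2 ^+ 2 :> R); last by ring.
  by rewrite sqrtr_sqr ger0_norm.
rewrite ler_wsqrtr // -exprM mulnC exprM (_ : 4 ^+ 2 = 16) //; ring.
Qed.

(** [altsum_powR_lower] and [norm_sin_kern_mass] bound E from below, [abs_moment_le] and
    [pow4_le_central_bin] bound A from above, both as multiples of C(2M, M); [scale_choice] compares
    what remains. *)
Lemma parity_bias (p : R) (k M : nat) : 1 <= p -> (forall z : int, p <> 2 * z%:~R) ->
  p < k%:R -> (k <= 2 * M)%N -> (6 * M <= 4 * k)%N ->
  abs_moment M p * (`|sin (pi * p / 2)| / (3 * p ^+ 2)) *
    (2 * p / (expR 1 ^+ 2 * pi ^+ 2 * k%:R)) `^ ((p + 1) / 2)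
  <= `|altsum M (fun x => x `^ (p / 2))| /\ 0 < `|altsum M (fun x => x `^ (p / 2))|.
Proof.
move=> p1 pe pk kM Mk.
have p0 : 0 < p by exact: lt_le_trans p1.
have k0 : 0 < k%:R :> R by exact: lt_trans pk.
have M0 : (0 < M)%N by move: k0; rewrite ltr0n; lia.
have M0R : 0 < M%:R :> R by rewrite ltr0n.
have e3 := expR1_le3 R; have e2 := expR1_ge R.
have e0 : 0 < expR 1 :> R by exact: expR_gt0.
have pi0 : 0 < pi :> R by exact: pi_gt0.
have p20 : 0 <= p / 2 by rewrite divr_ge0 // ltW.
have /andP[q1 q2] := truncn_itv p20.
set q := Num.truncn (p / 2) in q1 q2.
pose a := p - 2 * q%:R.
(* Here [a] is p reduced modulo 2; it is nonzero because p is not an even integer. *)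
have ha : 0 < a < 2.
  apply/andP; split; last by rewrite /a; move: q2; rewrite -(natr1 q); lra.
  rewrite lt_neqAle; apply/andP; split; last by rewrite /a; lra.
  by apply/eqP => a0; apply: (pe q%:Z); rewrite -[q%:Z%:~R]/(q%:R); move: a0; rewrite /a; lra.
have pE : a + 2 * q%:R = p by rewrite /a; ring.
have qM : (q < M)%N.
  rewrite -(ltr_nat R); move: kM; rewrite -(ler_nat R) natrM; lra.
have [N N0 hN] := scale_choice p1.
have N0R : 0 < N%:R :> R by rewrite ltr0n.
pose C : R := 'C(M.*2, M)%:R.
have C0 : 0 < C by rewrite /C ltr0n bin_gt0 -addnn leq_addr.
(* Integrate up to t = e^u = 2N: there e^(2u) <= 4N^2, so the product is at least C(2M, M) divided
   by the product of 1 + N^2 / i^2. *)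
have hQ : C * (4 * expR (- (4 * N%:R))) * (expR (p * ln (2 * N%:R)) / p)
    <= kern_mass a * `|altsum M (fun x => x `^ (p / 2))|.
  have /= := @altsum_powR_lower R a q M (ln (2 * N%:R)) (C * (4 * expR (- (4 * N%:R)))) ha qM.
  rewrite pE; apply; last first.
    by rewrite !mulr_ge0 ?expR_ge0 // ltW.
  move=> u uL.
  have su : expR (2 * u) <= 4 * N%:R ^+ 2.
    rewrite expRM_natl (_ : 4 * _ = (2 * N%:R) ^+ 2); last by ring.
    rewrite lerXn2r ?nnegrE ?expR_ge0 ?mulr_ge0 //.
    by rewrite -[leRHS]lnK ?posrE ?mulr_gt0 // ler_expR.
  apply: (@le_trans _ _ (C * (\prod_(i < M) (1 + N%:R ^+ 2 / i.+1%:R ^+ 2))^-1)).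
    rewrite ler_pM2l //.
    have -> : 4 * expR (- (4 * N%:R)) = (expR (4 * N%:R) / 4)^-1 :> R.
      by rewrite expRN invf_div mulrC.
    rewrite lef_pV2 ?posrE ?divr_gt0 ?expR_gt0 //; first exact: prod_1Dsqr_le.
    by apply: prodr_gt0 => i _; rewrite ltr_wpDr // divr_ge0 // sqr_ge0.
  rewrite /C central_binE -prodfV -big_split /=.
  apply: ler_prod => i _; apply/andP; split.
    by rewrite !mulr_ge0 // invr_ge0 // addr_ge0 // divr_ge0 // sqr_ge0.
  have i0 : 0 < i.+1%:R :> R by [].
  have d0 : 0 < i.+1%:R ^+ 2 + N%:R ^+ 2 :> R by rewrite addr_gt0 ?exprn_gt0.
  have -> : 2 * i.*2.+1%:R / i.+1%:R / (1 + N%:R ^+ 2 / i.+1%:R ^+ 2)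
     = (8 * i.+1%:R * i.*2.+1%:R) / (4 * N%:R ^+ 2 + 4 * i.+1%:R ^+ 2) :> R.
    field; rewrite nat1r pnatr_eq0 /= !gt_eqF //; lra.
  have s1 : 0 < 4 * i.+1%:R ^+ 2 :> R by rewrite mulr_gt0 ?exprn_gt0.
  apply: ler_wpM2l; first by rewrite !mulr_ge0.
  rewrite lef_pV2 ?lerD2r //; rewrite posrE addr_gt0 ?expR_gt0 //.
  by rewrite mulr_gt0 // exprn_gt0.
have hS := @norm_sin_kern_mass R a q ha; rewrite pE in hS.
set S := `|sin _| in hS *; set E := `|altsum _ _| in hQ *.
set X := 2 * p / _.
have S0 : 0 <= S by exact: normr_ge0.
have E0 : 0 <= E by exact: normr_ge0.
have X0 : 0 < X by rewrite divr_gt0 ?mulr_gt0 ?exprn_gt0.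
have powE : expR (p * ln (2 * N%:R)) = (2 * N%:R) `^ p by rewrite /powR gt_eqF // mulr_gt0.
rewrite powE in hQ.
split; last first.
  rewrite lt_neqAle E0 andbT eq_sym; apply/eqP => E00; move: hQ.
  rewrite E00 mulr0 leNgt => /negP; apply.
  by rewrite !mulr_gt0 ?invr_gt0 ?expR_gt0 // powR_gt0 // mulr_gt0.
have h1 : S * (C * (4 * expR (- (4 * N%:R))) * ((2 * N%:R) `^ p / p)) <= pi * E.
  apply: (le_trans (ler_wpM2l S0 hQ)).
  by rewrite mulrA ler_wpM2r.
rewrite -(ler_pM2l pi0); apply: le_trans h1.
have hA := abs_moment_le M0 p0; have h4 := pow4_le_central_bin M0; rewrite -/C in h4.
have A2 : abs_moment M p <= 4 * Num.sqrt M%:R * C * (2 * M%:R * p / expR 1) `^ (p / 2).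
  apply: (le_trans hA); rewrite ler_wpM2r ?powR_ge0 //.
  by rewrite (_ : 4 * _ * _ = 2 * (2 * Num.sqrt M%:R * C)) ?ler_wpM2l //; ring.
set Y := (2 * M%:R * p / expR 1) `^ (p / 2) in A2.
have Y0 : 0 <= Y by exact: powR_ge0.
have key : pi * Num.sqrt M%:R * Y * X `^ ((p + 1) / 2)
    <= Num.sqrt (4 * p / (3 * expR 1 ^+ 2)) * (p / expR 1 ^+ 2) `^ p.
  have MkR : 6 * M%:R <= 4 * k%:R :> R by rewrite -!natrM ler_nat.
  have -> : X `^ ((p + 1) / 2) = X `^ (p / 2) * Num.sqrt X.
    rewrite -powR12_sqrt ?(ltW X0) // -powRD ?(gt_eqF X0) ?implybT //.
    by congr (_ `^ _); field.
  have -> : pi * Num.sqrt M%:R * Y * (X `^ (p / 2) * Num.sqrt X)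
     = Num.sqrt (pi ^+ 2 * M%:R * X) * (2 * M%:R * p / expR 1 * X) `^ (p / 2).
    rewrite powRM ?(ltW X0) //; last by rewrite divr_ge0 ?mulr_ge0 // ltW.
    have -> : Num.sqrt (pi ^+ 2 * M%:R * X) = pi * Num.sqrt M%:R * Num.sqrt X :> R.
      have pM : 0 <= pi ^+ 2 * M%:R :> R by rewrite mulr_ge0 ?sqr_ge0.
      by rewrite (sqrtrM _ pM) (sqrtrM _ (sqr_ge0 (pi : R))) sqrtr_sqr ger0_norm ?(ltW pi0).
    by rewrite -/Y; ring.
  (* The half power of X absorbs pi and the square root of M, using M / k <= 2/3; the power p/2 is
     paired with Y. *)
  apply: ler_pM; rewrite ?sqrtr_ge0 ?powR_ge0 //.
    apply: ler_wsqrtr.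
    have -> : pi ^+ 2 * M%:R * X = 2 * p * M%:R / (expR 1 ^+ 2 * k%:R).
      by rewrite /X; move: (@pi R) pi0 => r r0; field; rewrite !gt_eqF.
    rewrite ler_pdivrMr ?mulr_gt0 ?exprn_gt0 //.
    have -> : 4 * p / (3 * expR 1 ^+ 2) * (expR 1 ^+ 2 * k%:R) = p * (4 * k%:R) / 3.
      by field; rewrite !gt_eqF.
    by rewrite ler_pdivlMr //; nra.
  have -> : (p / expR 1 ^+ 2) `^ p = ((p / expR 1 ^+ 2) ^+ 2) `^ (p / 2).
    rewrite -(@powR_mulrn _ (p / expR 1 ^+ 2) 2); last by rewrite divr_ge0 ?sqr_ge0 // ltW.
    by rewrite -powRrM; congr (_ `^ _); field.
  have P8 := pi2_ge8 R.
  apply: ge0_ler_powR => //; rewrite ?nnegrE.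
  - by apply: mulr_ge0; [rewrite divr_ge0 ?mulr_ge0 // ltW | exact: ltW].
  - by rewrite sqr_ge0.
  have -> : 2 * M%:R * p / expR 1 * X = p ^+ 2 / expR 1 ^+ 4 * (4 * M%:R * expR 1 / (pi ^+ 2 * k%:R)).
    by rewrite /X; move: (@pi R) pi0 => r r0; field; rewrite !gt_eqF.
  have -> : (p / expR 1 ^+ 2) ^+ 2 = p ^+ 2 / expR 1 ^+ 4 * 1 by field; rewrite gt_eqF.
  rewrite ler_wpM2l ?divr_ge0 ?exprn_ge0 ?(ltW p0) ?(ltW e0) //.
  rewrite ler_pdivrMr ?mulr_gt0 ?exprn_gt0 // mul1r.
  (* 4 M e <= 12 M <= 8 k <= pi^2 k. *)
  apply: (@le_trans _ _ (8 * k%:R)); last by rewrite ler_pM2r.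
  apply: (@le_trans _ _ (4 * M%:R * 3)); last by lra.
  by rewrite ler_wpM2l // mulr_ge0.
have hh := le_trans key hN.
have A3 : abs_moment M p * (S / (3 * p ^+ 2)) * X `^ ((p + 1) / 2) <=
   4 * Num.sqrt M%:R * C * Y * (S / (3 * p ^+ 2)) * X `^ ((p + 1) / 2).
  by rewrite !ler_wpM2r ?powR_ge0 // divr_ge0 // mulr_ge0 // sqr_ge0.
apply: le_trans (ler_wpM2l (ltW pi0) A3) _.
have -> : pi * (4 * Num.sqrt M%:R * C * Y * (S / (3 * p ^+ 2)) * X `^ ((p + 1) / 2))
  = 4 * C * S / (3 * p ^+ 2) * (pi * Num.sqrt M%:R * Y * X `^ ((p + 1) / 2)).
  by field; rewrite gt_eqF.
have -> : S * (C * (4 * expR (- (4 * N%:R))) * ((2 * N%:R) `^ p / p))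
  = 4 * C * S / (3 * p ^+ 2) * (3 * p * expR (- (4 * N%:R)) * (2 * N%:R) `^ p).
  by field; rewrite gt_eqF.
rewrite ler_wpM2l // divr_ge0 ?mulr_ge0 ?sqr_ge0 // ltW //.
Qed.

Lemma altsum_le_abs_moment M (p : R) : `|altsum M (fun x => x `^ (p / 2))| <= abs_moment M p.
Proof.
apply: le_trans (ler_norm_sum _ _ _) _; apply: ler_sum => j _.
by rewrite !normrM normr_sign mul1r !ger0_norm ?powR_ge0.
Qed.

End Bias.

Local Close Scope classical_set_scope.

(** * The parity gadget *)

Section SignVectors.
Variable R : realType.
Variable p : R.

Lemma sum_sets_card (V : nmodType) (T : finType) (F : nat -> V) :
  \sum_(W : {set T}) F #|W| = \sum_(j < #|T|.+1) F j *+ 'C(#|T|, j).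
Proof.
pose c (W : {set T}) : 'I_#|T|.+1 := inord #|W|.
have cE W : c W = #|W| :> nat by rewrite inordK // ltnS max_card.
rewrite (partition_big c xpredT) //=; apply: eq_bigr => j _.
rewrite (eq_bigr (fun=> F j)); last by move=> W /eqP <-; rewrite cE.
rewrite sumr_const; congr (_ *+ _); rewrite -(card_draws T j).
by apply: eq_card => W; rewrite [RHS]inE unfold_in -[LHS]/(nat_of_ord (c W) == nat_of_ord j) cE.
Qed.

Definition sgn (T : finType) (W : {set T}) (j : T) : R := (-1) ^+ (j \in W).

Definition sgn_moment (T : finType) (W : {set T}) : R := `|\sum_j sgn W j| `^ p.

Lemma sum_sgn (T : finType) (W : {set T}) : \sum_j sgn W j = #|T|%:R - 2 * #|W|%:R.
Proof.
rewrite (bigID (mem W)) /= (eq_bigr (fun=> -1)); last by move=> j h; rewrite /sgn h.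
rewrite [X in _ + X](eq_bigr (fun=> 1)); last by move=> j /negbTE h; rewrite /sgn h.
rewrite !sumr_const mulNrn -(cardsC W) natrD.
have -> : #|(fun j => j \notin mem W)| = #|~: W| by apply: eq_card => j; rewrite !inE.
ring.
Qed.

Lemma sgn_momentE M (W : {set 'I_M.*2}) :
  sgn_moment W = node R M #|W| `^ (p / 2).
Proof.
have M2 : M.*2%:R = 2 * M%:R :> R by rewrite -mul2n natrM.
rewrite node_powR /sgn_moment sum_sgn card_ord M2 -mulrBr normrM.
by rewrite ger0_norm // distrC.
Qed.

Definition half_moment M (b : bool) : R :=
  \sum_(W : {set 'I_M.*2} | odd #|W| == b) sgn_moment W.

Lemma half_momentD M : half_moment M false + half_moment M true = abs_moment M p.
Proof.
rewrite /half_moment /abs_moment.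
have -> : \sum_(W : {set 'I_M.*2} | odd #|W| == true) sgn_moment W
  = \sum_(W : {set 'I_M.*2} | ~~ (odd #|W| == false)) sgn_moment W.
  by apply: eq_bigl => W; case: odd.
transitivity (\sum_(W : {set 'I_M.*2}) sgn_moment W).
  by rewrite [RHS](bigID (fun W : {set 'I_M.*2} => odd #|W| == false)).
under eq_bigr do rewrite sgn_momentE.
rewrite (sum_sets_card _ (fun j => node R M j `^ (p / 2))) card_ord.
by apply: eq_bigr => j _; rewrite mulr_natl.
Qed.

Lemma half_momentB M : half_moment M false - half_moment M true
  = altsum M (fun x => x `^ (p / 2)).
Proof.
rewrite /half_moment /altsum -sumrN.
have -> : \sum_(W : {set 'I_M.*2} | odd #|W| == false) sgn_moment W
  = \sum_(W : {set 'I_M.*2} | odd #|W| == false) (-1) ^+ #|W| * sgn_moment W.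
  by apply: eq_bigr => W /eqP o; rewrite -signr_odd o mul1r.
have -> : \sum_(W : {set 'I_M.*2} | odd #|W| == true) - sgn_moment W
  = \sum_(W : {set 'I_M.*2} | ~~ (odd #|W| == false)) (-1) ^+ #|W| * sgn_moment W.
  rewrite (eq_bigl (fun W : {set 'I_M.*2} => ~~ (odd #|W| == false))).
    by apply: eq_bigr => W; rewrite eqbF_neg negbK => o; rewrite -signr_odd o mulN1r.
  by move=> W; case: odd.
transitivity (\sum_(W : {set 'I_M.*2}) (-1) ^+ #|W| * sgn_moment W).
  by rewrite [RHS](bigID (fun W : {set 'I_M.*2} => odd #|W| == false)).
under eq_bigr do rewrite sgn_momentE.
rewrite (sum_sets_card _ (fun j => (-1) ^+ j * node R M j `^ (p / 2))) card_ord.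
by apply: eq_bigr => j _; rewrite -mulr_natl; ring.
Qed.

Definition symdiff (T : finType) (W Y : {set T}) : {set T} :=
  [set j | (j \in W) (+) (j \in Y)].

Lemma symdiffK (T : finType) (Y : {set T}) : involutive (@symdiff T ^~ Y).
Proof. by move=> W; apply/setP => j; rewrite !inE -addbA addbb addbF. Qed.

Lemma odd_symdiff (T : finType) (W Y : {set T}) :
  odd #|symdiff W Y| = odd #|W| (+) odd #|Y|.
Proof.
have H (V : {set T}) : odd #|V| = \big[addb/false]_j (j \in V).
  rewrite -sum1_card big_mkcond /=.
  by elim/big_rec2: _ => // j b n _ <-; rewrite oddD; case: (j \in V).
by rewrite !H -big_split /=; apply: eq_bigr => j _; rewrite inE.
Qed.

Lemma sgn_symdiff (T : finType) (W Y : {set T}) j :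
  sgn (symdiff W Y) j = sgn W j * sgn Y j.
Proof. by rewrite /sgn inE signr_addb. Qed.

(** Multiplying sign vectors entrywise is taking symmetric differences of their negative sets, a
    bijection that shifts the parity by that of Y. *)
Lemma half_moment_symdiff M (Y : {set 'I_M.*2}) b :
  \sum_(W : {set 'I_M.*2} | odd #|W| == b) `|\sum_j sgn W j * sgn Y j| `^ p
  = half_moment M (b (+) odd #|Y|).
Proof.
rewrite /half_moment (reindex_inj (inv_inj (symdiffK Y))) /=.
apply: eq_big => [W|W _].
  by rewrite odd_symdiff; case: odd; case: odd; case: b.
congr (`|_| `^ p); apply: eq_bigr => j _.
by rewrite sgn_symdiff -mulrA /sgn -signr_addb addbb mulr1.
Qed.

End SignVectors.

(** * From table indices to real values *)

Section RowValues.
Variable R : realType.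
Variable p : R.

Definition op_val (o : option bool) : R :=
  match o with None => 0 | Some b => 2 * (-1) ^+ b end.

Lemma entry_index_bounds q ops l i :
  (entry_index q ops l i <= q + 2 * size ops)%N /\
  (q <= entry_index q ops l i + 2 * size ops)%N.
Proof.
elim: ops l q => [|o ops IH] [|a l] q /=; try by lia.
have [] := IH l (if a == i then shift_index o q else q).
by case: (a == i); case: o => [[]|] /=; lia.
Qed.

(** The hypothesis keeps the truncated predecessor of [shift_index] away from 0. *)
Lemma entry_index_val q ops l i : (2 * size ops <= q)%N ->
  (entry_index q ops l i)%:R = q%:R + \sum_(x <- zip ops l) (x.2 == i)%:R * op_val x.1 :> R.
Proof.
elim: ops l q => [|o ops IH] [|a l] q /= qs; rewrite ?big_nil ?addr0 //.
rewrite big_cons IH /=; last by case: (a == i); case: o => [[]|] /=; lia.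
rewrite addrA; congr (_ + _).
case: (a == i); rewrite ?mul0r ?addr0 // mul1r.
case: o => [[]|] /=; rewrite ?addr0 //.
  rewrite expr1 mulrN1 -[LHS](addrK 2) -natrD; congr (_%:R - _); lia.
by rewrite expr0 mulr1 -natrD addn2.
Qed.

Definition row_value (theta : seq R) n (x : row_indices) (z : 'I_n -> R) : R :=
  \sum_(i < n) theta`_(x.1 i) * z i - theta`_x.2.

Definition index_table (rho : R) (h : nat) : seq R :=
  mkseq (fun q => rho * (q%:R - h%:R)) h.*2.+1.

(** [base] is where a progression with zero at its centre [base + h] starts in [theta], so a shift
    of the index by two changes the entry by 2 [rho]. *)
Lemma row_value_tmpl (theta : seq R) (base h : nat) (rho : R) n (ops : seq (option bool))
    (tgt : nat) (l : seq 'I_n) (z : 'I_n -> R) :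
  (2 * size ops <= h)%N -> (tgt <= h.*2)%N ->
  (forall q, (q <= h.*2)%N -> theta`_(base + q) = rho * (q%:R - h%:R)) ->
  row_value theta (tmpl_row (RowTmpl (base + h) ops (base + tgt)) (map val l)) z
  = rho * (\sum_(x <- zip ops l) op_val x.1 * z x.2 - (tgt%:R - h%:R)).
Proof.
move=> sh th ht; rewrite /row_value /= ht // [RHS]mulrBr; congr (_ - _).
transitivity (\sum_(i < n) rho * (\sum_(x <- zip ops l) (x.2 == i)%:R * op_val x.1) * z i).
  apply: eq_bigr => i _; congr (_ * _).
  have [b1 b2] := entry_index_bounds (base + h) ops (map val l) i.
  have b0 : (base <= entry_index (base + h) ops (map val l) i)%N by lia.
  rewrite -(subnKC b0) ht; last by lia.
  rewrite natrB // entry_index_val; last by lia.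
  have -> : \sum_(x <- zip ops (map val l)) (x.2 == i)%:R * op_val x.1
       = \sum_(x <- zip ops l) (x.2 == i)%:R * op_val x.1.
    have -> : zip ops (map val l) = [seq (x.1, val x.2) | x <- zip ops l].
      by elim: (ops) (l) => [|o os IH] [|a l'] //=; rewrite IH.
    by rewrite big_map; apply: eq_bigr => x _ /=; rewrite (inj_eq val_inj).
  by rewrite natrD; ring.
rewrite mulr_sumr; under eq_bigr do rewrite mulr_sumr mulr_suml.
rewrite exchange_big /=; apply: eq_bigr => x _.
rewrite (bigD1 x.2) //= eqxx big1 ?addr0; first by rewrite mul1r mulrA.
by move=> i; rewrite eq_sym => /negbTE ->; rewrite mul0r mulr0 mul0r.
Qed.

End RowValues.

(* Constraints are padded with constants to an even length, since alternating *)
(* sums over odd lengths vanish by symmetry. *)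
Definition width (k : nat) : nat := (uphalf k).*2.

Lemma leq_width k : (k <= width k)%N. Proof. rewrite /width; lia. Qed.

(** Large enough for k shifts by two in either direction and for target offsets of up to [width k],
    which is at most k + 1. *)
Definition table_center (k : nat) : nat := k.*2.+2.

(** W is the set of negative signs; the target is offset by 2M - 2 |W|, the sum of all signs. *)
Definition gadget_tmpl k (W : {set 'I_(width k)}) : row_tmpl :=
  RowTmpl (table_center k)
    [seq Some (widen_ord (leq_width k) j \in W) | j <- enum 'I_k]
    (table_center k + width k - 2 * #|W|).

(** These rows use the second table, scaled by omega, which starts right after the first. *)
Definition binary_tmpl k (j0 : 'I_k) : row_tmpl :=
  RowTmpl ((table_center k).*2.+1 + table_center k)
    [seq if j == j0 then Some false else None | j <- enum 'I_k]
    ((table_center k).*2.+1 + (table_center k).+1).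

Definition templates k (sigma b : bool) : seq row_tmpl :=
  [seq gadget_tmpl W | W : {set 'I_(width k)} <- enum {: {set 'I_(width k)}} & odd #|W| == b (+) sigma]
    ++ [seq binary_tmpl j | j <- enum 'I_k].

(** * The cost of one constraint *)

Section Costs.
Variable R : realType.
Variables (p : R) (k : nat).
Definition constants (omega rad : R) : seq R :=
  index_table 1 (table_center k) ++ index_table omega (table_center k) ++ [:: rad].

Lemma constants0 omega rad q : (q <= (table_center k).*2)%N ->
  (constants omega rad)`_(0 + q) = 1 * (q%:R - (table_center k)%:R).
Proof.
by move=> qh; rewrite /constants nth_cat size_mkseq add0n ltnS qh nth_mkseq.
Qed.

Lemma constants1 omega rad q : (q <= (table_center k).*2)%N ->
  (constants omega rad)`_((table_center k).*2.+1 + q) = omega * (q%:R - (table_center k)%:R).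
Proof.
move=> qh; rewrite /constants nth_cat size_mkseq ifF; last by lia.
by rewrite addKn nth_cat size_mkseq ltnS qh nth_mkseq.
Qed.

Lemma constants_rad omega rad : (constants omega rad)`_((table_center k).*2.+1).*2 = rad.
Proof.
rewrite /constants nth_cat size_mkseq ifF; last by lia.
by rewrite -addnn addKn nth_cat size_mkseq ltnn subnn.
Qed.

Section OneConstraint.
Variables (omega rad : R) (n : nat) (l : k.-tuple 'I_n) (z : 'I_n -> R).

Let zip_enum (f : 'I_k -> option bool) (G : option bool -> 'I_n -> R) :
  \sum_(x <- zip [seq f j | j <- enum 'I_k] l) G x.1 x.2 = \sum_(j < k) G (f j) (tnth l j).
Proof.
have -> : zip [seq f j | j <- enum 'I_k] l = [seq (f j, tnth l j) | j <- enum 'I_k].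
  rewrite {1}(tuple_map_ord l) /= ; elim: (enum 'I_k) => //= j s -> //.
by rewrite big_map big_enum.
Qed.

(** This is -<w, y> for y = 1 - 2z padded with ones: the padding contributes to the target only. *)
Lemma gadget_row_value (W : {set 'I_(width k)}) :
  row_value (constants omega rad) (tmpl_row (gadget_tmpl W) (map val l)) z
  = \sum_(j < k) 2 * sgn R W (widen_ord (leq_width k) j) * z (tnth l j)
    - \sum_j sgn R W j.
Proof.
have cW : (#|W| <= width k)%N by rewrite -[leqRHS]card_ord max_card.
have wk : (width k <= k.+1)%N by rewrite /width; lia.
rewrite /gadget_tmpl -[in RowTmpl _ _ _](add0n (table_center k)).
rewrite -[X in RowTmpl _ _ X]add0n.
rewrite (row_value_tmpl (rho := 1)); first last.
- by move=> q; exact: constants0.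
- by rewrite /table_center; lia.
- by rewrite size_map size_enum_ord /table_center; lia.
rewrite mul1r (zip_enum _ (fun o i => op_val R o * z i)); congr (_ - _).
  by rewrite sum_sgn card_ord natrB ?natrD ?natrM; [ring | rewrite /table_center; lia].
Qed.

Lemma binary_row_value (j0 : 'I_k) :
  row_value (constants omega rad) (tmpl_row (binary_tmpl j0) (map val l)) z
  = omega * (2 * z (tnth l j0) - 1).
Proof.
rewrite /binary_tmpl (row_value_tmpl (rho := omega)); first last.
- by move=> q; exact: constants1.
- by rewrite /table_center; lia.
- by rewrite size_map size_enum_ord /table_center; lia.
rewrite (zip_enum _ (fun o i => op_val R o * z i)).
rewrite (bigD1 j0) //= eqxx big1 ?addr0; last by move=> j /negbTE -> /=; rewrite mul0r.
by rewrite -natr1 /= expr0 mulr1; congr (_ * _); ring.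
Qed.

Lemma constraint_cost sigma b : 0 <= omega ->
  \sum_(x <- constraint_rows (templates k sigma) (map val l, b))
    `|row_value (constants omega rad) x z| `^ p
  = \sum_(W : {set 'I_(width k)} | odd #|W| == b (+) sigma)
      `|\sum_(j < k) 2 * sgn R W (widen_ord (leq_width k) j) * z (tnth l j) - \sum_j sgn R W j| `^ p
    + omega `^ p * \sum_(j < k) `|2 * z (tnth l j) - 1| `^ p.
Proof.
move=> omega_ge0; rewrite /constraint_rows /templates map_cat big_cat /=; congr (_ + _).
  rewrite -map_comp big_map big_filter big_enum_cond /=; apply: eq_bigr => W _.
  by rewrite gadget_row_value.
rewrite -map_comp big_map big_enum mulr_sumr; apply: eq_bigr => j _ /=.
by rewrite binary_row_value normrM powRM // ger0_norm.
Qed.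

End OneConstraint.

Hypothesis p_ge1 : 1 <= p.

Let p_gt0 : 0 < p. Proof. exact: lt_le_trans p_ge1. Qed.


Definition hi_cost : R := (abs_moment (uphalf k) p + `|altsum (uphalf k) (fun x => x `^ (p / 2))|) / 2.
Definition lo_cost : R := (abs_moment (uphalf k) p - `|altsum (uphalf k) (fun x => x `^ (p / 2))|) / 2.
(** [altsum] is the even half minus the odd half, so the odd sign vectors are cheaper when it is
    nonnegative. *)
Definition cheap_parity : bool := 0 <= altsum (uphalf k) (fun x => x `^ (p / 2)).

Lemma half_momentE b :
  half_moment p (uphalf k) b = if b == cheap_parity then lo_cost else hi_cost.
Proof.
have e1 := half_momentD p (uphalf k); have e2 := half_momentB p (uphalf k).
rewrite /hi_cost /lo_cost /cheap_parity -e1 -e2.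
case: b; rewrite ?(eqb_id, eqbF_neg).
- by case: ger0P => h; field.
- by case: ger0P => h /=; field.
Qed.

Lemma binary_cost omega rad n (c : k.-tuple 'I_n * bool) (x : {ffun 'I_n -> bool}) :
  0 <= omega ->
  \sum_(r <- constraint_rows (templates k cheap_parity) (map val c.1, c.2))
    `|row_value (constants omega rad) r (fun i => (x i)%:R)| `^ p
  = (if sat_parity x c then lo_cost else hi_cost) + k%:R * omega `^ p.
Proof.
case: c => l b o0; rewrite constraint_cost //=; congr (_ + _); last first.
  have n1 (v : bool) : `|2 * v%:R - 1| = 1 :> R.
    have e1 : 2 - 1 = 1 :> R by lra.
    by case: v; rewrite ?mulr1 ?e1 ?normr1 // mulr0 sub0r normrN1.
  by under eq_bigr do rewrite n1 powR1; rewrite sumr_const card_ord mulrC.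
(* The negative set of the padded y: positions whose variable is true, the padding being
   positive. *)
pose Y := [set j : 'I_(width k) | (if insub (val j) is Some j' then x (tnth l j') else false)].
have Yw j : (widen_ord (leq_width k) j \in Y) = x (tnth l j).
  by rewrite inE /= insubT // => jk; congr (x (tnth l _)); exact: val_inj.
have oY : odd #|Y| = \big[addb/false]_(j < k) x (tnth l j).
  rewrite -sum1_card big_mkcond /=.
  transitivity (\big[addb/false]_j (j \in Y)).
    by elim/big_rec2: _ => // j b' n' _ <-; rewrite oddD; case: (j \in Y).
  under [RHS]eq_bigr do rewrite -Yw.
  rewrite (bigID (fun j : 'I_(width k) => (j < k)%N)) /= [X in _ (+) X]big1 ?addbF.
    by rewrite (big_ord_narrow (leq_width k)).
  by move=> j jk; rewrite inE insubF //; exact: negbTE.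
have -> : sat_parity x (l, b) = (b (+) cheap_parity (+) odd #|Y| == cheap_parity).
  by rewrite /sat_parity /= -oY; case: (odd _); case: b; case: cheap_parity.
rewrite -half_momentE -half_moment_symdiff; apply: eq_bigr => W _.
rewrite -normrN opprB; congr (`|_| `^ p).
have -> : \sum_(j < k) 2 * sgn R W (widen_ord (leq_width k) j) * (x (tnth l j))%:R
   = \sum_(j < width k) 2 * sgn R W j * (j \in Y)%:R.
  under eq_bigr do rewrite -Yw.
  rewrite [RHS](bigID (fun j : 'I_(width k) => (j < k)%N)) /= [X in _ + X]big1 ?addr0.
    by rewrite (big_ord_narrow (leq_width k)).
  by move=> j jk; rewrite inE insubF ?mulr0 //; exact: negbTE.
rewrite -sumrB; apply: eq_bigr => j _; rewrite [sgn R Y j]/sgn.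
by case: (j \in Y); rewrite /= ?expr1 ?expr0 ?mulr1 ?mulr0; ring.
Qed.

(** An odd integer has absolute value at least 1. *)
Lemma int_dist_half (a : int) : 1 <= `|2 * a%:~R - 1| :> R.
Proof.
have -> : 2 * a%:~R - 1 = (2 * a - 1)%:~R :> R by rewrite rmorphB rmorphM.
by rewrite -intr_norm (ler_int R 1); lia.
Qed.

Lemma int_dist_half3 (a : int) : a != 0 -> a != 1 -> 3 <= `|2 * a%:~R - 1| :> R.
Proof.
move=> a0 a1; have -> : 2 * a%:~R - 1 = (2 * a - 1)%:~R :> R by rewrite rmorphB rmorphM.
by rewrite -intr_norm (ler_int R 3); lia.
Qed.

(** If all coordinates are binary, both sides agree. Otherwise the gadget may cost nothing, but one
    binary row costs at least 3^p omega^p instead of omega^p, an excess of [hi_cost], and the others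
    at least omega^p each. *)
Lemma int_cost omega rad n (c : k.-tuple 'I_n * bool) (z : 'I_n -> int) :
  0 <= omega -> omega `^ p * (3 `^ p - 1) = hi_cost ->
  (if sat_parity [ffun i => z i == 1] c then lo_cost else hi_cost) + k%:R * omega `^ p <=
  \sum_(r <- constraint_rows (templates k cheap_parity) (map val c.1, c.2))
    `|row_value (constants omega rad) r (fun i => (z i)%:~R)| `^ p.
Proof.
case: c => l b o0 oE.
case: (boolP [forall j, (z (tnth l j) == 0) || (z (tnth l j) == 1)]) => [/forallP bin|].
  rewrite -(binary_cost rad) // !constraint_cost //= le_eqVlt; apply/orP; left; apply/eqP.
  have e j : ((z (tnth l j)) %:~R : R) = ([ffun i => z i == 1] (tnth l j))%:R.
    by rewrite ffunE; case/orP: (bin j) => /eqP ->.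
  by congr (_ + _ * _); apply: eq_bigr => W _; [under [in RHS]eq_bigr do rewrite e | rewrite e].
move=> /forallPn[j0]; rewrite negb_or => /andP[z0 z1].
rewrite constraint_cost //=.
apply: (@le_trans _ _ (hi_cost + k%:R * omega `^ p)).
  rewrite lerD2r; case: ifP => // _; rewrite /lo_cost /hi_cost ler_pM2r ?invr_gt0 //.
  by rewrite lerD2l (le_trans _ (normr_ge0 _)) // oppr_le0.
rewrite -[leLHS]add0r; apply: lerD.
  by apply: sumr_ge0 => W _; exact: powR_ge0.
rewrite -oE [_ * omega `^ p]mulrC -mulrDr ler_wpM2l ?powR_ge0 //.
rewrite (bigD1 j0) //= addrAC -addrA; apply: lerD.
  apply: ge0_ler_powR; rewrite ?nnegrE ?(ltW p_gt0) //.
  exact: int_dist_half3.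
apply: (@le_trans _ _ (\sum_(j < k | j != j0) 1)).
  have : \sum_(j < k) 1 = k%:R :> R by rewrite sumr_const card_ord.
  by rewrite (bigD1 j0) //= => h; lra.
have e1 : 1 `^ p = 1 :> R by rewrite powR1.
apply: ler_sum => j _; rewrite -[leLHS]e1.
by apply: ge0_ler_powR; rewrite ?nnegrE ?(ltW p_gt0) // int_dist_half.
Qed.

End Costs.

(** * The lattice of an instance *)

Section InstanceCost.
Variable R : realType.
Variables (p : R) (k : nat).

Lemma lit_val_const (theta : seq R) q : lit_val p theta (const_literal q) = theta`_q.
Proof. by rewrite /lit_val /= expr0 !mul1r powR1 mul1r. Qed.

Lemma sum_instance_rows T h n cs (F : row_indices -> R) :
  \sum_(x <- instance_rows T h n cs) F x
  = \sum_(i < n) F (unused_row h cs i) + \sum_(c <- cs) \sum_(x <- constraint_rows T c) F x.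
Proof.
rewrite /instance_rows big_cat /= big_map; congr (_ + _).
  by rewrite -(big_mkord xpredT (fun i => F (unused_row h cs i))) /index_iota subn0.
by rewrite (perm_big _ (permEl (perm_rev _))) big_flatten /= big_map.
Qed.

Lemma unused_row_value omega rad n cs (i : 'I_n) (z : 'I_n -> R) :
  row_value (constants k omega rad) (unused_row (table_center k) cs i) z
  = (~~ occurs cs i)%:R * z i.
Proof.
have t0 : (constants k omega rad)`_(table_center k) = 0.
  by rewrite -[X in nth _ _ X]add0n constants0 ?subrr ?mulr0 //; lia.
have t1 : (constants k omega rad)`_(table_center k).+1 = 1.
  rewrite -[X in nth _ _ X]add0n constants0; last by rewrite /table_center; lia.
  by rewrite mul1r -(natr1 (table_center k)) addrC addKr.
move: (table_center k) t0 t1 => h t0 t1; rewrite /row_value /= t0 subr0 (bigD1 i) //= eqxx /= big1 ?addr0.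
  by case: ifP => // _; rewrite ?t0 ?t1.
by move=> j ji; rewrite (inj_eq val_inj) (negbTE ji) t0 mul0r.
Qed.

Lemma rows_cvp_dist (theta : seq R) n rows m rad (z : 'cV[int]_n) :
  let J := map_cvp (lit_val p theta) (rows_cvp n rows m rad) in
  lpnorm p (cvp_basis J *m map_mx intr z - cvp_target J)
  = (\sum_(x <- rows) `|row_value theta x (fun i : 'I_n => (z i 0)%:~R)| `^ p) `^ p^-1.
Proof.
rewrite /lpnorm /=; congr (_ `^ _).
rewrite [RHS]big_tnth; apply: eq_bigr => r _; congr (`|_| `^ _).
rewrite !mxE /row_value lit_val_const; congr (_ - _).
by apply: eq_bigr => j _; rewrite !mxE lit_val_const.
Qed.

Variable I : parity_inst k.
Notation n := (nvars I).
Notation cs := (plain_constraints I).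

Lemma instance_cost omega rad sigma (z : 'I_n -> R) :
  \sum_(x <- instance_rows (templates k sigma) (table_center k) n cs)
    `|row_value (constants k omega rad) x z| `^ p
  = \sum_(i < n) `|(~~ occurs cs i)%:R * z i| `^ p
    + \sum_(c <- constraints I) \sum_(x <- constraint_rows (templates k sigma) (map val (tval c.1), c.2))
        `|row_value (constants k omega rad) x z| `^ p.
Proof.
rewrite sum_instance_rows; congr (_ + _).
  by apply: eq_bigr => i _; rewrite unused_row_value.
by rewrite /plain_constraints big_map.
Qed.

(** A vector killed by the basis has the row values of 0. The row of a variable that occurs nowhere,
    or a binary row of one that occurs, then forces its coordinate to be 0. *)
Lemma reduction_rank omega rad sigma : 0 < omega ->
  \rank (cvp_basis (map_cvp (lit_val p (constants k omega rad))
    (reduction (templates k sigma) (table_center k) ((table_center k).*2.+1).*2 I))) = n.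
Proof.
move=> o0; set B := cvp_basis _.
rewrite -mxrank_tr; apply/eqP; rewrite -[_ == _]/(row_free _).
apply: inj_row_free => v vB; apply/rowP => i; rewrite mxE.
pose v0 : 'I_n -> R := v 0; change (v0 i = 0).
have rowv (x : row_indices) : x \in instance_rows (templates k sigma) (table_center k) n cs ->
   \sum_(j < n) (constants k omega rad)`_(x.1 j) * v0 j = 0.
  move=> /seq_tnthP[r ->]; move/rowP: vB => /(_ r); rewrite !mxE => vB.
  rewrite -[RHS]vB; apply: eq_bigr => j _; rewrite !mxE lit_val_const mulrC; congr (_ * nth _ _ _).
have zero_target (x : row_indices) : x \in instance_rows (templates k sigma) (table_center k) n cs ->
   row_value (constants k omega rad) x v0 = row_value (constants k omega rad) x (fun _ : 'I_n => 0).
  move=> /rowv e; rewrite /row_value e; congr (_ - _).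
  by rewrite big1 // => j _; rewrite mulr0.
case: (boolP (occurs cs i)) => oi; last first.
  have := zero_target (unused_row (table_center k) cs i).
  rewrite !unused_row_value oi mulr0 mul1r; apply.
  by rewrite /instance_rows mem_cat map_f // mem_iota /= add0n.
case/hasP: oi => c /mapP[c0 c0I ->] /= /mapP[i' /tnthP[j ->] e].
have := zero_target (tmpl_row (binary_tmpl j) (map val (tval c0.1))).
rewrite !binary_row_value mulr0 => /(_ _)/wrap[].
  rewrite /instance_rows mem_cat; apply/orP; right.
  rewrite mem_rev; apply/flattenP.
  exists (constraint_rows (templates k sigma) (map val (tval c0.1), c0.2)).
    by apply: map_f; apply/mapP; exists c0.
  rewrite /constraint_rows /templates map_cat mem_cat -[X in _ || (_ \in X)]map_comp.
  by apply/orP; right; apply/mapP; exists j; rewrite ?mem_enum.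
have -> : tnth c0.1 j = i by exact: val_inj.
move/(mulfI (lt0r_neq0 o0)) => h; lra.
Qed.

Definition sat_count (x : {ffun 'I_n -> bool}) : nat := count (sat_parity x) (constraints I).

Lemma sum_sat (x : {ffun 'I_n -> bool}) (lo hi w : R) :
  \sum_(c <- constraints I) ((if sat_parity x c then lo else hi) + w)
  = (w + hi) * (size (constraints I))%:R - (hi - lo) * (sat_count x)%:R.
Proof.
rewrite /sat_count; elim: (constraints I) => [|c s IH] /=.
  by rewrite big_nil !mulr0 subr0.
rewrite big_cons IH natrD -natr1; case: ifP => _; rewrite /=; ring.
Qed.

Lemma sat_ext (x y : {ffun 'I_n -> bool}) c : c \in constraints I ->
  (forall i : 'I_n, occurs cs i -> x i = y i) -> sat_parity x c = sat_parity y c.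
Proof.
move=> cI xy; rewrite /sat_parity; congr (_ == _); apply: eq_bigr => j _; apply: xy.
apply/hasP; exists (map val (tval c.1), c.2); last by rewrite /= map_f // mem_tnth.
by apply/mapP; exists c.
Qed.

(** The maximum is attained by an assignment; [0 < c] excludes the default value 0 of the big
    maximum. *)
Lemma parity_val_ge c : 0 < c -> (0 < size (constraints I))%N -> c <= parity_val R I ->
  exists x, c * (size (constraints I))%:R <= (sat_count x)%:R.
Proof.
move=> c0 m0 cv; apply: contrapT => nx.
suff : parity_val R I < c by rewrite ltNge cv.
rewrite /parity_val; elim/big_ind: _ => //.
  by move=> a b ac bc; rewrite gt_max ac.
move=> x _; rewrite ltNge; apply/negP => h; apply: nx; exists x.
by move: h; rewrite ler_pdivlMr ?ltr0n.
Qed.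

End InstanceCost.

(** * The gap *)

Section Gap.
Variable R : realType.
Variables (p : R) (k : nat) (s c : R).
Hypothesis p_ge1 : 1 <= p.
Hypothesis p_not_even : forall z : int, p <> 2 * z%:~R.
Hypothesis k_gt2 : (2 < k)%N.
Hypothesis k_gtp : p < k%:R.
Hypothesis s_gt : 1 / 2 < s.
Hypothesis s_le_c : s <= c.
Hypothesis c_lt1 : c < 1.

Notation hi := (hi_cost p k).
Notation lo := (lo_cost p k).
Notation A := (abs_moment (uphalf k) p).
Notation E := (`|altsum (uphalf k) (fun x => x `^ (p / 2))|).

(* A coordinate outside {0, 1} costs at least [(3^p - 1) * binary_weight] more, *)
(* which is the whole cost of a violated gadget. *)
Definition binary_weight : R := hi / (3 `^ p - 1).
(** The p-th power of the distance, per constraint, when a fraction t is satisfied. *)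
Definition threshold (t : R) : R := k%:R * binary_weight + hi - (hi - lo) * t.
Definition gap : R := (threshold s / threshold c) `^ p^-1.
Definition parity_to_cvp : parity_inst k -> cvp_inst literal :=
  reduction (templates k (cheap_parity p k)) (table_center k) ((table_center k).*2.+1).*2 (k:=k).
Definition cvp_constants : seq R :=
  constants k (binary_weight `^ p^-1) (threshold c `^ p^-1).

Let p0 : 0 < p. Proof. exact: lt_le_trans p_ge1. Qed.
Let k0 : 0 < k%:R :> R. Proof. by rewrite ltr0n; lia. Qed.

(** For M = [uphalf k], 6M <= 3k + 3 <= 4k since k >= 3. *)
Let bias := @parity_bias R p k (uphalf k) p_ge1 p_not_even k_gtp
  ltac:(lia) ltac:(lia).

Let E_gt0 : 0 < E. Proof. by case: bias. Qed.
Let E_le_A : E <= A. Proof. exact: altsum_le_abs_moment. Qed.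
Let hi_lo : hi - lo = E. Proof. rewrite /hi_cost /lo_cost; lra. Qed.
Let hi_gt0 : 0 < hi. Proof. by rewrite /hi_cost divr_gt0 //; move: E_gt0 E_le_A; lra. Qed.
Let lo_ge0 : 0 <= lo. Proof. by rewrite /lo_cost divr_ge0 //; move: E_gt0 E_le_A; lra. Qed.

Let pow3 : 2 <= 3 `^ p - 1 :> R.
Proof. by have := @le1r_powR R 3 p; rewrite ler1n => /(_ isT p_ge1); lra. Qed.

Let w_gt0 : 0 < binary_weight. Proof. by rewrite divr_gt0 //; move: pow3; lra. Qed.

Let threshold_gt0 t : t <= 1 -> 0 < threshold t.
Proof.
move=> t1; rewrite /threshold hi_lo.
have : E * t <= E by rewrite ler_piMr // ltW.
have : 0 < k%:R * binary_weight by rewrite mulr_gt0.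
by move: hi_lo lo_ge0; lra.
Qed.

Let c_le1 : c <= 1. Proof. exact: ltW. Qed.
Let s_le1 : s <= 1. Proof. exact: le_trans c_le1. Qed.
Let c_gt0 : 0 < c. Proof. by move: s_gt s_le_c; lra. Qed.

Let powRpV (x : R) : 0 <= x -> (x `^ p^-1) `^ p = x.
Proof. by move=> x0; rewrite -powRrM mulVf ?gt_eqF // powRr1. Qed.

Let omega_gt0 : 0 < binary_weight `^ p^-1. Proof. exact: powR_gt0. Qed.

(** With D = [threshold], the gap is at least 1 + ln(D s / D c) / p, hence at least 1 + (1 - D c / D
    s) / p = 1 + E (c - s) / (p D s). The bounds on D s and on E / A give twice the required
    excess. *)
Lemma gap_ge : 1 + (c - s) * (`|sin (pi * p / 2)| / (4 * p ^+ 3 * k%:R))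
  * ((2 * p / (expR 1 ^+ 2 * pi ^+ 2 * k%:R)) `^ ((p + 1) / 2)) <= gap.
Proof.
have [b _] := bias; move: b.
set S := `|sin _|; set X := _ `^ ((p + 1) / 2) => b.
have S0 : 0 <= S by exact: normr_ge0.
have X0 : 0 <= X by exact: powR_ge0.
have A0 : 0 < A by exact: lt_le_trans E_gt0 E_le_A.
have Dc : 0 < threshold c by exact: threshold_gt0.
have Ds : 0 < threshold s by exact: threshold_gt0.
have k3 : 3 <= k%:R :> R by rewrite ler_nat.
(* The binary rows cost at most k A / 2 as 3^p - 1 >= 2; the gadget part is at most [hi] - E / 2 = A
   / 2 <= k A / 6, by s > 1/2 and k >= 3. *)
have Dsle : threshold s <= 2 * k%:R * A / 3.
  have w_le : binary_weight <= A / 2.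
    rewrite ler_pdivrMr; last by move: pow3; lra.
    have hiA : hi <= A by rewrite /hi_cost ler_pdivrMr //; move: E_le_A; lra.
    apply: (le_trans hiA); rewrite -mulrA ler_peMr ?(ltW A0) //; move: pow3; lra.
  have kw : k%:R * binary_weight <= k%:R * (A / 2) by rewrite ler_pM2l.
  have Es : E / 2 <= E * s by rewrite (ler_pM2l E_gt0) -div1r ltW.
  have A3 : 3 * A <= k%:R * A by rewrite ler_pM2r.
  rewrite /threshold hi_lo /hi_cost; lra.
have ratio : threshold s - threshold c = E * (c - s) by rewrite /threshold hi_lo; ring.
have cs : 0 <= c - s by rewrite subr_ge0.
apply: (@le_trans _ _ (1 + p^-1 * (E * (c - s) / threshold s))).
  rewrite lerD2l.
  apply: (@le_trans _ _ (p^-1 * (E * (c - s) / (2 * k%:R * A / 3)))); last first.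
    rewrite ler_wpM2l ?invr_ge0 ?(ltW p0) // ler_wpM2l ?mulr_ge0 ?(ltW E_gt0) //.
    by rewrite lef_pV2 ?posrE // divr_gt0 ?mulr_gt0.
  rewrite (_ : p^-1 * _ = (c - s) * (3 / (2 * p * k%:R * A) * E)); last first.
    by field; rewrite !gt_eqF.
  rewrite -mulrA ler_wpM2l //.
  apply: (@le_trans _ _ (3 / (2 * p * k%:R * A) * (A * (S / (3 * p ^+ 2)) * X))).
    rewrite (_ : 3 / _ * _ = 2 * (S / (4 * p ^+ 3 * k%:R) * X)); last first.
      by field; rewrite !gt_eqF.
    rewrite ler_peMl ?ler1n // mulr_ge0 // divr_ge0 // !mulr_ge0 ?exprn_ge0 ?(ltW p0) ?(ltW k0) //.
  by rewrite ler_wpM2l // divr_ge0 // !mulr_ge0 // ltW.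
have -> : gap = expR (p^-1 * ln (threshold s / threshold c)).
  by rewrite /gap /powR gt_eqF ?divr_gt0.
apply: le_trans (expR_ge1Dx _).
rewrite lerD2l ler_wpM2l ?invr_ge0 ?(ltW p0) // -ratio.
have r0 : 0 < threshold c / threshold s by rewrite divr_gt0.
have := @le_ln1Dx R (threshold c / threshold s - 1).
rewrite [1 + _]addrC subrK => /(_ _)/wrap[]; first lra.
rewrite -[threshold c / _]invf_div lnV ?posrE ?divr_gt0 // invf_div.
have -> : (threshold s - threshold c) / threshold s = 1 - threshold c / threshold s.
  by field; rewrite gt_eqF.
by lra.
Qed.

(** * YES and NO instances *)

Section OneInstance.
Variable I : parity_inst k.
Hypothesis size_gt0 : (0 < size (constraints I))%N.
Notation J := (map_cvp (lit_val p cvp_constants) (parity_to_cvp I)).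
Notation N := ((size (constraints I))%:R : R).

Let N0 : 0 < N. Proof. by rewrite ltr0n. Qed.

Lemma radiusE : cvp_radius J = (threshold c * N) `^ p^-1.
Proof.
have lit theta bs q : lit_val p theta (Literal false [:: true] bs q)
    = (nat_of_bits bs)%:R `^ p^-1 * theta`_q :> R by rewrite /lit_val /= expr0 !mul1r.
apply: (etrans (lit _ _ _)); rewrite bits_of_natK constants_rad.
rewrite powRM ?(ltW N0) 1?mulrC //; by apply: ltW; exact: threshold_gt0.
Qed.

Lemma parity_to_cvp_wf : cvp_wf J.
Proof.
split; first exact: reduction_rank.
by rewrite radiusE powR_gt0 // mulr_gt0 // threshold_gt0.
Qed.

Lemma parity_to_cvp_yes : c <= parity_val R I ->
  dist_lp p (lattice (cvp_basis J)) (cvp_target J) <= cvp_radius J.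
Proof.
move=> /(parity_val_ge c_gt0 size_gt0)[x hx].
(* Variables that occur nowhere are set to 0, so that their rows cost nothing. *)
pose y := [ffun i => x i && occurs (plain_constraints I) i].
pose z : 'cV[int]_(nvars I) := \col_i (y i : nat)%:Z.
have hy : sat_count y = sat_count x.
  apply: eq_in_count => C CI; apply: (sat_ext CI) => i oi.
  by rewrite ffunE oi andbT.
apply: (@le_trans _ _ (lpnorm p (cvp_basis J *m map_mx intr z - cvp_target J))).
  apply: ge_inf; last by exists (cvp_basis J *m map_mx intr z) => //; exists z.
  by exists 0 => _ [v _ <-]; exact: powR_ge0.
rewrite rows_cvp_dist radiusE.
have zE (i : 'I_(nvars I)) : ((z i 0)%:~R : R) = (y i)%:R by rewrite mxE.
have -> : (fun i => (z i 0)%:~R) = (fun i : 'I_(nvars I) => (y i)%:R : R) by apply/funext.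
apply: ge0_ler_powR; rewrite ?invr_ge0 ?nnegrE ?(ltW p0) //.
- by apply: sumr_ge0 => r _; exact: powR_ge0.
- by rewrite mulr_ge0 ?(ltW N0) // ltW // threshold_gt0.
rewrite instance_cost. set U := (X in X + _).
have -> : U = 0.
  apply: big1 => i _; rewrite ffunE; case: occurs; rewrite ?andbF ?mulr0 ?mul0r normr0 powR0 //;
  by rewrite gt_eqF.
rewrite add0r.
under eq_bigr do rewrite binary_cost ?(ltW omega_gt0) //.
rewrite sum_sat hy powRpV ?(ltW w_gt0) // /threshold hi_lo.
rewrite [leRHS]mulrBl lerD2l lerN2 -mulrA ler_pM2l //.
Qed.

(** Rounding shows that every lattice vector costs at least [threshold] of the value. The strict
    inequality comes from the value being below s, so passing to the infimum does no harm. *)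
Lemma parity_to_cvp_no : parity_val R I < s ->
  gap * cvp_radius J < dist_lp p (lattice (cvp_basis J)) (cvp_target J).
Proof.
move=> hv.
have Dc : 0 < threshold c by exact: threshold_gt0.
have Ds : 0 < threshold s by exact: threshold_gt0.
have -> : gap * cvp_radius J = (threshold s * N) `^ p^-1.
  rewrite radiusE /gap -powRM; first last.
  - by rewrite mulr_ge0 ?(ltW N0) ?(ltW Dc).
  - by rewrite divr_ge0 ?(ltW Ds) ?(ltW Dc).
  by rewrite mulrA divfK // gt_eqF.
have v0 : 0 <= parity_val R I.
  rewrite /parity_val; elim/big_ind: _ => // a b a0 b0.
  by rewrite le_max a0.
have v1 : parity_val R I <= 1 by apply: ltW; exact: lt_le_trans hv s_le1.
apply: (@lt_le_trans _ _ ((threshold (parity_val R I) * N) `^ p^-1)).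
  apply: gt0_ltr_powR; rewrite ?invr_gt0 ?nnegrE ?mulr_ge0 ?(ltW N0) ?(ltW Ds) //.
    by rewrite ltW // threshold_gt0.
  by rewrite ltr_pM2r // /threshold hi_lo ltrD2l ltrN2 ltr_pM2l.
apply: lb_le_inf.
  exists (lpnorm p (cvp_basis J *m map_mx intr 0 - cvp_target J)).
  by exists (cvp_basis J *m map_mx intr 0) => //; exists 0.
move=> _ [_ [z _ <-] <-]; rewrite rows_cvp_dist.
apply: ge0_ler_powR; rewrite ?invr_ge0 ?nnegrE ?(ltW p0) //.
- by rewrite mulr_ge0 ?(ltW N0) // ltW // threshold_gt0.
- by apply: sumr_ge0 => r _; exact: powR_ge0.
rewrite instance_cost; set U := \sum_(i < _) _.
have U0 : 0 <= U by apply: sumr_ge0 => i _; exact: powR_ge0.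
rewrite -[leLHS]add0r; apply: lerD => //.
pose x := [ffun i => z i 0 == 1].
apply: (@le_trans _ _ (\sum_(C <- constraints I)
   ((if sat_parity x C then lo else hi) + k%:R * (binary_weight `^ p^-1) `^ p))); last first.
  apply: ler_sum => C _; apply: int_cost => //; first exact: ltW.
  by rewrite powRpV ?(ltW w_gt0) // /binary_weight divfK // gt_eqF //; move: pow3; lra.
rewrite sum_sat powRpV ?(ltW w_gt0) // /threshold hi_lo.
rewrite [leLHS]mulrBl lerD2l lerN2 -mulrA ler_pM2l //.
rewrite -ler_pdivrMr // /parity_val; exact: (le_bigmax _ (fun x => (count (sat_parity x) (constraints I))%:R / N)).
Qed.

End OneInstance.
End Gap.

(** The largest index, 3 [table_center] + 2, is the target of a binary template. *)
Lemma templates_tmpl_ok k sigma :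
  templates_ok (templates k sigma) (3 * table_center k + 2) k
    (size (templates k sigma true) + size (templates k sigma false)).
Proof.
move=> b; split; last by case: b; lia.
have wk : (width k <= k.+1)%N by rewrite /width; lia.
rewrite /templates all_cat !all_map; apply/andP; split; apply/allP => x _ /=.
  by rewrite /tmpl_ok /= size_map size_enum_ord /table_center; lia.
by rewrite /tmpl_ok /= size_map size_enum_ord /table_center; lia.
Qed.

Theorem theorem4p1 (R : realType) (p : R) (k : nat) (s c : R)
    (p_ge1 : 1 <= p) (p_not_even : forall z : int, p <> 2 * z%:~R)
    (k_gt2 : (2 < k)%N) (k_gtp : p < k%:R)
    (s_gt : 1 / 2 < s) (s_le_c : s <= c) (c_lt1 : c < 1) :
  exists gamma : R,
    1 + (c - s) * (`|sin (pi * p / 2)| / (4 * p ^+ 3 * k%:R))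
        * ((2 * p / (expR 1 ^+ 2 * pi ^+ 2 * k%:R)) `^ ((p + 1) / 2)) <= gamma
    /\ exists (theta : seq R) (f : parity_inst k -> cvp_inst literal),
         karp_reduction (gap_parity k s c) (gap_cvp p gamma)
           (@enc_parity k) enc_cvp (map_cvp (lit_val p theta)) f
         /\ forall I : parity_inst k, cvp_rank (f I) = nvars I.
Proof.
exists (gap p k s c); split; first exact: gap_ge.
exists (cvp_constants p k c), (@parity_to_cvp R p k); split; last by [].
split.
- by apply: reduction_poly_time (templates_tmpl_ok _ _) _; rewrite /table_center; lia.
- by move=> I m0; exact: (parity_to_cvp_wf p_ge1 p_not_even k_gt2 k_gtp s_gt).
- by move=> I [m0 v]; split; [exact: (parity_to_cvp_wf p_ge1 p_not_even k_gt2 k_gtp s_gt) | exact: (parity_to_cvp_yes p_ge1 p_not_even k_gt2 k_gtp s_gt)].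
- by move=> I [m0 v]; split; [exact: (parity_to_cvp_wf p_ge1 p_not_even k_gt2 k_gtp s_gt) | exact: parity_to_cvp_no].
Qed.
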